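(* Let $(X,d,\mu)$ be a space of homogeneous type and $\mathcal{D}$ a dyadic system on $X$ with parameters $c_0$, $C_0$ and $\delta$. Let $\alpha\ge \frac{3c_d^2}{\delta}$, let $1\le q,r<\infty$, $s=\max(q,r)$, and let $\vec f:X\to\mathbb{R}^n$ be a boundedly supported function with $|\vec f|\in L^s(X)$. Let $T$ be a linear operator and assume that there exist non-increasing functions $\psi,\phi:(0,1)\to[0,\infty)$ such that for every ball $B$ and every boundedly supported $g\in L^s(X,\mathbb{R})$, $$\mu\left(\{x\in B:|T(g\chi_B)(x)|>\psi(\lambda)\langle g\rangle_{q,B}\}\right)\le\lambda\mu(B)\qquad(0<\lambda<1)$$ and $$\mu\left(\{x\in B:\mathcal{M}^{\#}_{T,\alpha}(g\chi_B)(x)>\phi(\lambda)\langle g\rangle_{r,B}\}\right)\le\lambda\mu(B)\qquad(0<\lambda<1).$$ Then there exists a $\frac12$-sparse family $\mathcal{S}\subset\mathcal{D}$ such that for a.e. $x\in X$ $$T\vec f(x)\in c_{n,d}\,c_T\sum_{Q\in\mathcal{S}}\langle\langle\vec f\rangle\rangle_{s,\alpha Q}\,\chi_Q(x).$$ In other words, for a.e. $x\in X$, $$T\vec f(x)=c_{n,d}\,c_T\sum_{Q\in\mathcal{S}}\frac{1}{\mu(\alpha Q)}\int_{\alpha Q}\vec f(y)k_Q(x,y)\,d\mu(y)\,\chi_Q(x),$$ where the $k_Q$ are measurable scalar functions on $Q\times \alpha Q$ with $$\Big\|\,\|k_Q(x,y)\|_{L^{s'}(\alpha Q,\frac{d\mu(y)}{\mu(\alpha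 Q)})}\Big\|_{L^\infty(Q,d\mu(x))}\le 1 .$$ Furthermore, there exist $0<\tilde c_0\le \tilde C_0<\infty$, $0<\tilde\delta<1$ and $m\in\mathbb{N}$ such that there are dyadic systems $\mathcal{D}_1,\dots,\mathcal{D}_m$ with parameters $\tilde c_0,\tilde C_0,\tilde\delta$ and $m$ sparse families $\mathcal{S}_j\subset\mathcal{D}_j$ such that for a.e. $x\in X$ $$T\vec f(x)=c_{n,d}\,c_T\sum_{j=1}^m\sum_{Q\in\mathcal{S}_j}\frac{1}{\mu(Q)}\int_Q\vec f(y)k_Q(x,y)\,d\mu(y)\,\chi_Q(x),$$ where the $k_Q$ are measurable scalar functions on $Q\times Q$ with $$\Big\|\,\|k_Q(x,y)\|_{L^{s'}(Q,\frac{d\mu(y)}{\mu(Q)})}\Big\|_{L^\infty(Q,d\mu(x))}\le 1 .$$ Here $c_{n,d}$ and $c_T$ denote constants (possibly different in the two representations) not depending on $\vec f$: $c_{n,d}$ depends on $n$ and on the geometric data (the space, $\alpha$ and the dyadic systems), and $c_T$ depends on $T$ through $\psi,\phi$ and $s$.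
   Context: Space of homogeneous type $(X,d,\mu)$: $X$ is a set with a quasi-metric $d$, i.e. $d(x,y)\le c_d(d(x,z)+d(z,y))$ for some $c_d\ge1$, and a Borel measure $\mu$ with $\mu(B(x,2\rho))\le c_\mu\mu(B(x,\rho))$, where $B(x,\rho)=\{y:d(x,y)<\rho\}$. All balls are Borel sets with $0<\mu(B)<\infty$, and the Lebesgue differentiation theorem holds. A ball carries its center and radius, and for $B=B(x,\rho)$, $\alpha B=B(x,\alpha\rho)$. Dyadic system with parameters $0<c_0\le C_0<\infty$, $\delta\in(0,1)$: $\mathcal{D}=\bigcup_{k\in\mathbb{Z}}\mathcal{D}_k$, where $\mathcal{D}_k=\{Q_j^k\}_{j\in J_k}$ is a pairwise disjoint collection of measurable sets (''cubes'') with points $z_j^k$ (''centers'') such that (1) $X=\bigcup_{j\in J_k}Q_j^k$ for every $k$; (2) if $k\ge l$, $P\in\mathcal{D}_k$, $Q\in\mathcal{D}_l$, then $P\cap Q=\emptyset$ or $P\subseteq Q$; (3) $B(z_j^k,c_0\delta^k)\subseteq Q_j^k\subseteq B(z_j^k,C_0\delta^k)$. A cube carries its center and generation, and for $\alpha\ge1$, $\alpha Q_j^k:=B(z_j^k,\alpha C_0\delta^k)$ (a ball). $\mathcal{S}$ is $\eta$-sparse ($0<\eta<1$) if for every $Q\in\mathcal{S}$ there is a measurable $E_Q\subset Q$ with $\mu(E_Q)\ge\eta\mu(Q)$ and the sets $E_Q$ are pairwise disjoint; ''sparse'' means $\eta$-sparse for some $\eta\in(0,1)$. $\langle g\rangle_{s,Q}=\left(\frac1{\mu(Q)}\int_Q|g|^s\,d\mu\right)^{1/s}$.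 For $\vec f:X\to\mathbb{R}^n$, $\langle\langle\vec f\rangle\rangle_{s,Q}=\left\{\frac1{\mu(Q)}\int_Q\varphi\vec f\,d\mu:\ \|\varphi\|_{L^{s'}(Q,\frac{d\mu}{\mu(Q)})}\le1\right\}\subset\mathbb{R}^n$, where $\varphi$ ranges over scalar functions, $\frac1s+\frac1{s'}=1$ ($s'=\infty$ if $s=1$). Sums of sets are Minkowski sums. $T$ is a linear operator mapping boundedly supported functions in $L^s(X,\mathbb{R})$ to measurable scalar functions on $X$; it acts on vector valued functions coordinatewise: $T\vec f=\sum_{j=1}^nT(\langle\vec f,\vec e_j\rangle)\vec e_j$ for an orthonormal basis $\{\vec e_j\}$ of $\mathbb{R}^n$. ''Boundedly supported'' means vanishing outside some ball. $\mathcal{M}^{\#}_{T,\alpha}f(x)=\sup_{B\ni x}\operatorname{ess\,sup}_{y,z\in B}|T(f\chi_{X\setminus\alpha B})(y)-T(f\chi_{X\setminus\alpha B})(z)|$, the supremum over balls $B$ containing $x$. *)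

(* Defs.v *)
From HB Require Import structures.
From mathcomp Require Import all_boot all_order all_algebra.
From mathcomp Require Import finmap.
From mathcomp Require Import all_classical all_reals all_analysis.
From mathcomp Require Import ess_sup_inf.
From mathcomp Require summability.

Set Implicit Arguments.
Unset Strict Implicit.
Unset Printing Implicit Defensive.

Import Order.TTheory GRing.Theory Num.Theory.
Import numFieldNormedType.Exports.

Local Open Scope classical_set_scope.
Local Open Scope ring_scope.

(** * Spaces of homogeneous type *)

Definition quasi_metric (R : realType) (X : Type) (d : X -> X -> R) (cd : R)
    : Prop :=
  [/\ forall x y, 0 <= d x y,
      forall x y, d x y = 0 <-> x = y,
      forall x y, d x y = d y x,
      1 <= cd
    & forall x y z, d x y <= cd * (d x z + d z y)].

Definition qball (R : realType) (X : Type) (d : X -> X -> R) (x : X) (rho : R)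
    : set X :=
  [set y | d x y < rho].

(* The topology induced by [d]; the balls themselves need not be open. *)
Definition qopen (R : realType) (X : Type) (d : X -> X -> R) (U : set X)
    : Prop :=
  forall x, U x -> exists2 rho : R, 0 < rho & qball d x rho `<=` U.

Definition qlocally_integrable (R : realType) (disp : measure_display)
    (X : measurableType disp) (d : X -> X -> R)
    (mu : {measure set X -> \bar R}) (f : X -> R) : Prop :=
  measurable_fun [set: X] f /\
  forall x rho, 0 < rho -> mu.-integrable (qball d x rho) (EFin \o f).

Definition lebesgue_differentiation_property (R : realType)
    (disp : measure_display) (X : measurableType disp) (d : X -> X -> R)
    (mu : {measure set X -> \bar R}) : Prop :=
  forall f : X -> R, qlocally_integrable d mu f ->
  {ae mu, forall x,
    (fine (mu (qball d x rho)))^-1 * \int[mu]_(y in qball d x rho) f y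
      @[rho --> 0^'+] --> f x}.

(* The first field says that the sigma-algebra of [X] is the Borel one. *)
Record homogeneous_type (R : realType) (disp : measure_display)
    (X : measurableType disp) (d : X -> X -> R)
    (mu : {measure set X -> \bar R}) (cd cmu : R) : Prop := HomogeneousType {
  homogeneous_borel : @measurable disp X = <<s [set U | qopen d U] >> ;
  homogeneous_quasi_metric : quasi_metric d cd ;
  homogeneous_measurable_ball :
    forall x rho, 0 < rho -> measurable (qball d x rho) ;
  homogeneous_ball_gt0 :
    forall x rho, 0 < rho -> (0 < mu (qball d x rho))%E ;
  homogeneous_ball_lty :
    forall x rho, 0 < rho -> (mu (qball d x rho) < +oo)%E ;
  homogeneous_doubling : forall x rho, 0 < rho ->
    (mu (qball d x (2 * rho)) <= cmu%:E * mu (qball d x rho))%E ;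
  homogeneous_lebesgue : lebesgue_differentiation_property d mu
}.

(** * Dyadic systems and sparse families *)

(* Since a cube carries its center and its generation, the same set occurring
   in two generations gives two different cubes. *)
Record cube (X : Type) : Type := Cube {
  cube_set :> set X ;
  cube_center : X ;
  cube_gen : int
}.

(* A choice structure is needed to form finite sets of cubes. *)
HB.instance Definition _ (X : Type) := gen_eqMixin (cube X).
HB.instance Definition _ (X : Type) := gen_choiceMixin (cube X).

Record dyadic_system (R : realType) (disp : measure_display)
    (X : measurableType disp) (d : X -> X -> R) (c0 C0 delta : R)
    (D : set (cube X)) : Prop := DyadicSystem {
  dyadic_c0 : 0 < c0 ;
  dyadic_C0 : c0 <= C0 ;
  dyadic_delta : 0 < delta < 1 ;
  dyadic_measurable : forall Q : cube X, D Q -> measurable (Q : set X) ;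
  dyadic_disjoint : forall P Q : cube X, D P -> D Q ->
    cube_gen P = cube_gen Q -> P <> Q -> P `&` Q = set0 ;
  dyadic_cover : forall (k : int) (x : X),
    exists Q : cube X, [/\ D Q, cube_gen Q = k & (Q : set X) x] ;
  dyadic_nested : forall P Q : cube X, D P -> D Q ->
    (cube_gen Q <= cube_gen P)%R -> P `&` Q = set0 \/ P `<=` Q ;
  dyadic_inner : forall Q : cube X, D Q ->
    qball d (cube_center Q) (c0 * delta ^ cube_gen Q) `<=` Q ;
  dyadic_outer : forall Q : cube X, D Q ->
    Q `<=` qball d (cube_center Q) (C0 * delta ^ cube_gen Q)
}.

Definition cube_dilate (R : realType) (X : Type) (d : X -> X -> R)
    (C0 delta alpha : R) (Q : cube X) : set X :=
  qball d (cube_center Q) (alpha * C0 * delta ^ cube_gen Q).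

Definition eta_sparse (R : realType) (disp : measure_display)
    (X : measurableType disp) (mu : {measure set X -> \bar R}) (eta : R)
    (S : set (cube X)) : Prop :=
  exists E : cube X -> set X,
    [/\ forall Q, S Q -> measurable (E Q),
        forall Q, S Q -> E Q `<=` Q,
        forall Q, S Q -> (eta%:E * mu Q <= mu (E Q))%E
      & trivIset S E].

Definition sparse (R : realType) (disp : measure_display)
    (X : measurableType disp) (mu : {measure set X -> \bar R})
    (S : set (cube X)) : Prop :=
  exists2 eta : R, 0 < eta < 1 & eta_sparse mu eta S.

(** * Normalized norms and convex bodies *)

(* The norm of L^p(Q, mu / mu Q) for 0 < p <= +oo; the value at -oo is junk.
   For finite p this is the average <g>_{p,Q}.  The normalization of mu does
   not affect the essential supremum. *)
Definition avg_norm (R : realType) (disp : measure_display)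
    (X : measurableType disp) (mu : {measure set X -> \bar R}) (p : \bar R)
    (Q : set X) (g : X -> \bar R) : \bar R :=
  (match p with
   | r%:E => ((mu Q)^-1 * \int[mu]_(x in Q) (`|g x| `^ r)) `^ r^-1
   | _ => ess_sup mu (fun x => `|g x| * (\1_Q x)%:E)
   end)%E.

Definition avg_rV (R : realType) (disp : measure_display)
    (X : measurableType disp) (mu : {measure set X -> \bar R}) (n : nat)
    (Q : set X) (f : X -> 'rV[R]_n) : 'rV[R]_n :=
  \row_i ((fine (mu Q))^-1 * \int[mu]_(x in Q) f x ord0 i).

Definition convex_body (R : realType) (disp : measure_display)
    (X : measurableType disp) (mu : {measure set X -> \bar R}) (n : nat)
    (s : R) (Q : set X) (f : X -> 'rV[R]_n) : set 'rV[R]_n :=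
  [set v | exists phi : X -> R,
     [/\ measurable_fun Q phi,
         (avg_norm mu (hoelder_conjugate s%:E) Q (EFin \o phi) <= 1)%E
       & v = avg_rV mu Q (fun x => phi x *: f x)]].

(* [has_sum A v w]: the family (v i), i in A, is unconditionally summable, with
   sum w. *)
Definition has_sum (R : realType) (n : nat) (I : choiceType) (A : set I)
    (v : I -> 'rV[R]_n) (w : 'rV[R]_n) : Prop :=
  summability.partial_sum (patch (fun=> 0) A v) @ summability.totally --> w.

Definition scale_set (R : realType) (n : nat) (a : R) (K : set 'rV[R]_n)
    : set 'rV[R]_n :=
  [set a *: v | v in K].

Definition minkowski_sum (R : realType) (n : nat) (I : choiceType) (A : set I)
    (K : I -> set 'rV[R]_n) : set 'rV[R]_n :=
  [set w | exists2 v : I -> 'rV[R]_n,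
     forall i, A i -> K i (v i) & has_sum A v w].

(** * The operator and its maximal function *)

Definition boundedly_supported (R : realType) (X : Type) (d : X -> X -> R)
    (V : zmodType) (g : X -> V) : Prop :=
  exists (c : X) (rho : R), 0 < rho /\ forall x, ~ qball d c rho x -> g x = 0.

Definition bounded_Lfun (R : realType) (disp : measure_display)
    (X : measurableType disp) (d : X -> X -> R)
    (mu : {measure set X -> \bar R}) (s : R) (g : X -> R) : Prop :=
  boundedly_supported d g /\ g \in Lfun mu s%:E.

Definition enorm (R : realType) (n : nat) (v : 'rV[R]_n) : R :=
  Num.sqrt (\sum_i v ord0 i ^+ 2).

Definition bounded_Lfun_rV (R : realType) (disp : measure_display)
    (X : measurableType disp) (d : X -> X -> R)
    (mu : {measure set X -> \bar R}) (n : nat) (s : R) (f : X -> 'rV[R]_n)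
    : Prop :=
  [/\ boundedly_supported d f,
      forall i, measurable_fun [set: X] (fun x => f x ord0 i)
    & (fun x => enorm (f x)) \in Lfun mu s%:E].

(* Measurable functions are identified when they agree almost everywhere, so
   linearity is only required almost everywhere. *)
Definition linear_operator (R : realType) (disp : measure_display)
    (X : measurableType disp) (d : X -> X -> R)
    (mu : {measure set X -> \bar R}) (s : R) (T : (X -> R) -> (X -> R))
    : Prop :=
  (forall g, bounded_Lfun d mu s g -> measurable_fun [set: X] (T g)) /\
  (forall (a b : R) g h, bounded_Lfun d mu s g -> bounded_Lfun d mu s h ->
    {ae mu, forall x,
      T (fun y => a * g y + b * h y) x = a * T g x + b * T h x}).

(* The rows of [e]. *)
Definition orthonormal_basis (R : realType) (n : nat) (e : 'M[R]_n) : Prop :=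
  e *m e^T = 1%:M.

Definition dotv (R : realType) (n : nat) (u v : 'rV[R]_n) : R :=
  \sum_i u ord0 i * v ord0 i.

Definition vector_operator (R : realType) (X : Type) (n : nat)
    (T : (X -> R) -> (X -> R)) (e : 'M[R]_n) (f : X -> 'rV[R]_n) (x : X)
    : 'rV[R]_n :=
  \sum_j T (fun y => dotv (f y) (row j e)) x *: row j e.

Definition cutoff (R : realType) (X : Type) (A : set X) (g : X -> R) : X -> R :=
  fun x => g x * \1_A x.

(* The essential supremum of |h(y) - h(z)| over y, z in B, with respect to the
   product measure.  Sigma-finiteness is what the library's product measure
   asks for; it follows from [homogeneous_ball_lty], as X is a countable union
   of balls. *)
Definition ess_osc (R : realType) (disp : measure_display)
    (X : measurableType disp) (mu : {sigma_finite_measure set X -> \bar R})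
    (B : set X) (h : X -> R) : \bar R :=
  ess_sup (mu \x mu)%E
    (fun p : X * X => (`|h p.1 - h p.2| * \1_(B `*` B) p)%:E).

Definition sharp_maximal (R : realType) (disp : measure_display)
    (X : measurableType disp) (d : X -> X -> R)
    (mu : {sigma_finite_measure set X -> \bar R})
    (T : (X -> R) -> (X -> R)) (alpha : R) (f : X -> R) (x : X) : \bar R :=
  ereal_sup [set w | exists (c : X) (rho : R),
    [/\ 0 < rho, qball d c rho x
      & w = ess_osc mu (qball d c rho)
              (T (cutoff (~` qball d c (alpha * rho)) f))]].

Definition nonincreasing_01 (R : realType) (psi : R -> R) : Prop :=
  (forall l, 0 < l < 1 -> 0 <= psi l) /\
  (forall l1 l2, 0 < l1 -> l1 <= l2 -> l2 < 1 -> psi l2 <= psi l1).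

Definition operator_bound (R : realType) (disp : measure_display)
    (X : measurableType disp) (d : X -> X -> R)
    (mu : {measure set X -> \bar R}) (s q : R)
    (T : (X -> R) -> (X -> R)) (psi : R -> R) : Prop :=
  forall (c : X) (rho : R) (g : X -> R) (lambda : R),
    0 < rho -> bounded_Lfun d mu s g -> 0 < lambda < 1 ->
    let B := qball d c rho in
    (mu (B `&` [set x | (psi lambda)%:E * avg_norm mu q%:E B (EFin \o g)
                        < `|T (cutoff B g) x|%:E])
     <= lambda%:E * mu B)%E.

(* The superlevel sets of the maximal function need not be measurable, whence
   the outer measure [mu^*], which agrees with [mu] on measurable sets. *)
Definition sharp_maximal_bound (R : realType) (disp : measure_display)
    (X : measurableType disp) (d : X -> X -> R)
    (mu : {sigma_finite_measure set X -> \bar R}) (s r alpha : R)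
    (T : (X -> R) -> (X -> R)) (phi : R -> R) : Prop :=
  forall (c : X) (rho : R) (g : X -> R) (lambda : R),
    0 < rho -> bounded_Lfun d mu s g -> 0 < lambda < 1 ->
    let B := qball d c rho in
    (mu_ext mu (B `&` [set x |
        (phi lambda)%:E * avg_norm mu r%:E B (EFin \o g)
        < sharp_maximal d mu T alpha (cutoff B g) x])
     <= lambda%:E * mu B)%E.

(** * Kernels *)

(* [k] is a measurable kernel on A * B with
   || ||k(x,y)||_{L^p(B, dmu(y)/mu(B))} ||_{L^oo(A, dmu(x))} <= 1. *)
Definition normalized_kernel (R : realType) (disp : measure_display)
    (X : measurableType disp) (mu : {measure set X -> \bar R}) (p : \bar R)
    (A B : set X) (k : X -> X -> R) : Prop :=
  measurable_fun (A `*` B) (fun z : X * X => k z.1 z.2) /\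
  (avg_norm mu +oo A (fun x => avg_norm mu p B (EFin \o k x)) <= 1)%E.

(* Main.v *)
Require Import Defs.
From HB Require Import structures.
From mathcomp Require Import all_boot all_order all_algebra.
From mathcomp Require Import finmap perm.
From mathcomp Require Import all_classical all_reals all_analysis.
From mathcomp Require Import ess_sup_inf measurable_realfun.
From mathcomp Require Import ring lra zify.
From mathcomp Require summability.

Set Implicit Arguments.
Unset Strict Implicit.
Unset Printing Implicit Defensive.

Import Order.TTheory GRing.Theory Num.Theory.
Import numFieldNormedType.Exports.

Local Open Scope classical_set_scope.
Local Open Scope ring_scope.

(* A cube P of D is split off by a stopping time.  If V, W is a nearly extremal
   basis for the convex body of f over alpha P, the scalar functions
   g_i = (f W)_i 1_(alpha P) have bounded s-averages.  The points of P where
   some T g_i, some sharp maximal function, or some average of |g_i|^s over the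
   dilate of a smaller cube is large form a small set E; the stopping cubes Q
   are the maximal ones in which E has density above a threshold.  Outside
   them |T g_i| is bounded, and on each of them so is
   T g_i - T (g_i 1_(alpha Q)), by the oscillation bound for the sharp maximal
   function.  Writing the bounded coefficients in terms of the test functions
   behind the rows of V gives a kernel for P that is a finite sum of products
   tau_i(x) phi_i(y).  Iterating, the differences telescope along the chain of
   stopping cubes containing x, which is finite for a.e. x by Lebesgue
   differentiation.

   For the second representation, nets indexed by colors generate finitely many
   dyadic systems such that alpha Q lies in a cube of comparable size of one of
   them, and the kernels are transported to these larger cubes. *)

(** * Balls in a space of homogeneous type *)

(** The weak type bounds say nothing about an individual point, but one good point of a stopping
    cube Q is enough: there T g and T (g 1_(alpha Q)) are both bounded, the second because the
    average of |g|^s over alpha Q is still controlled, and the oscillation bound carries their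
    difference to a.e. point of Q. The density threshold therefore has two tasks. It must be large
    enough against the measure of E that the stopping cubes fill at most half of P, and small enough
    that E fills at most half of each stopping cube, so that good points remain. Maximality gives
    the second property by comparison with the parent cube. All the g_i, at most n of them, share
    one set E, so the level lam at which psi and phi are evaluated depends only on n and the
    geometry; this keeps the constant independent of f. Two geometric obstacles remain. The
    inclusion of alpha Q in alpha P may fail for cubes just below P, so stopping starts a fixed
    number of generations lower. And growing cubes around one point need not exhaust X, so the
    iteration starts from a partition of X into cubes whose dilates contain the support of f; this
    is where alpha >= 3 cd^2 / delta enters in full. *)

Definition vol (R : realType) (disp : measure_display) (X : measurableType disp)
  (mu : set X -> \bar R) (A : set X) : R := fine (mu A).

Section Volume.
Context (R : realType) (disp : measure_display) (X : measurableType disp).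
Variable mu : {measure set X -> \bar R}.
Implicit Types A B : set X.

Lemma vol_ge0 A : 0 <= vol mu A.
Proof. exact: fine_ge0. Qed.

Lemma volE A : (mu A < +oo)%E -> mu A = (vol mu A)%:E.
Proof. by move=> h; rewrite /vol fineK// ge0_fin_numE. Qed.

Lemma mule_volE (c : R) A : (mu A < +oo)%E ->
  (c%:E * mu A = (c * vol mu A)%:E)%E.
Proof. by move=> h; rewrite volE. Qed.

Lemma finite_sub A B : measurable A -> measurable B -> A `<=` B ->
  (mu B < +oo)%E -> (mu A < +oo)%E.
Proof. by move=> mA mB AB; apply: le_lt_trans; apply: le_measure; rewrite ?inE. Qed.

Lemma vol_le A B : measurable A -> measurable B -> A `<=` B ->
  (mu B < +oo)%E -> vol mu A <= vol mu B.
Proof.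
move=> mA mB AB fB; rewrite -lee_fin -!volE//; last exact: (finite_sub mA mB).
by apply: le_measure; rewrite ?inE.
Qed.

End Volume.

Section Homogeneous.
Context (R : realType) (disp : measure_display) (X : measurableType disp).
Variables (d : X -> X -> R) (mu : {measure set X -> \bar R}) (cd cmu : R).
Hypothesis HT : homogeneous_type d mu cd cmu.

Let QM := homogeneous_quasi_metric HT.

Lemma qdist_ge0 x y : 0 <= d x y. Proof. by case: QM. Qed.
Lemma qdist_refl x : d x x = 0. Proof. by case: QM => _ h _ _ _; apply/h. Qed.
Lemma qdistC x y : d x y = d y x. Proof. by case: QM. Qed.
Lemma cd_ge1 : 1 <= cd. Proof. by case: QM. Qed.
Lemma cd_gt0 : 0 < cd. Proof. exact: lt_le_trans ltr01 cd_ge1. Qed.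
Lemma qdist_tri z x y : d x y <= cd * (d x z + d z y). Proof. by case: QM. Qed.

Lemma qball_center x r : 0 < r -> qball d x r x.
Proof. by rewrite /qball/= qdist_refl. Qed.

Lemma qball_sub x y r r' : cd * (d x y + r) <= r' ->
  qball d y r `<=` qball d x r'.
Proof.
rewrite /qball => h z /= yz; apply: lt_le_trans h; apply: le_lt_trans (qdist_tri y _ _) _.
by rewrite ltr_pM2l ?cd_gt0// ltrD2l.
Qed.

Lemma qball_le x r r' : r <= r' -> qball d x r `<=` qball d x r'.
Proof. by move=> rr' y /= h; apply: lt_le_trans rr'. Qed.

Lemma measurable_qball x r : measurable (qball d x r).
Proof.
have [r0|r0] := ltP 0 r; first exact: homogeneous_measurable_ball HT _ _ r0.
rewrite (_ : qball d x r = set0)//; apply/seteqP; split => // y.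
by rewrite /qball/= => /lt_le_trans/(_ r0); rewrite ltNge qdist_ge0.
Qed.

Lemma qball_lty x r : (mu (qball d x r) < +oo)%E.
Proof.
have r1 : 0 < Num.max r 1 by rewrite lt_max ltr01 orbT.
apply: (@finite_sub _ _ _ _ _ (qball d x (Num.max r 1))).
- exact: measurable_qball.
- exact: measurable_qball.
- by apply: qball_le; rewrite le_max lexx.
- exact: homogeneous_ball_lty HT _ _ r1.
Qed.

Lemma vol_qball_gt0 x r : 0 < r -> 0 < vol mu (qball d x r).
Proof.
move=> r0; rewrite -lte_fin -volE ?qball_lty//; exact: homogeneous_ball_gt0 HT _ _ r0.
Qed.

(** Doubling is iterated k times with t <= 2^k, so the constant depends on t but neither on the
    center nor on the radius. *)
Lemma vol_qball_dilate (t : R) : exists2 C, 1 <= C &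
  forall (x : X) (r : R), 0 < r -> vol mu (qball d x (t * r)) <= C * vol mu (qball d x r).
Proof.
pose c := Num.max cmu 1.
have c1 : 1 <= c by rewrite le_max lexx orbT.
have step x r : 0 < r -> vol mu (qball d x (2 * r)) <= c * vol mu (qball d x r).
  move=> r0; have := homogeneous_doubling HT x r0.
  rewrite mule_volE ?qball_lty// volE ?qball_lty// lee_fin => /le_trans; apply.
  by rewrite ler_wpM2r ?vol_ge0// le_max lexx.
have iter (k : nat) x r : 0 < r ->
    vol mu (qball d x (2 ^+ k * r)) <= c ^+ k * vol mu (qball d x r).
  elim: k x r => [|k IH] x r r0; first by rewrite !expr0 !mul1r.
  rewrite !exprS -mulrA; apply: (le_trans (step _ _ _)).
    by rewrite mulr_gt0// exprn_gt0.
  by rewrite -mulrA ler_wpM2l ?IH// (le_trans ler01).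
pose k := (Num.truncn t).+1.
have tk : t <= 2 ^+ k.
  apply: (le_trans (ltW (truncnS_gt t))); rewrite -/k -natrX ler_nat.
  exact/ltnW/ltn_expl.
exists (c ^+ k); first exact: exprn_ege1.
move=> x r r0; apply: le_trans (iter k x r r0); apply: vol_le.
- exact: measurable_qball.
- exact: measurable_qball.
- by apply: qball_le; rewrite ler_wpM2r// ltW.
- exact: qball_lty.
Qed.

Lemma vol_qball_comparable (t u : R) : exists2 C, 1 <= C &
  forall (x y : X) (r : R), 0 < r -> d x y < u * r ->
    vol mu (qball d x (t * r)) <= C * vol mu (qball d y r).
Proof.
have [C C1 hC] := vol_qball_dilate (cd * (u + `|t|)).
exists C => // x y r r0 xy; apply: le_trans (hC y r r0); apply: vol_le.
- exact: measurable_qball.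
- exact: measurable_qball.
- apply: qball_sub; rewrite qdistC -mulrA ler_pM2l ?cd_gt0// mulrDl.
  by rewrite lerD ?(ltW xy)// ler_wpM2r ?ler_norm// ltW.
- exact: qball_lty.
Qed.

(** * Separated sets and packing bounds *)

Definition qseparated (rho : R) (A : set X) : Prop :=
  forall z w, A z -> A w -> z <> w -> rho <= d z w.

Lemma qseparated_disjoint (rho : R) A z w : qseparated rho A -> A z -> A w ->
  z <> w -> qball d z (rho / (2 * cd)) `&` qball d w (rho / (2 * cd)) = set0.
Proof.
move=> sA Az Aw zw; apply/seteqP; split => // y [/= zy wy].
have := sA _ _ Az Aw zw; rewrite leNgt => /negP[].
apply: le_lt_trans (qdist_tri y _ _) _.
have -> : rho = cd * (rho / (2 * cd) + rho / (2 * cd)).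
  by field; rewrite gt_eqF ?cd_gt0.
by rewrite ltr_pM2l ?cd_gt0// ltrD// qdistC.
Qed.

(** Packing by volume: the balls of radius rho / (2 cd) about the points of A are disjoint, lie in
    one ball about x of radius comparable to rho, and each has at least the fraction 1 / C of its
    measure. *)
Lemma qseparated_card (t : R) : exists m : nat, forall (x : X) (rho : R) (A : {fset X}),
  0 < rho -> qseparated rho [set` A] -> [set` A] `<=` qball d x (t * rho) ->
  (#|` A| <= m)%N.
Proof.
have cd0 := cd_gt0; have cdN0 : cd != 0 by rewrite gt_eqF.
pose e := (2 * cd)^-1.
have e0 : 0 < e by rewrite invr_gt0; lra.
have e1 : e <= 1 by rewrite invf_le1; have := cd_ge1; lra.
pose T := cd * (`|t| + 1).
have [C C1 hC] := vol_qball_comparable (T / e) (`|t| / e).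
exists (Num.truncn C) => x rho A r0 sA Ax.
have T0 : 0 < T by rewrite mulr_gt0//; have := normr_ge0 t; lra.
pose V := vol mu (qball d x (T * rho)).
have V0 : 0 < V by rewrite vol_qball_gt0// mulr_gt0.
pose b z := qball d z (e * rho).
have bE z : b z = qball d z (rho / (2 * cd)) by rewrite /b mulrC.
have trb : trivIset [set` A] b.
  move=> z w Az Aw [y [zy wy]]; apply: contrapT => zw.
  have := qseparated_disjoint sA Az Aw zw; rewrite -!bE => h.
  by have : (b z `&` b w) y by []; rewrite h.
have mb z : measurable (b z) by exact: measurable_qball.
have bV z : z \in A -> ((V / C)%:E <= mu (b z))%E.
  move=> zA; rewrite (volE (qball_lty _ _)) lee_fin ler_pdivrMr ?(lt_le_trans ltr01)// mulrC.
  have -> : V = vol mu (qball d x (T / e * (e * rho))).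
    by rewrite mulrA mulfVK ?gt_eqF.
  apply: hC; first by rewrite mulr_gt0.
  rewrite mulrA mulfVK ?gt_eqF//; apply: lt_le_trans (Ax _ zA) _.
  by rewrite ler_wpM2r ?ler_norm// ltW.
have bT : \big[setU/set0]_(z <- A) b z `<=` qball d x (T * rho).
  rewrite -bigcup_fset => y [z /= zA].
  apply: (qball_sub (y := z)); rewrite /T -mulrA ler_pM2l// mulrDl.
  apply: lerD; last by rewrite ler_wpM2r// ltW.
  by apply: (le_trans (ltW (Ax _ zA))); rewrite ler_wpM2r ?ler_norm// ltW.
have : (mu (\big[setU/set0]_(z <- A) b z) <= V%:E)%E.
  rewrite /V -volE ?qball_lty//; apply: le_measure; rewrite ?inE//.
    exact: bigsetU_measurable.
  exact: measurable_qball.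
rewrite measure_fbigsetU//.
have -> : (#|` A| <= Num.truncn C)%N = (#|` A|%:R <= C).
  by rewrite truncn_ge_nat ?(le_trans ler01).
move=> h.
have : ((\sum_(z <- A) (V / C)) <= V).
  rewrite -lee_fin -sumEFin; apply: le_trans h.
  by rewrite big_seq [leRHS]big_seq; apply: lee_sum.
rewrite big_const_seq count_predT iter_addr_0 => h2.
have C0 : 0 < C by apply: lt_le_trans C1.
by move: h2; rewrite -(mulr_natr (V / C)) mulrAC ler_pdivrMr// ler_pM2l.
Qed.

Lemma qseparated_finite x r rho (A : set X) : 0 < rho -> qseparated rho A ->
  A `<=` qball d x r -> finite_set A.
Proof.
move=> r0 sA Ax; apply: contrapT => /(infinite_set_fset _) inf.
have [m hm] := qseparated_card (r / rho).
have [B BA cB] := inf m.+1.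
have h1 : qseparated rho [set` B] by move=> z w /BA Az /BA Aw; exact: sA.
have h2 : [set` B] `<=` qball d x r by move=> z /BA /Ax.
by have := hm x rho B r0 h1; rewrite divfK ?gt_eqF// => /(_ h2); rewrite leqNgt cB.
Qed.

Lemma qseparated_countable rho (A : set X) : 0 < rho -> qseparated rho A ->
  countable A.
Proof.
move=> r0 sA.
have [[x _]|nX] := pselect ([set: X] !=set0); last first.
  by rewrite (_ : A = set0) ?countable0//; apply/seteqP; split => // y _; apply: nX; exists y.
have -> : A = \bigcup_(n in [set: nat]) (A `&` qball d x n%:R).
  apply/seteqP; split => [y Ay|y [n _ []//]].
  exists (Num.truncn (d x y)).+1 => //; split => //; exact: truncnS_gt.
apply: bigcup_countable => [|n _]; first exact: countableP.
apply: finite_set_countable.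
apply: (qseparated_finite r0 _ (@subIsetr _ _ _)).
by move=> z w [Az _] [Aw _]; exact: sA.
Qed.

End Homogeneous.

(** * Dyadic cubes generated by nets *)

Lemma countable_bigcup_measurable (disp : measure_display)
    (X : measurableType disp) (I : Type) (D : set I) (F : I -> set X) :
  countable D -> (forall i, D i -> measurable (F i)) ->
  measurable (\bigcup_(i in D) F i).
Proof.
move=> /countable_injP[f finj] mF.
have -> : \bigcup_(i in D) F i =
    \bigcup_(n in [set: nat]) \bigcup_(i in D `&` [set i | f i = n]) F i.
  apply/seteqP; split => [x [i Di Fi]|x [n _ [i [Di _] Fi]]]; last by exists i.
  by exists (f i) => //; exists i.
apply: bigcup_measurable => n _.
have [[i [Di fi]]|nD] := pselect (exists i, D i /\ f i = n).
  rewrite (_ : \bigcup_(_ in _) _ = F i); first exact: mF.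
  apply/seteqP; split => [x [j [Dj fj] Fj]|x Fi]; last by exists i.
  by rewrite (finj i j) ?inE// fj.
rewrite (_ : \bigcup_(_ in _) _ = set0)//; apply/seteqP; split => // x [i [Di fi] _].
by apply: nD; exists i.
Qed.

Lemma countable_bigcap_measurable (disp : measure_display)
    (X : measurableType disp) (I : Type) (D : set I) (F : I -> set X) :
  countable D -> (forall i, D i -> measurable (F i)) ->
  measurable (\bigcap_(i in D) F i).
Proof.
move=> cD mF; rewrite -[X in measurable X]setCK; apply: measurableC.
rewrite setC_bigcap; apply: countable_bigcup_measurable => // i Di.
by apply: measurableC; exact: mF.
Qed.

(** If each value z stopped occurring at the times in P after some g z, a time in P beyond the
    maximum of g would have no value left. The predicate P serves to restrict the times to those at
    which a coarser ancestor is already prescribed. *)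
Lemma infinitely_often_pigeonhole (T : choiceType) (f : nat -> T) (S : set T)
    (P : nat -> Prop) :
  finite_set S -> (forall j, S (f j)) ->
  (forall i : nat, exists2 j, (i <= j)%N & P j) ->
  exists2 z, S z & forall i : nat, exists2 j, (i <= j)%N & P j /\ f j = z.
Proof.
move=> /finite_fsetP[F SF] Sf Pinf; apply: contrapT => nz.
have : forall z, exists i : nat, S z ->
    forall j, (i <= j)%N -> P j -> f j <> z.
  move=> z; apply: contrapT => /forallNP h; apply: nz; exists z.
    by apply: contrapT => nS; apply: (h 0).
  move=> i; apply: contrapT => hi; apply: (h i) => _ j ij Pj fj.
  by apply: hi; exists j.
move=> /choice[g hg].
have [j jm Pj] := Pinf (\max_(z <- F) g z)%N.
have Sfj := Sf j; apply: (hg (f j) Sfj j) => //; apply: leq_trans jm.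
by apply: leq_bigmax_seq => //; move: Sfj; rewrite SF.
Qed.

Section ArgMin.
Context (disp : measure_display) (X : measurableType disp).
Variables (U : set X) (nu : X -> nat).
Hypotheses (cU : countable U) (nu_inj : {in U &, injective nu}).

(** Taking the candidate with the least number in a fixed numbering of a countable set keeps choices
    measurable: z is chosen exactly where z is a candidate and no candidate has a smaller number. An
    arbitrary choice would not give measurable cubes. *)
Definition argmin (P : set X) (x0 : X) : X :=
  xget x0 [set z | P z /\ forall w, P w -> (nu z <= nu w)%N].

Lemma argminP P x0 : P !=set0 ->
  P (argmin P x0) /\ forall w, P w -> (nu (argmin P x0) <= nu w)%N.
Proof.
move=> [z Pz].
have exP : exists n, `[< exists2 z, P z & nu z = n >].
  by exists (nu z); apply/asboolP; exists z.
have [n /asboolP[w Pw wn] nmin] := ex_minnP exP.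
rewrite /argmin; apply: (@xgetPex _ x0 [set z | P z /\ forall w, P w -> (nu z <= nu w)%N]).
exists w; split => // v Pv; rewrite wn; apply: nmin; apply/asboolP; by exists v.
Qed.

Definition measurable_fibers (f : X -> X) : Prop :=
  (forall x, U (f x)) /\ forall z, measurable [set x | f x = z].

Lemma measurable_fibers_argmin (P : X -> set X) :
  (forall x, P x `<=` U) -> (forall x, P x !=set0) ->
  (forall z, U z -> measurable [set x | P x z]) ->
  measurable_fibers (fun x => argmin (P x) x).
Proof.
move=> PU P0 mP; split => [x|z].
  by apply: (PU x); have [] := argminP x (P0 x).
have [Uz|nUz] := pselect (U z); last first.
  rewrite (_ : [set _ | _] = set0)//; apply/seteqP; split => // x /= xz.
  by apply: nUz; rewrite -xz; apply: (PU x); have [] := argminP x (P0 x).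
rewrite (_ : [set _ | _] = [set x | P x z] `&`
    \bigcap_(w in U `&` [set w | (nu w < nu z)%N]) ~` [set x | P x w]).
  apply: measurableI; first exact: mP.
  apply: countable_bigcap_measurable.
    by apply: sub_countable cU; apply: subset_card_le => w [].
  by move=> w [Uw _]; apply: measurableC; exact: mP.
apply/seteqP; split => x /=.
  move=> xz; have [h1 h2] := argminP x (P0 x); rewrite xz in h1 h2; split => //.
  by move=> w /= [Uw wz] /h2; rewrite leqNgt wz.
move=> [Pz hz]; have [h1 h2] := argminP x (P0 x).
apply: nu_inj; rewrite ?inE//; first exact: (PU x).
apply/eqP; rewrite eqn_leq h2//= leqNgt; apply/negP => lt.
by apply: (hz (argmin (P x) x)) => //; split => //; exact: (PU x).
Qed.

Lemma measurable_fibers_comp (g f : X -> X) : (forall x, U (g (f x))) ->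
  measurable_fibers f -> measurable_fibers (g \o f).
Proof.
move=> Ug [Uf mf]; split => // z.
rewrite (_ : [set _ | _] = \bigcup_(w in U `&` [set w | g w = z]) [set x | f x = w]).
  apply: countable_bigcup_measurable => [|//].
  by apply: sub_countable cU; apply: subset_card_le => w [].
apply/seteqP; split => x /=; first by move=> gz; exists (f x).
by move=> [w [Uw gw] /= ->].
Qed.

End ArgMin.

Section ChristCubes.
Context (R : realType) (disp : measure_display) (X : measurableType disp).
Variables (d : X -> X -> R) (mu : {measure set X -> \bar R}) (cd cmu : R).
Hypothesis HT : homogeneous_type d mu cd cmu.
Variables (A : int -> set X) (a b D : R).
Hypotheses (a0 : 0 < a) (ab : a <= b) (D0 : 0 < D)
  (Dsmall : 8 * cd ^+ 3 * b * D <= a).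
Hypothesis sepA : forall k, qseparated d (a * D ^ k) (A k).
Hypothesis denseA : forall k x, exists2 z, A k z & d x z < b * D ^ k.

Let cd0 : 0 < cd. Proof. exact: cd_gt0 HT. Qed.
Let cd1 : 1 <= cd. Proof. exact: cd_ge1 HT. Qed.
Let b0 : 0 < b. Proof. exact: lt_le_trans ab. Qed.
Let Dk0 k : 0 < D ^ k. Proof. exact: exprz_gt0. Qed.

Let DkS (k : int) : D ^ (k + 1) = D * D ^ k.
Proof. by rewrite exprzDr ?unitfE ?gt_eqF// expr1z mulrC. Qed.

Let cdD : 8 * cd ^+ 3 * D <= 1.
Proof.
have : 8 * cd ^+ 3 * D * b <= 1 * b by rewrite mul1r mulrAC (le_trans Dsmall).
by rewrite ler_pM2r.
Qed.

Let U : set X := \bigcup_k A k.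

Let cU : countable U.
Proof.
apply: bigcup_countable => [|k _]; first exact: countableP.
exact: (qseparated_countable HT (mulr_gt0 a0 (Dk0 k)) (@sepA k)).
Qed.

Let nu : X -> nat := sval (cid ((countable_injP _) cU)).
Let nu_inj : {in U &, injective nu} := svalP (cid ((countable_injP _) cU)).

(** The last clause forces the choice close to a net point, which is the origin of the inner balls.
    Since the map is defined on all of X, it serves both to approximate points by the net and to
    give net points their parents. *)
Let choices k x : set X := [set z | [/\ A k z, d x z < b * D ^ k &
  forall w, A k w -> d x w < a * D ^ k / (2 * cd) -> z = w]].

Let p k x : X := argmin nu (choices k x) x.

Let near_uniq k x z w : A k z -> A k w -> d x z < a * D ^ k / (2 * cd) ->
  d x w < a * D ^ k / (2 * cd) -> z = w.
Proof.
move=> Az Aw xz xw; apply: contrapT => zw.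
have := qseparated_disjoint HT (@sepA k) Az Aw zw => h.
suff : (set0 : set X) x by [].
by rewrite -h; split; rewrite /qball/= (qdistC HT).
Qed.

Let choices_neq0 k x : choices k x !=set0.
Proof.
have [[w [Aw xw]]|nw] := pselect (exists w, A k w /\ d x w < a * D ^ k / (2 * cd)).
  exists w; split => //; last by move=> v Av xv; exact: (near_uniq Aw Av xw xv).
  apply: lt_le_trans xw _; rewrite ler_pdivrMr ?mulr_gt0// mulrAC ler_pM2r//.
  apply: (le_trans ab); rewrite ler_peMr ?(ltW b0)//; have := cd1; lra.
have [z Az xz] := denseA k x; exists z; split => // w Aw xw.
by exfalso; apply: nw; exists w.
Qed.

Let pP k x : [/\ A k (p k x), d x (p k x) < b * D ^ k &
  forall w, A k w -> d x w < a * D ^ k / (2 * cd) -> p k x = w].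
Proof. by have [] := argminP nu x (choices_neq0 k x). Qed.

Let measurable_p k : measurable_fibers U (p k).
Proof.
apply: measurable_fibers_argmin => //.
- by move=> x z [Az _ _]; exists k.
- move=> z Uz.
  have [Az|nAz] := pselect (A k z); last first.
    rewrite (_ : [set _ | _] = set0)//; apply/seteqP; split => // x [] //.
  rewrite (_ : [set _ | _] = qball d z (b * D ^ k) `&`
    \bigcap_(w in A k `\ z) ~` qball d w (a * D ^ k / (2 * cd))).
    apply: measurableI; first exact: measurable_qball HT _ _.
    apply: countable_bigcap_measurable.
      by apply: sub_countable cU; apply: subset_card_le => w [Aw _]; exists k.
    by move=> w _; apply: measurableC; exact: measurable_qball HT _ _.
  apply/seteqP; split => x; rewrite /qball/=.
    move=> [_ xz hz]; split; first by rewrite (qdistC HT).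
    by move=> w [Aw wz] /=; rewrite (qdistC HT) => /(hz _ Aw) zw; apply: wz.
  move=> [xz hz]; split => //; first by rewrite (qdistC HT).
  move=> w Aw xw; apply: contrapT => zw; apply: (hz w).
    by split => // wz; apply: zw.
  by rewrite /= (qdistC HT).
Qed.

(* [anc i k x] is the ancestor in generation k of the net point chosen for x in
   generation k + i.  It need not stabilize as i grows, so [label] below follows
   a thread of ancestors that occur infinitely often. *)
Let anc := fix anc (i : nat) (k : int) (x : X) : X :=
  if i is j.+1 then p k (anc j (k + 1) x) else p k x.

Let ancS i k x : anc i.+1 k x = p k (anc i (k + 1) x). Proof. by []. Qed.

Let ancA i k x : A k (anc i k x).
Proof. by case: i => [|i]; [have [] := pP k x | have [] := pP k (anc i (k + 1) x)]. Qed.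

(** The constant 2 cd b is preserved by the recursion t -> cd (t D + b), because 2 cd D <= 1; hence
    the bound does not grow with i. *)
Let anc_dist i k x : d x (anc i k x) < 2 * cd * b * D ^ k.
Proof.
have cdD2 : 2 * cd * D <= 1.
  apply: le_trans cdD; rewrite ler_pM2r// exprS mulrA.
  have h : 1 <= cd ^+ 2 by exact: exprn_ege1.
  have := ler_wpM2l (ltW cd0) h; have := cd1; lra.
elim: i k => [|i IH] k.
  have [_ /lt_le_trans h _] := pP k x; apply: h; rewrite ler_pM2r// ler_peMl ?(ltW b0)//.
  have := cd1; lra.
rewrite ancS; set y := anc i _ _; have [_ h _] := pP k y.
apply: le_lt_trans (qdist_tri HT y _ _) _.
have hy : d x y < 2 * cd * b * (D * D ^ k) by rewrite -DkS; exact: IH.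
apply: (@lt_le_trans _ _ (cd * (2 * cd * b * (D * D ^ k) + b * D ^ k))).
  by rewrite ltr_pM2l// ltrD.
rewrite (_ : _ * (_ + _) = (2 * cd * D + 1) * (cd * b * D ^ k)); last by ring.
rewrite (_ : 2 * cd * b * D ^ k = 2 * (cd * b * D ^ k)); last by ring.
by rewrite ler_pM2r ?mulr_gt0//; have := cd1; lra.
Qed.

(** The last parent step starts from a point within 2 cd b D^(k+1) of x, and [Dsmall] makes this so
    short that the point still lies where the choice of w is forced. *)
Let anc_near i k x w : A k w -> d x w < a / (4 * cd ^+ 2) * D ^ k -> anc i k x = w.
Proof.
move=> Aw xw; case: i => [|i].
  have [_ _ h] := pP k x; apply: h => //; apply: (lt_le_trans xw).
  rewrite mulrAC ler_pM2l ?mulr_gt0// lef_pV2 ?posrE ?mulr_gt0// ?exprn_gt0//.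
  by rewrite expr2 mulrA ler_pM2r//; have := cd1; lra.
rewrite ancS; set y := anc i _ _; have [_ _ h] := pP k y; apply: h => //.
apply: le_lt_trans (qdist_tri HT x _ _) _.
have hy : d y x < 2 * cd * b * (D * D ^ k).
  by rewrite (qdistC HT) -DkS; exact: anc_dist.
apply: (@lt_le_trans _ _ (cd * (2 * cd * b * (D * D ^ k) + a / (4 * cd ^+ 2) * D ^ k))).
  by rewrite ltr_pM2l// ltrD.
have -> : cd * (2 * cd * b * (D * D ^ k) + a / (4 * cd ^+ 2) * D ^ k) =
  (8 * cd ^+ 3 * b * D + a) * (D ^ k / (4 * cd)).
  by field; rewrite gt_eqF.
have -> : a * D ^ k / (2 * cd) = (a + a) * (D ^ k / (4 * cd)).
  by field; rewrite gt_eqF.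
by rewrite ler_pM2r ?lerD// divr_gt0// mulr_gt0.
Qed.

Let io k z x : Prop := forall i : nat, exists2 j, (i <= j)%N & anc j k x = z.

Let ioA k z x : io k z x -> A k z.
Proof. by move=> /(_ 0%N)[j _ <-]. Qed.

Let near_finite k x : finite_set [set z | A k z /\ d x z < 2 * cd * b * D ^ k].
Proof.
apply: (qseparated_finite HT (x := x) (r := 2 * cd * b * D ^ k)
  (mulr_gt0 a0 (Dk0 k))) => [|z []//].
by move=> z w [Az _] [Aw _]; exact: sepA.
Qed.

Let io_ex k x : exists z, io k z x.
Proof.
have [|i|z _ h] := @infinitely_often_pigeonhole X (fun i =>
  anc i k x) _ (fun=> True) (near_finite k x).
- by move=> j; split; [exact: ancA|exact: anc_dist].
- by exists i.
- by exists z => i; have [j ij []] := h i; exists j.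
Qed.

(** The pigeonhole is applied to the ancestors of generation k + 1, at the infinitely many times
    when the ancestor of generation k is z. *)
Let io_lift k z x : io k z x -> exists z', io (k + 1) z' x /\ p k z' = z.
Proof.
move=> zx.
have [||z' _ h] := @infinitely_often_pigeonhole X (fun i => anc i (k + 1) x) _
    (fun i => anc i.+1 k x = z) (near_finite (k + 1) x).
- by move=> j; split; [exact: ancA|exact: anc_dist].
- by move=> i; have [[//|j] ij e] := zx i.+1; exists j.
- exists z'; split; first by move=> i; have [j ij []] := h i; exists j.
  by have [j _ [<- <-]] := h 0%N.
Qed.

Let io_push k z x : io (k + 1) z x -> io k (p k z) x.
Proof.
move=> h i; have [j ij e] := h i; exists j.+1; first exact: leq_trans ij _.
by rewrite ancS e.
Qed.

Let measurable_anc i k : measurable_fibers U (anc i k).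
Proof.
elim: i k => [|i IH] k; first exact: measurable_p.
apply: (measurable_fibers_comp cU _ (IH (k + 1))) => x.
by exists k => //; have [] := pP k (anc i (k + 1) x).
Qed.

Let measurable_io k z : measurable [set x | io k z x].
Proof.
rewrite (_ : [set _ | _] = \bigcap_(i in [set: nat])
    \bigcup_(j in [set j | (i <= j)%N]) [set x | anc j k x = z]).
  apply: countable_bigcap_measurable => [|i _]; first exact: countableP.
  by apply: bigcup_measurable => j _; have [] := measurable_anc j k.
apply/seteqP; split => x /=.
  by move=> h i _; have [j ij e] := h i; exists j.
by move=> h i; have [j ij e] := h i I; exists j.
Qed.

(** The thread is lifted from generation 0 to finer generations, each label being a recurring
    ancestor whose parent is the previous label. Towards coarser generations the parent map leaves
    nothing to choose. *)
Let lpos := fix lpos (i : nat) (x : X) : X :=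
  if i is j.+1 then argmin nu [set z | io j.+1 z x /\ p j z = lpos j x] x
  else argmin nu [set z | io 0 z x] x.

Let intSr (i : nat) : (i : int) + 1 = i.+1. Proof. by rewrite -PoszD addn1. Qed.

Let lpos_io (i : nat) x : io i (lpos i x) x.
Proof.
elim: i => [|i IH]; first by have [] := argminP nu x (io_ex 0 x).
have [z []] := io_lift IH; rewrite intSr => h1 h2.
by have [[]] := @argminP _ _ nu [set z | io i.+1 z x /\ p i z = lpos i x] x
  (ex_intro _ z (conj h1 h2)).
Qed.

Let lposS_ex (i : nat) x : [set z | io i.+1 z x /\ p i z = lpos i x] !=set0.
Proof. by have [z []] := io_lift (lpos_io i x); rewrite intSr; exists z. Qed.

Let lposS (i : nat) x : p i (lpos i.+1 x) = lpos i x.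
Proof. by have [[]] := argminP nu x (lposS_ex i x). Qed.

Let lneg := fix lneg (i : nat) (x : X) : X :=
  if i is j.+1 then p (Negz j) (lneg j x) else lpos 0 x.

Let label k x : X := match k with Posz i => lpos i x | Negz i => lneg i.+1 x end.

Let label_p k x : p k (label (k + 1) x) = label k x.
Proof.
case: k => [i|[|i]]; first by rewrite intSr; exact: lposS.
- by [].
- by rewrite (_ : Negz i.+1 + 1 = Negz i)//; lia.
Qed.

Let label_io k x : io k (label k x) x.
Proof.
case: k => [i|i]; first exact: lpos_io.
elim: i => [|i IH].
  by rewrite -label_p; apply: io_push; exact: lpos_io.
by rewrite -label_p; apply: io_push; rewrite (_ : Negz i.+1 + 1 = Negz i)//; lia.
Qed.

Let labelA k x : A k (label k x). Proof. exact: ioA (label_io k x). Qed.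

Let measurable_label k : measurable_fibers U (label k).
Proof.
have ioU j x : io j^~ x `<=` U by move=> z /ioA Az; exists j.
have lp i : measurable_fibers U (lpos i).
  elim: i => [|i IH].
    apply: measurable_fibers_argmin => // [x|x|z _];
      [exact: ioU|exact: io_ex|exact: measurable_io].
  apply: measurable_fibers_argmin => // [x z [/ioU]//|z _].
  rewrite (_ : [set _ | _] = [set x | io i.+1 z x] `&` [set x | lpos i x = p i z]).
    by apply: measurableI; [exact: measurable_io|case: IH].
  by apply/seteqP; split => x /= [].
case: k => [i|i]; first exact: lp.
suff h : measurable_fibers U (lneg i.+1) by exact: h.
have ln j : measurable_fibers U (lneg j).
  elim: j => [|j IH]; first exact: lp.
  apply: (measurable_fibers_comp cU _ IH) => x.
  by exists (Negz j) => //; have [] := pP (Negz j) (lneg j x).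
exact: ln.
Qed.

Let label_le k l x y : l <= k -> label k x = label k y -> label l x = label l y.
Proof.
move=> lk; have -> : k = l + `|k - l|%N by lia.
elim: `|k - l|%N => [|i IH] ; first by rewrite addr0.
move=> e; apply: IH; rewrite -!(label_p (l + i)).
by rewrite -addrA intSr e.
Qed.

(** A cube is the set of points with a given label. Labels of one generation determine those of the
    coarser ones, whence nesting; each label is one of the ancestors of x, so the uniform bounds on
    ancestors give the two balls. The last clause is what allows the net, and hence the centers, to
    be prescribed for the adjacent systems. *)
Lemma christ_cubes : exists DD : set (cube X),
  dyadic_system d (a / (4 * cd ^+ 2)) (2 * cd * b) D DD /\
  forall k z, A k z ->
    exists2 Q : cube X, DD Q & cube_gen Q = k /\ cube_center Q = z.
Proof.
exists [set Q : cube X | A (cube_gen Q) (cube_center Q) /\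
  (Q : set X) = [set x | label (cube_gen Q) x = cube_center Q]].
split; last first.
  by move=> k z Az; exists (Cube [set x | label k x = z] z k).
split => /=.
- by rewrite divr_gt0// mulr_gt0// exprn_gt0.
- rewrite ler_pdivrMr ?mulr_gt0 ?exprn_gt0//.
  have : 1 <= cd * cd ^+ 2 by rewrite -exprS; exact: exprn_ege1.
  move=> h; have : b * 1 <= b * (cd * cd ^+ 2) by rewrite ler_pM2l.
  rewrite (_ : 2 * cd * b * (4 * cd ^+ 2) = 8 * (b * (cd * cd ^+ 2))); last by ring.
  by move: (b * (cd * cd ^+ 2)) => t; have := b0; have := ab; lra.
- rewrite D0/=; have : 1 <= cd ^+ 3 by exact: exprn_ege1.
  move=> h; have := cdD; have : 1 * D <= cd ^+ 3 * D by rewrite ler_pM2r.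
  have := cd1; lra.
- by move=> Q [_ ->]; have [_] := measurable_label (cube_gen Q); exact.
- move=> [P zP k] [Q zQ l] /= [AP ->] [AQ ->] kl PQ; subst l.
  apply/seteqP; split => // x [/= xP xQ]; apply: PQ.
  by rewrite -xP -xQ.
- by move=> k x; exists (Cube [set y | label k y = label k x] (label k x) k); split => /=.
- move=> [P zP k] [Q zQ l] /= [AP ->] [AQ ->] lk.
  have [[x [/= xP xQ]]|nx] := pselect ([set x | label k x = zP] `&`
      [set x | label l x = zQ] !=set0); last first.
    by left; apply/seteqP; split => // x hx; apply: nx; exists x.
  by right => y /= yP; rewrite -xQ; apply: (label_le lk); rewrite yP xP.
- move=> [Q z k] /= [AQ ->] x; rewrite /qball/= (qdistC HT) => xz.
  by have [j _ <-] := label_io k x 0; exact: anc_near.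
- move=> [Q z k] /= [AQ ->] x; rewrite /qball/= (qdistC HT) => <-.
  by have [j _ <-] := label_io k x 0; exact: anc_dist.
Qed.

End ChristCubes.

(** * Adjacent dyadic systems *)

Section Dyadic.
Context (R : realType) (disp : measure_display) (X : measurableType disp).
Variables (d : X -> X -> R) (mu : {measure set X -> \bar R}) (cd cmu : R).
Hypothesis HT : homogeneous_type d mu cd cmu.
Variables (c0 C0 delta : R) (D : set (cube X)).
Hypothesis DS : dyadic_system d c0 C0 delta D.

Lemma dyadic_c0_gt0 : 0 < c0. Proof. by case: DS. Qed.
Lemma dyadic_C0_gt0 : 0 < C0.
Proof. exact: lt_le_trans dyadic_c0_gt0 (dyadic_C0 DS). Qed.
Lemma dyadic_delta_gt0 : 0 < delta. Proof. by case: DS => _ _ /andP[]. Qed.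
Lemma dyadic_delta_lt1 : delta < 1. Proof. by case: DS => _ _ /andP[]. Qed.

Lemma dyadic_scale_gt0 (k : int) : 0 < delta ^ k.
Proof. exact: exprz_gt0 dyadic_delta_gt0. Qed.

Lemma dyadic_scale_le (k l : int) : k <= l -> delta ^ l <= delta ^ k.
Proof.
move=> kl; rewrite -(invrK delta) ![_^-1^-1 ^ _]exprz_inv ler_eXz2l ?lerN2//.
by rewrite invf_gt1 ?dyadic_delta_lt1 ?dyadic_delta_gt0.
Qed.

Lemma dyadic_center_in Q : D Q -> (Q : set X) (cube_center Q).
Proof.
move=> DQ; apply: (dyadic_inner DS DQ); apply: (qball_center HT).
exact: mulr_gt0 dyadic_c0_gt0 (dyadic_scale_gt0 _).
Qed.

Lemma dyadic_uniq P Q x : D P -> D Q -> cube_gen P = cube_gen Q ->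
  (P : set X) x -> (Q : set X) x -> P = Q.
Proof.
move=> DP DQ gPQ Px Qx; apply: contrapT => PQ.
have h := dyadic_disjoint DS DP DQ gPQ PQ.
by suff : (set0 : set X) x by []; rewrite -h.
Qed.

Lemma dyadic_sub P Q x : D P -> D Q -> cube_gen Q <= cube_gen P ->
  (P : set X) x -> (Q : set X) x -> P `<=` Q.
Proof.
move=> DP DQ gPQ Px Qx; have [h|//] := dyadic_nested DS DP DQ gPQ.
by suff : (set0 : set X) x by []; rewrite -h.
Qed.

Lemma dyadic_lty Q : D Q -> (mu Q < +oo)%E.
Proof.
move=> DQ; apply: finite_sub (dyadic_outer DS DQ) (qball_lty HT _ _).
  exact: dyadic_measurable DS _ DQ.
exact: measurable_qball HT _ _.
Qed.

Lemma dyadic_sub_qball Q x t : D Q -> (Q : set X) x ->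
  2 * cd * C0 * delta ^ cube_gen Q <= t -> Q `<=` qball d x t.
Proof.
move=> DQ Qx ht; apply: subset_trans (dyadic_outer DS DQ) _.
apply: (qball_sub HT); apply: le_trans ht.
have := dyadic_outer DS DQ Qx; rewrite /qball/= (qdistC HT) => /ltW h.
rewrite (_ : 2 * cd * C0 * _ = cd * (C0 * delta ^ cube_gen Q + C0 * delta ^ cube_gen Q));
  last by ring.
by rewrite ler_pM2l ?(cd_gt0 HT)// lerD2r.
Qed.

Lemma dyadic_vol_ge Q : D Q ->
  vol mu (qball d (cube_center Q) (c0 * delta ^ cube_gen Q)) <= vol mu Q.
Proof.
move=> DQ; apply: vol_le (dyadic_inner DS DQ) (dyadic_lty DQ).
  exact: measurable_qball HT _ _.
exact: dyadic_measurable DS _ DQ.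
Qed.

Lemma dyadic_vol_gt0 Q : D Q -> 0 < vol mu Q.
Proof.
move=> DQ; apply: lt_le_trans (dyadic_vol_ge DQ); apply: (vol_qball_gt0 HT).
exact: mulr_gt0 dyadic_c0_gt0 (dyadic_scale_gt0 _).
Qed.

Lemma dyadic_vol_dilate (t : R) : exists2 C, 1 <= C & forall Q, D Q ->
  vol mu (qball d (cube_center Q) (t * delta ^ cube_gen Q)) <= C * vol mu Q.
Proof.
have [C C1 hC] := vol_qball_dilate HT (t / c0).
exists C => // Q DQ; have := hC (cube_center Q) _ (mulr_gt0 dyadic_c0_gt0 (dyadic_scale_gt0
  (cube_gen Q))).
rewrite mulrA divfK ?gt_eqF ?dyadic_c0_gt0// => /le_trans; apply.
by rewrite ler_wpM2l ?dyadic_vol_ge// (le_trans ler01).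
Qed.

Definition dyadic_centers (k : int) : set X :=
  [set cube_center Q | Q in D `&` [set Q | cube_gen Q = k]].

Lemma dyadic_centers_separated k :
  qseparated d (c0 * delta ^ k) (dyadic_centers k).
Proof.
move=> _ _ [P [DP <-] <-] [Q [DQ /= gQ] <-] PQ; rewrite leNgt; apply/negP => h.
apply: PQ; congr cube_center; apply: (dyadic_uniq DP DQ (esym gQ) (x := cube_center Q)).
  exact: (dyadic_inner DS DP).
exact: dyadic_center_in.
Qed.

Lemma dyadic_centers_dense k x :
  exists2 z, dyadic_centers k z & d x z < C0 * delta ^ k.
Proof.
have [Q [DQ gQ Qx]] := dyadic_cover DS k x.
exists (cube_center Q); first by exists Q.
by have := dyadic_outer DS DQ Qx; rewrite /qball/= (qdistC HT) gQ.
Qed.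

(** Within one generation a cube is determined by its center, and the centers form a separated set,
    which is countable by the packing bound. *)
Lemma dyadic_countable : countable D.
Proof.
have -> : D = \bigcup_(k in [set: int]) (D `&` [set Q | cube_gen Q = k]).
  by apply/seteqP; split => [Q DQ|Q [k _ []//]]; exists (cube_gen Q).
apply: bigcup_countable => [|k _]; first exact: countableP.
have /countable_injP[f finj] := qseparated_countable HT
  (mulr_gt0 dyadic_c0_gt0 (dyadic_scale_gt0 k)) (@dyadic_centers_separated k).
apply/countable_injP; exists (f \o @cube_center X) => P Q.
rewrite !inE => -[DP gP] [DQ gQ] /= fPQ.
have e : cube_center P = cube_center Q.
  by apply: finj fPQ; rewrite inE; [exists P|exists Q].
apply: (dyadic_uniq DP DQ _ (dyadic_center_in DP)); first by rewrite gP gQ.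
by rewrite e; exact: dyadic_center_in.
Qed.

End Dyadic.

(** * Greedy coloring of a countable graph of bounded degree *)

Lemma nat_coloring (adj : nat -> nat -> bool) (m : nat) :
  (forall n, size [seq j <- iota 0 n | adj n j] <= m)%N ->
  exists col : nat -> nat, (forall n, col n <= m)%N /\
    forall n j, (j < n)%N -> adj n j -> col j <> col n.
Proof.
move=> hm.
pose free n (s : seq nat) : set nat :=
  [set i | (i <= m)%N /\ forall j, (j < n)%N -> adj n j -> nth 0 s j <> i].
pose new n s := xget 0 (free n s).
pose cs := fix cs n := if n is k.+1 then rcons (cs k) (new k (cs k)) else [::].
pose col n := new n (cs n).
have szcs n : size (cs n) = n by elim: n => //= n IH; rewrite size_rcons IH.
have nthcs n j : (j < n)%N -> nth 0 (cs n) j = col j.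
  elim: n => // n IH; rewrite ltnS leq_eqVlt /= nth_rcons szcs => /predU1P[->|jn].
    by rewrite ltnn eqxx.
  by rewrite jn IH.
have fr n : free n (cs n) (col n).
  apply: xgetPex; apply: contrapT => nfree.
  pose J := [seq j <- iota 0 n | adj n j].
  have : (size (iota 0 m.+1) <= size [seq nth 0 (cs n) j | j <- J])%N.
    apply: uniq_leq_size (iota_uniq _ _) _ => i; rewrite mem_iota add0n ltnS /= => im.
    apply: contrapT => ni; apply: nfree; exists i; split => // j jn aj e.
    by apply: ni; rewrite -e; apply: map_f; rewrite mem_filter aj mem_iota.
  by rewrite size_iota size_map ltnNge => /negP; apply; exact: hm.
exists col; split => [n|n j jn aj]; first by have [] := fr n.
by have [_ /(_ j jn aj)] := fr n; rewrite nthcs.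
Qed.

(** A numbering of U turns the points into integers, colored greedily in increasing order; symmetry
    of [near] lets each pair be treated from the point with the larger number. *)
Lemma countable_coloring (T : choiceType) (U : set T) (near : T -> T -> Prop)
    (m : nat) :
  countable U -> (forall z w, near z w -> near w z) ->
  (forall z (B : {fset T}), U z -> [set` B] `<=` U `&` near z -> (#|` B| <= m)%N) ->
  exists col : T -> nat, (forall z, col z <= m)%N /\
    forall z w, U z -> U w -> near z w -> z <> w -> col z <> col w.
Proof.
move=> /countable_injP[nu nuI] nearC hm.
pose rep n j : set T := [set w | [/\ U w, nu w = j &
  exists z, [/\ U z, nu z = n & near z w]]].
pose adj n j := `[< rep n j !=set0 >].
have [n|col [colm hcol]] := @nat_coloring adj m.
  have [[z [Uz zn]]|nz] := pselect (exists z, U z /\ nu z = n); last first.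
    rewrite (_ : [seq _ <- _ | _] = [::])//; apply/eqP; rewrite -size_eq0 size_filter.
    rewrite -leqn0 leqNgt -has_count; apply/hasPn => j _; apply/asboolPn.
    by move=> [w [_ _ [z [Uz zn _]]]]; apply: nz; exists z.
  pose J := [seq j <- iota 0 n | adj n j].
  have repJ j : j \in J -> rep n j (xget z (rep n j)).
    by rewrite mem_filter => /andP[/asboolP h _]; exact: xgetPex.
  have uJ : uniq [seq xget z (rep n j) | j <- J].
    rewrite map_inj_in_uniq ?filter_uniq ?iota_uniq// => i j /repJ[_ e1 _] /repJ[_ e2 _] e.
    by rewrite -e1 -e2 e.
  rewrite -(size_map (fun j => xget z (rep n j))) -(undup_id uJ) -card_fseq.
  apply: (hm z) => // w /=; rewrite inE => /mapP[j /repJ[Uw wj [z' [Uz' z'n z'w]]] ->].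
  have e : z' = z by apply: nuI; rewrite ?inE// zn z'n.
  by rewrite e in z'w; split.
exists (col \o nu); split => [z|z w Uz Uw zw zNw]; first exact: colm.
wlog lt : z w Uz Uw zw zNw / (nu w < nu z)%N.
  move=> h; have [lt|lt|e] := ltngtP (nu w) (nu z); first exact: h.
    by move=> e; apply: (h w z) => //; [exact: nearC|exact: nesym].
  by case: zNw; apply: nuI; rewrite ?inE.
move=> e; apply: (hcol (nu z) (nu w) lt) => //; apply/asboolP; exists w.
by split => //; exists z.
Qed.

Lemma expr_small (R : realType) (x e : R) : 0 < x < 1 -> 0 < e ->
  exists2 N : nat, (0 < N)%N & x ^+ N <= e.
Proof.
move=> /andP[x0 x1] e0.
have h : x ^+ n @[n --> \oo] --> (0 : R) by apply: cvg_expr; rewrite gtr0_norm.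
have [N _ hN] : \forall n \near \oo, `|x ^+ n| < e.
  move/cvgrPdist_lt: h => /(_ e e0); apply: filterS => n; by rewrite sub0r normrN.
exists N.+1 => //; apply: ltW; apply: le_lt_trans (ler_norm _) _; apply: hN => /=.
exact: leqnSn.
Qed.

Section AdjacentSystems.
Context (R : realType) (disp : measure_display) (X : measurableType disp).
Variables (d : X -> X -> R) (mu : {measure set X -> \bar R}) (cd cmu : R).
Hypothesis HT : homogeneous_type d mu cd cmu.
Variables (c0 C0 delta alpha : R) (D : set (cube X)).
Hypothesis DS : dyadic_system d c0 C0 delta D.
Hypothesis alpha0 : 0 <= alpha.

(* The systems are generated by nets that, for a given color j, contain all the
   points of color j of a net one generation finer; hence every point of the
   finer net is the center of a coarser cube of one of the systems. *)
Lemma adjacent_systems : exists (c1 C1 delta1 : R) (N m : nat)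
    (D' : nat -> set (cube X)) (C : R),
  [/\ (0 < N)%N, 1 <= C, forall j, dyadic_system d c1 C1 delta1 (D' j) &
    forall Q, D Q -> exists j (Q' : cube X),
      [/\ (j <= m)%N, D' j Q', cube_gen Q' = (cube_gen Q %/ N)%Z - 1,
          cube_dilate d C0 delta alpha Q `<=` Q' &
          vol mu Q' <=
            C * vol mu (qball d (cube_center Q) (c0 * delta ^ cube_gen Q))]].
Proof.
have cd0 := cd_gt0 HT; have cd1 := cd_ge1 HT.
have c00 := dyadic_c0_gt0 DS; have C00 := dyadic_C0_gt0 DS; have c0C0 := dyadic_C0 DS.
have dl0 := dyadic_delta_gt0 DS; have dl1 := dyadic_delta_lt1 DS.
(* Density constant of the mixed nets [A j k]: x is within C0 De^k of some z in Y k, and if z was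
   discarded it is within c0 De^k <= C0 De^k of a point of color j. *)
pose b := 2 * cd * C0; have b0 : 0 < b by rewrite !mulr_gt0.
have ab : c0 <= b.
  apply: (le_trans c0C0); rewrite /b ler_peMl ?(ltW C00)//; lra.
(* The first summand gives the smallness required by [christ_cubes]; the second makes alpha Q fit
   into the inner ball of a cube one generation coarser. *)
pose K := 8 * cd ^+ 3 * b + cd * C0 * (1 + alpha) * (4 * cd ^+ 2).
have K1 : 0 < 8 * cd ^+ 3 * b by rewrite !mulr_gt0// exprn_gt0.
have K2 : 0 <= cd * C0 * (1 + alpha) * (4 * cd ^+ 2).
  by rewrite !mulr_ge0 ?addr_ge0 ?exprn_ge0// ltW.
have K0 : 0 < K by rewrite /K; lra.
have [N N0 hN] := expr_small (dyadic_delta DS) (divr_gt0 c00 K0).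
set De := delta ^+ N in hN.
have De0 : 0 < De by rewrite exprn_gt0.
have hK : K * De <= c0 by rewrite mulrC -ler_pdivlMr.
have DekE (k : int) : De ^ k = delta ^ ((N : int) * k).
  by rewrite /De exprnP exprz_exp.
have Dek0 k : 0 < De ^ k by exact: exprz_gt0.
have DeS (k : int) : De ^ (k + 1) = De * De ^ k.
  by rewrite exprzDr ?unitfE ?gt_eqF// expr1z mulrC.
pose Y (k : int) := dyadic_centers D ((N : int) * k).
have sepY k : qseparated d (c0 * De ^ k) (Y k).
  by rewrite DekE; exact: (dyadic_centers_separated HT DS).
have denseY k x : exists2 z, Y k z & d x z < C0 * De ^ k.
  by rewrite DekE; exact: (dyadic_centers_dense HT DS).
have [m hm] := qseparated_card HT De^-1.
have colorY k : exists col : X -> nat, (forall z, col z <= m)%N /\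
    forall z w, Y (k + 1) z -> Y (k + 1) w -> d z w < c0 * De ^ k -> z <> w ->
      col z <> col w.
  apply: (@countable_coloring _ _ (fun z w => d z w < c0 * De ^ k) m).
  - exact: (qseparated_countable HT (mulr_gt0 c00 (Dek0 (k + 1))) (@sepY _)).
  - by move=> z w; rewrite (qdistC HT).
  - move=> z B Yz BY; apply: (hm z (c0 * De ^ (k + 1))); first exact: mulr_gt0.
      by move=> u v /BY[Yu _] /BY[Yv _]; exact: sepY.
    move=> w /BY[_ /= zw]; rewrite /qball/= DeS.
    by rewrite (_ : _ * _ = c0 * De ^ k)//; field; rewrite gt_eqF.
have [col hcol] := choice colorY.
(* Points of equal color in the finer net are c0 De^k apart by the choice of the coloring; points of
   Y k at this distance from all of them are added to restore density. *)
pose A j k : set X := [set z | Y (k + 1) z /\ col k z = j] `|`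
  [set z | Y k z /\ forall w, Y (k + 1) w -> col k w = j -> c0 * De ^ k <= d z w].
have christ j : exists D' : set (cube X),
    dyadic_system d (c0 / (4 * cd ^+ 2)) (2 * cd * b) De D' /\
    forall k z, A j k z ->
    exists2 Q : cube X, D' Q & cube_gen Q = k /\ cube_center Q = z.
  apply: (christ_cubes HT c00 ab De0).
  - by apply: le_trans hK; rewrite ler_pM2r// /K lerDl.
  - move=> k z w [[Yz zj]|[Yz hz]] [[Yw wj]|[Yw hw]] zw.
    + rewrite leNgt; apply/negP => h; have [_ hc] := hcol k.
      by apply: (hc _ _ Yz Yw h zw); rewrite zj wj.
    + by rewrite (qdistC HT); exact: hw.
    + exact: hz.
    + exact: sepY.
  - move=> k x; have [z Yz xz] := denseY k x.
    have [far|] := pselect (forall w, Y (k + 1) w -> col k w = j -> c0 * De ^ k <= d z w).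
      exists z; first by right.
      apply: (lt_le_trans xz); rewrite ler_pM2r// /b ler_peMl ?(ltW C00)//; lra.
    move=> /existsNP[w /not_implyP[Yw /not_implyP[wj /negP]]].
    rewrite -ltNge => zw; exists w; first by left.
    apply: le_lt_trans (qdist_tri HT z _ _) _.
    have : d x z + d z w < 2 * (C0 * De ^ k).
      have : c0 * De ^ k <= C0 * De ^ k by rewrite ler_pM2r.
      lra.
    by rewrite -(ltr_pM2l cd0) => /lt_le_trans; apply; rewrite /b le_eqVlt; apply/orP;
      left; apply/eqP; ring.
have [D' hD'] := choice christ.
pose C1 := 2 * cd * b.
have C10 : 0 < C1 by rewrite !mulr_gt0.
have [C C_ge1 hC] := vol_qball_comparable HT (C1 / (c0 * De ^+ 2)) (C0 / (c0 * De)).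
exists (c0 / (4 * cd ^+ 2)), C1, De, N, m, D', C; split => //.
  by move=> j; have [] := hD' j.
move=> Q DQ; set kap := cube_gen Q; set q := (kap %/ N)%Z.
have kapE := divz_eq kap N; rewrite -/q in kapE.
have N0z : (0 < (N : int)) by rewrite ltz_nat.
have rN : (kap %% N)%Z < N by rewrite ltz_pmod.
have r0 : 0 <= (kap %% N)%Z by rewrite modz_ge0// gt_eqF.
have dlk1 : delta ^ kap <= De ^ q.
  by rewrite DekE; apply: (dyadic_scale_le DS); rewrite [leRHS]kapE (mulrC q) lerDl.
have dlk2 : De ^ (q + 1) <= delta ^ kap.
  rewrite DekE; apply: (dyadic_scale_le DS).
  by rewrite [leLHS]kapE mulrDr mulr1 (mulrC q) lerD2l ltW.
(* The point w of the net of generation q belongs, through its color, to a net of generation q - 1.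
   This is where the -1 in the generation of Q' comes from. *)
have [w Yw zw] := denseY q (cube_center Q).
have qE : q - 1 + 1 = q by rewrite subrK.
have Aw : A (col (q - 1) w) (q - 1) w by left; rewrite qE.
have [DSj hj] := hD' (col (q - 1) w).
have [Q' DQ' [gQ' cQ']] := hj _ _ Aw.
have Deq : De ^ q = De * De ^ (q - 1) by rewrite -DeS qE.
exists (col (q - 1) w), Q'; split => //.
- by have [] := hcol (q - 1).
- apply: subset_trans (dyadic_inner DSj DQ').
  rewrite /cube_dilate gQ' cQ'; apply: (qball_sub HT).
  have : d w (cube_center Q) + alpha * C0 * delta ^ cube_gen Q <=
      C0 * (1 + alpha) * De ^ q.
    rewrite mulrDr mulrDl mulr1 (mulrC C0 alpha); apply: lerD.
      by rewrite (qdistC HT) ltW.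
    by rewrite ler_wpM2l// mulr_ge0// ltW.
  rewrite -(ler_pM2l cd0) => /le_trans; apply; rewrite Deq.
  rewrite (_ : cd * _ = cd * C0 * (1 + alpha) * (4 * cd ^+ 2) * De * (De ^ (q - 1) / (4 *
    cd ^+ 2))); last first.
    by field; rewrite gt_eqF.
  rewrite (_ : c0 / _ * _ = c0 * (De ^ (q - 1) / (4 * cd ^+ 2))); last first.
    by field; rewrite gt_eqF.
  rewrite ler_pM2r ?divr_gt0 ?mulr_gt0 ?exprn_gt0//.
  apply: le_trans hK; rewrite ler_pM2r// /K lerDr; exact: ltW.
- apply: le_trans (hC w _ _ _ _); last first.
  + apply: (lt_le_trans (y := C0 * De ^ q)); first by rewrite (qdistC HT).
    rewrite (_ : C0 / _ * _ = C0 * (delta ^ kap / De)); last first.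
      by rewrite /kap; field; rewrite !gt_eqF.
    by rewrite ler_pM2l// ler_pdivlMr// mulrC -DeS.
  + by rewrite mulr_gt0// exprz_gt0.
  apply: vol_le.
  + exact: dyadic_measurable DSj _ DQ'.
  + exact: measurable_qball HT _ _.
  + apply: subset_trans (dyadic_outer DSj DQ') _; rewrite gQ' cQ'.
    apply: qball_le; rewrite -/C1.
    rewrite (_ : C1 / _ * _ = C1 * (delta ^ kap / De ^+ 2)); last first.
      by rewrite /kap; field; rewrite !gt_eqF.
    rewrite ler_pM2l// ler_pdivlMr ?exprn_gt0// expr2 mulrC -mulrA -Deq.
    by rewrite -DeS.
  + exact: qball_lty HT _ _.
Qed.

End AdjacentSystems.

(** * Near-extremal bases *)

Lemma norm_det_le (R : realDomainType) (k : nat) (A : 'M[R]_k) (B : R) :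
  (forall i j, `|A i j| <= B) -> `|\det A| <= (k`!)%:R * B ^+ k.
Proof.
move=> hA; rewrite /determinant; apply: le_trans (ler_norm_sum _ _ _) _.
have -> : (k`!)%:R * B ^+ k = \sum_(s : 'S_k) B ^+ k.
  by rewrite sumr_const card_Sn mulr_natl.
apply: ler_sum => s _; rewrite normrM normr_sign mul1r normr_prod.
rewrite -[in leRHS](card_ord k) -prodr_const; apply: ler_prod => i _.
by rewrite normr_ge0 hA.
Qed.

(* Rows of (nearly) maximal determinant: by Cramer's rule the coordinates of a
   point of K are quotients of determinants, hence at most 2. *)
Lemma near_extremal_basis (R : realType) (n : nat) (K : set 'rV[R]_n) (M : R) :
  (forall u i, K u -> `|u ord0 i| <= M) ->
  exists (k : nat) (V : 'M[R]_(k, n)) (W : 'M[R]_(n, k)),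
    [/\ (k <= n)%N, forall i, K (row i V) &
        forall u, K u -> u = u *m W *m V /\ forall i, `|(u *m W) ord0 i| <= 2].
Proof.
move=> KM.
pose good k := `[< exists V : 'M[R]_(k, n), row_free V /\ forall i, K (row i V) >].
have g0 : exists k, good k.
  exists 0%N; apply/asboolP; exists 0; split; last by case.
  by rewrite /row_free mxrank0.
have gn k : good k -> (k <= n)%N.
  by move=> /asboolP[V [/eqP e _]]; have := rank_leq_col V; rewrite e.
have [k /asboolP[V0 [fV0 KV0]] kmax] := ex_maxnP g0 gn.
(* By maximality of k, adding u to k independent rows from K cannot give k + 1 independent rows. *)
have span (V : 'M[R]_(k, n)) u : row_free V -> (forall i, K (row i V)) -> K u ->
    (u <= V)%MS.
  move=> fV KV Ku; apply: contrapT => /negP uV.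
  suff /kmax : good k.+1 by rewrite ltnn.
  rewrite -addn1; apply/asboolP; exists (col_mx V u); split; last first.
    move=> i; rewrite -(splitK i); case: (fintype.split i) => j /=.
      by rewrite rowKu.
    by rewrite rowKd (_ : row j u = u)//; apply/rowP => l; rewrite mxE (ord1 j).
  have : (V < V + u)%MS by rewrite ltmxE addsmxSl /= addsmx_sub submx_refl.
  move=> /rank_ltmx; rewrite addsmxE (eqP fV) => h.
  by rewrite /row_free eqn_leq rank_leq_row /=; apply: leq_trans h; rewrite addn1.
(* With the right inverse W0 of V0, the number |det (V W0)| is a volume for k rows in the span of K,
   equal to 1 for V0; boundedness of K makes its supremum finite. *)
have /row_freeP[W0 VW0] := fV0.
pose S : set R := [set x | exists V : 'M[R]_(k, n),
  (forall i, K (row i V)) /\ x = `|\det (V *m W0)|].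
have S1 : S 1 by exists V0; split => //; rewrite VW0 det1 normr1.
pose B := \sum_i \sum_j M * `|W0 i j|.
have supS : has_sup S.
  split; first by exists 1.
  exists ((k`!)%:R * B ^+ k) => _ [V [KV ->]]; apply: norm_det_le => i j.
  rewrite mxE; apply: le_trans (ler_norm_sum _ _ _) _; apply: ler_sum => l _.
  have h : `|V i l| <= M by have := KM _ l (KV i); rewrite mxE.
  rewrite (bigD1 j)//= normrM; apply: ler_wpDr; last by rewrite ler_wpM2r.
  by apply: sumr_ge0 => ? _; rewrite mulr_ge0// (le_trans _ h).
have sup1 : 1 <= sup S by apply: ub_le_sup => //; case: supS.
(* K is not assumed closed, so the supremum may not be attained; settling for half of it costs the
   factor 2 in the coordinates. *)
have sup2 : 0 < sup S / 2 by rewrite divr_gt0// (lt_le_trans ltr01).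
have [x [V [KV xE]] xS] := sup_adherent sup2 supS.
set G := V *m W0 in xE.
have Gx : sup S / 2 < `|\det G| by rewrite -xE; apply: le_lt_trans xS; lra.
have detG : \det G != 0 by rewrite -normr_gt0 (lt_trans sup2).
have uG : G \in unitmx by rewrite unitmxE unitfE.
pose W := W0 *m invmx G.
have VW : V *m W = 1%:M by rewrite mulmxA mulmxV.
have fV : row_free V by apply/row_freeP; exists W.
exists k, V, W; split => //; first by apply: gn; apply/asboolP; exists V.
move=> u Ku; have /submxP[c uc] := span V u fV KV Ku.
have uW : u *m W = c by rewrite uc -mulmxA VW mulmx1.
rewrite uW -uc; split => // i.
pose V' := \matrix_(j < k) (if j == i then u else row j V).
have V'S : S `|\det (V' *m W0)|.
  by exists V'; split => // j; rewrite rowK; case: ifP.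
have detV' : \det (V' *m W0) = c ord0 i * \det G.
  rewrite (expand_det_row _ i).
  transitivity (\sum_j (c *m G) ord0 j * (\adj G) j i).
    apply: eq_bigr => j _; congr (_ * _).
      rewrite /G mulmxA -uc !mxE; apply: eq_bigr => l _.
      by rewrite !mxE eqxx.
    rewrite [RHS]mxE /cofactor; congr (_ * \det _); apply/matrixP => a b.
    rewrite /row' /col' !mxE; apply: eq_bigr => l _; rewrite !mxE.
    by rewrite eq_sym (negbTE (neq_lift _ _)) mxE.
  transitivity ((c *m G *m \adj G) ord0 i); first by rewrite [RHS]mxE.
  by rewrite -mulmxA mul_mx_adj mul_mx_scalar mxE mulrC.
have : `|\det (V' *m W0)| <= sup S by apply: ub_le_sup => //; case: supS.
rewrite detV' normrM => h.
have : `|c ord0 i| * `|\det G| <= 2 * `|\det G| by apply: le_trans h _; lra.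
by rewrite ler_pM2r// (lt_trans sup2).
Qed.

(** * Measure-theoretic preliminaries *)

Lemma ae_forall_countable (disp : measure_display) (X : measurableType disp)
    (R : realType) (mu : {measure set X -> \bar R}) (I : Type) (D : set I)
    (P : I -> X -> Prop) :
  countable D -> (forall i, D i -> {ae mu, forall x, P i x}) ->
  {ae mu, forall x, forall i, D i -> P i x}.
Proof.
move=> /countable_injP[f finj] h.
have /ae_foralln : forall n, {ae mu, forall x, forall i, D i -> f i = n -> P i x}.
  move=> n; have [[i [Di fi]]|nD] := pselect (exists i, D i /\ f i = n).
    apply: filterS (h i Di) => x Pix j Dj fj.
    by rewrite (finj j i) ?inE// fj fi.
  by apply: aeW => x i Di fi; case: nD; exists i.
by apply: filterS => x hx i Di; exact: (hx (f i)).
Qed.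

(** Turns the essential oscillation, taken over pairs of points, into a bound at a.e. z once y is
    fixed outside a null set. *)
Lemma ae_prod_section (disp : measure_display) (X : measurableType disp)
    (R : realType) (mu : {sigma_finite_measure set X -> \bar R})
    (P : X * X -> Prop) :
  {ae (mu \x mu)%E, forall p, P p} ->
  {ae mu, forall y, {ae mu, forall z, P (y, z)}}.
Proof.
move=> [N [mN muN0 hN]].
have ms := @measurable_fun_xsection _ _ _ _ R mu N mN.
have : ae_eq mu setT (mu \o xsection N) (cst 0%E).
  apply/(ae_eq_integral_abs mu measurableT ms).
  rewrite -[RHS]muN0 /product_measure1; apply: eq_integral => x _.
  by rewrite gee0_abs.
apply: filterS => y /(_ I) /= h.
exists (xsection N y); split => //; first exact: measurable_xsection.
by move=> z hz; rewrite /xsection /= inE; apply: hN.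
Qed.

(** A countable measurable cover nearly attains the outer measure. The loss from c to c' is the
    reason why the set where the sharp maximal function is large later costs 2 lam instead of
    lam. *)
Lemma mu_ext_hull (disp : measure_display) (X : measurableType disp)
    (R : realType) (mu : {measure set X -> \bar R}) (A : set X) (c c' : \bar R) :
  (mu_ext mu A <= c)%E -> (c < c')%E ->
  exists2 A', measurable A' /\ A `<=` A' & (mu A' <= c')%E.
Proof.
move=> h cc'; have [_ [F [mF AF] <-] hF] := ereal_inf_lt (le_lt_trans h cc').
exists (\bigcup_n F n); first by split => //; exact: bigcup_measurable.
apply: le_trans (ltW hF); apply: measure_sigma_subadditive => //.
exact: bigcup_measurable.
Qed.

(** Serves in two covering arguments: with h = |g|^s for cubes with large averages, and with h the
    indicator of the exceptional set for the stopping cubes. *)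
Lemma disjoint_cover_measure (disp : measure_display) (X : measurableType disp)
    (R : realType) (mu : {measure set X -> \bar R}) (h : X -> \bar R)
    (c : R) (G : set (cube X)) :
  0 <= c -> measurable_fun setT h -> (forall x, 0 <= h x)%E ->
  countable G -> (forall Q, G Q -> measurable (Q : set X)) ->
  (forall P Q x, G P -> G Q -> (P : set X) x -> (Q : set X) x -> P = Q) ->
  (forall Q, G Q -> (mu Q <= c%:E * \int[mu]_(x in Q) h x)%E) ->
  (mu (\bigcup_(Q in G) Q) <= c%:E * \int[mu]_(x in \bigcup_(Q in G) Q) h x)%E.
Proof.
move=> c0 mh h0 /countable_injP[f finj] mG disjG hG.
pose F n := \bigcup_(Q in G `&` [set Q | f Q = n]) (Q : set X).
have FE : \bigcup_(Q in G) (Q : set X) = \bigcup_n F n.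
  apply/seteqP; split => [x [Q GQ Qx]|x [n _ [Q [GQ _] Qx]]]; last by exists Q.
  by exists (f Q) => //; exists Q.
have F1 n Q : G Q -> f Q = n -> F n = Q.
  move=> GQ fQ; apply/seteqP; split => [x [P [GP fP] Px]|x Qx]; last by exists Q.
  by rewrite (finj Q P) ?inE// fP.
have F0 n : ~ (exists Q, G Q /\ f Q = n) -> F n = set0.
  move=> nQ; apply/seteqP; split => // x [Q [GQ fQ] _].
  by apply: nQ; exists Q.
have mF n : measurable (F n).
  have [[Q [GQ fQ]]|nQ] := pselect (exists Q, G Q /\ f Q = n).
    by rewrite (F1 _ Q)//; exact: mG.
  by rewrite F0.
have tF : trivIset [set: nat] F.
  move=> i j _ _ [x [[P [GP <-] Px] [Q [GQ <-] Qx]]].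
  by rewrite (disjG P Q x).
rewrite FE ge0_integral_bigcup//; last exact: measurable_funTS.
rewrite measure_bigcup//.
rewrite (eq_eseriesl (Q := xpredT)); last by move=> i; rewrite in_setT.
rewrite -nneseriesZl; last by move=> i _; apply: integral_ge0 => x _; exact: h0.
apply: lee_nneseries => [//|n _].
have [[Q [GQ fQ]]|nQ] := pselect (exists Q, G Q /\ f Q = n).
  by rewrite (F1 _ Q)//; exact: hG.
by rewrite F0// measure0 integral_set0 mule0.
Qed.

(** * Maximal cubes of a family, and density points along cubes *)

Section MaximalCubes.
Context (R : realType) (disp : measure_display) (X : measurableType disp).
Variables (d : X -> X -> R) (c0 C0 delta : R) (D : set (cube X)).
Hypothesis DS : dyadic_system d c0 C0 delta D.
Variables (F : set (cube X)) (k0 : int).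
Hypotheses (FD : F `<=` D) (Fk0 : forall Q, F Q -> k0 <= cube_gen Q).

(** Maximality compares generations instead of sets: the same set may occur in several generations,
    and inclusion would then not single out one cube. *)
Definition maximal_cubes : set (cube X) := [set Q | F Q /\
  forall P x, F P -> (P : set X) x -> (Q : set X) x -> cube_gen Q <= cube_gen P].

Lemma maximal_cubes_disjoint P Q x : maximal_cubes P -> maximal_cubes Q ->
  (P : set X) x -> (Q : set X) x -> P = Q.
Proof.
move=> [FP hP] [FQ hQ] Px Qx; apply: (dyadic_uniq DS (x := x)) => //; [exact: FD|exact: FD|].
by apply/eqP; rewrite eq_le (hP _ x)// (hQ _ x).
Qed.

Lemma sub_maximal_cube Q : F Q -> exists2 P, maximal_cubes P & Q `<=` P.
Proof.
have [n] := ubnP `|cube_gen Q - k0|%N; elim: n Q => // n IH Q hn FQ.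
have [mQ|] := pselect (maximal_cubes Q); first by exists Q.
move=> /not_andP[//|/existsNP[P /existsNP[x]]].
move=> /not_implyP[FP /not_implyP[Px /not_implyP[Qx /negP]]]; rewrite -ltNge => PQ.
have hP := Fk0 FP.
have [|//|P' mP' PP'] := IH P.
  by move: hn hP PQ; clear; move: (cube_gen P) (cube_gen Q) => a b; lia.
exists P' => //; apply: subset_trans PP'.
by apply: (dyadic_sub DS (x := x)) => //; [exact: FD|exact: FD|exact: ltW].
Qed.

End MaximalCubes.

Section Density.
Context (R : realType) (disp : measure_display) (X : measurableType disp).
Variables (d : X -> X -> R) (mu : {measure set X -> \bar R}) (cd cmu : R).
Hypothesis HT : homogeneous_type d mu cd cmu.
Variables (c0 C0 delta : R) (D : set (cube X)).
Hypothesis DS : dyadic_system d c0 C0 delta D.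

Lemma vol_setDI (A E : set X) : measurable A -> measurable E -> (mu A < +oo)%E ->
  vol mu A = vol mu (A `\` E) + vol mu (A `&` E).
Proof.
move=> mA mE fA.
have f1 : (mu (A `\` E) < +oo)%E.
  exact: (finite_sub (measurableD mA mE) mA (@subDsetl _ _ _) fA).
have f2 : (mu (A `&` E) < +oo)%E.
  exact: (finite_sub (measurableI _ _ mA mE) mA (@subIsetl _ _ _) fA).
apply: EFin_inj; rewrite EFinD -!volE//.
exact: measureDI.
Qed.

(** A cube Q containing x lies in the ball about x of radius 2 cd C0 delta^k, where k is its
    generation, and this ball has measure at most C mu(Q). So it is enough that the complement of E
    has density at most (1 - theta) / (2 C) in small balls about x, which Lebesgue differentiation
    of the indicator gives at a.e. x of E. *)
Lemma dyadic_density (E : set X) (theta : R) : measurable E -> theta < 1 ->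
  {ae mu, forall x, E x -> exists k0 : int, forall Q, D Q -> k0 <= cube_gen Q ->
     (Q : set X) x -> theta * vol mu Q < vol mu (Q `&` E)}.
Proof.
move=> mE th1.
have cd0 := cd_gt0 HT; have cd1 := cd_ge1 HT; have C00 := dyadic_C0_gt0 DS.
pose t := 2 * cd * C0; have t0 : 0 < t by rewrite !mulr_gt0.
have [C C1 hC] := dyadic_vol_dilate HT DS (cd * (C0 + t)).
have C_gt0 : 0 < C by exact: lt_le_trans C1.
pose e := (1 - theta) / (2 * C).
have e0 : 0 < e by rewrite divr_gt0 ?mulr_gt0// subr_gt0.
have li : qlocally_integrable d mu (\1_E : X -> R).
  split => [|x rho rho0]; first exact: measurable_indic.
  have mB := measurable_qball HT x rho; apply/integrableP; split.
    by apply/measurable_EFinP; exact: measurable_indic.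
  under eq_integral do rewrite gee0_abs ?lee_fin//.
  rewrite integral_indic//.
  exact: (finite_sub (measurableI _ _ mE mB) mB (@subIsetr _ _ _) (qball_lty HT _ _)).
apply: filterS (homogeneous_lebesgue HT li) => x hx Ex.
have {hx} : \forall rho \near 0^'+, `|1 - (fine (mu (qball d x rho)))^-1 *
    \int[mu]_(y in qball d x rho) (\1_E y : R)| < e.
  by move/cvgrPdist_lt: hx => /(_ _ e0); rewrite indicE mem_set.
move=> /nbhs_ballP[r /= r0 hr].
have {hr} small rho : 0 < rho -> rho < r ->
    vol mu (qball d x rho `\` E) <= e * vol mu (qball d x rho).
  move=> rho0 rhor; have mB := measurable_qball HT x rho.
  have fB := qball_lty HT x rho; have V0 := vol_qball_gt0 HT x rho0.
  have /hr/(_ rho0) : ball (0 : R) r rho by rewrite /ball/= sub0r normrN gtr0_norm.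
  rewrite /Rintegral integral_indic// setIC -/(vol mu (_ `&` E)) -/(vol mu _) => h.
  rewrite -(ler_pM2l (_ : 0 < (vol mu (qball d x rho))^-1)) ?invr_gt0// mulrCA mulVf
    ?gt_eqF// mulr1.
  apply: le_trans (ltW h); apply: le_trans (ler_norm _).
  rewrite le_eqVlt; apply/orP; left; apply/eqP.
  have := vol_setDI mB mE fB => ->; field.
  by rewrite -vol_setDI// gt_eqF.
have [N N0 hN] := expr_small (dyadic_delta DS) (divr_gt0 r0 (mulr_gt0 t0 (ltr0n R 2))).
exists N => Q DQ gQ Qx.
have mQ := dyadic_measurable DS DQ; have fQ := dyadic_lty HT DS DQ.
set rho := t * delta ^ cube_gen Q.
have rho0 : 0 < rho by rewrite mulr_gt0// (dyadic_scale_gt0 DS).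
have rhor : rho < r.
  have h : delta ^ cube_gen Q <= r / (t * 2).
    by apply: le_trans hN; rewrite exprnP; exact: (dyadic_scale_le DS).
  apply: (@le_lt_trans _ _ (t * (r / (t * 2)))); first by rewrite ler_pM2l.
  rewrite (_ : t * _ = r / 2); last by field; rewrite gt_eqF.
  by rewrite ltr_pdivrMr// mulr2n mulrDr mulr1 ltrDl.
have QB : Q `<=` qball d x rho by exact: (dyadic_sub_qball HT DS DQ Qx).
have h1 : vol mu (Q `\` E) <= e * vol mu (qball d x rho).
  apply: le_trans (small _ rho0 rhor); apply: vol_le.
  - exact: measurableD.
  - by apply: measurableD => //; exact: measurable_qball HT _ _.
  - by apply: setSD.
  - apply: finite_sub (qball_lty HT x rho); [|exact: measurable_qball HT _ _|exact: subDsetl].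
    by apply: measurableD => //; exact: measurable_qball HT _ _.
have h2 : vol mu (qball d x rho) <= C * vol mu Q.
  apply: le_trans (hC Q DQ); apply: vol_le;
    [exact: measurable_qball HT _ _|exact: measurable_qball HT _ _| |exact: qball_lty HT _ _].
  apply: (qball_sub HT); rewrite -mulrA ler_pM2l// mulrDl lerD2r.
  exact/ltW/(dyadic_outer DS DQ).
have V0 := dyadic_vol_gt0 HT DS DQ.
have h3 : vol mu (Q `\` E) <= (1 - theta) / 2 * vol mu Q.
  apply: (le_trans h1); rewrite /e (_ : (1 - theta) / 2 * vol mu Q = (1 - theta) / (2 * C)
    * (C * vol mu Q)); last first.
    by field; rewrite gt_eqF.
  by rewrite ler_pM2l.
have := vol_setDI mQ mE fQ.
move: h3 V0; move: (vol mu (Q `\` E)) (vol mu Q) (vol mu (Q `&` E)) => u v w.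
move=> h3 v0 h; have : 0 < (1 - theta) / 2 * v by rewrite mulr_gt0// divr_gt0 ?subr_gt0.
by lra.
Qed.

End Density.

(** * Boundedly supported functions *)

Section PowerIntegral.
Context (R : realType) (disp : measure_display) (X : measurableType disp).
Variable mu : {measure set X -> \bar R}.
Implicit Types (s q : R) (A : set X) (g : X -> R).

Definition pow_integral s A g : \bar R :=
  (\int[mu]_(x in A) (`|g x| `^ s)%:E)%E.

Lemma measurable_norm_powR s g : measurable_fun [set: X] g ->
  measurable_fun [set: X] (fun x => (`|g x| `^ s)%:E).
Proof.
move=> mg; apply/measurable_EFinP.
apply: (measurableT_comp (measurable_powR s)).
exact: (measurableT_comp (@normr_measurable _ _)).
Qed.

Lemma pow_integral_ge0 s A g : (0 <= pow_integral s A g)%E.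
Proof. by apply: integral_ge0 => x _; rewrite lee_fin powR_ge0. Qed.

Lemma pow_integral_sub s A B g : measurable A -> measurable B ->
  measurable_fun [set: X] g -> A `<=` B ->
  (pow_integral s A g <= pow_integral s B g)%E.
Proof.
move=> mA mB mg AB; apply: ge0_subset_integral => //.
exact/measurable_funTS/measurable_norm_powR.
Qed.

(** The pointwise bound |g|^q <= 1 + |g|^s replaces Jensen's inequality. It gives 1 + M where
    M^(1/s) would be optimal, which only affects constants. *)
Lemma avg_norm_le s q A g M : 1 <= q -> q <= s -> measurable A ->
  (mu A < +oo)%E -> 0 < vol mu A -> measurable_fun [set: X] g -> 0 <= M ->
  (pow_integral s A g <= (M * vol mu A)%:E)%E ->
  (avg_norm mu q%:E A (EFin \o g) <= (1 + M)%:E)%E.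
Proof.
move=> q1 qs mA fA A0 mg M0 hM; rewrite /avg_norm.
have q0 : 0 < q by exact: lt_le_trans q1.
have s0 : 0 < s by exact: lt_le_trans qs.
have h : (\int[mu]_(x in A) (`|(EFin \o g) x| `^ q) <= ((1 + M) * vol mu A)%:E)%E.
  apply: (@le_trans _ _ (\int[mu]_(x in A) (1 + (`|g x| `^ s)%:E))%E).
    apply: ge0_le_integral => //.
    - by move=> x _; exact: poweR_ge0.
    - exact/measurable_funTS/measurable_norm_powR.
    - apply: emeasurable_funD => //.
      exact/measurable_funTS/measurable_norm_powR.
    - move=> x _; rewrite /= -EFinD lee_fin.
      have [g1|g1] := leP 1 `|g x|.
        by apply: ler_wpDl => //; exact: ler_powR.
      rewrite -[leLHS]addr0 lerD ?powR_ge0//.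
      apply: (@le_trans _ _ (1 `^ q)); last by rewrite powR1.
      by apply: ge0_ler_powR; rewrite ?nnegrE// ltW.
  rewrite ge0_integralD//; last exact/measurable_funTS/measurable_norm_powR.
  by rewrite integral_cst// mul1e volE// mulrDl mul1r EFinD leeD2l.
have h2 : ((mu A)^-1 * \int[mu]_(x in A) (`|(EFin \o g) x| `^ q) <= (1 + M)%:E)%E.
  rewrite volE// inver gt_eqF// muleC lee_pdivrMr//.
apply: (@le_trans _ _ ((1 + M)%:E `^ q^-1)%E).
  apply: gt0_ler_poweR => //; first by rewrite invr_ge0 ltW.
    rewrite in_itv /= leey andbT; apply: mule_ge0.
      by rewrite volE// inver gt_eqF// lee_fin invr_ge0 ltW.
    by apply: integral_ge0 => x _; rewrite lee_fin powR_ge0.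
  by rewrite in_itv /= leey andbT lee_fin addr_ge0.
rewrite poweR_EFin lee_fin -[leRHS]powRr1 ?addr_ge0//.
by apply: ler_powR; rewrite ?lerDl// invf_le1.
Qed.

Lemma LfunP_pow_integral s g : 0 < s -> (g \in Lfun mu s%:E) <->
  measurable_fun [set: X] g /\ (pow_integral s [set: X] g < +oo)%E.
Proof.
move=> s0; rewrite inE /= /pow_integral; split.
  move=> /andP[]; rewrite !inE /= => mg; rewrite /finite_norm unlock => /lty_poweRy h.
  by split => //; apply: h; rewrite invr_neq0 ?gt_eqF.
move=> [mg h]; apply/andP; rewrite !inE /=; split => //.
by rewrite /finite_norm unlock; exact: poweR_lty.
Qed.

Lemma pow_integral_cutoff s A g : 0 < s -> measurable A ->
  pow_integral s [set: X] (cutoff A g) = pow_integral s A g.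
Proof.
move=> s0 mA; rewrite /pow_integral [RHS]integral_mkcond.
apply: eq_integral => x _; rewrite /cutoff patchE indicE.
by case: ifPn => _; rewrite ?mulr1// mulr0 normr0 powR0// gt_eqF.
Qed.

Lemma measurable_cutoff A g : measurable A -> measurable_fun [set: X] g ->
  measurable_fun [set: X] (cutoff A g).
Proof. by move=> mA mg; apply: measurable_funM => //; exact: measurable_indic. Qed.

End PowerIntegral.

Section BoundedFunctions.
Context (R : realType) (disp : measure_display) (X : measurableType disp).
Variables (d : X -> X -> R) (mu : {measure set X -> \bar R}) (cd cmu : R).
Hypothesis HT : homogeneous_type d mu cd cmu.
Variable s : R.
Hypothesis s1 : 1 <= s.

Let s0 : 0 < s. Proof. exact: lt_le_trans s1. Qed.

Lemma bounded_Lfun_measurable g : bounded_Lfun d mu s g ->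
  measurable_fun [set: X] g.
Proof. by move=> [_ /(LfunP_pow_integral mu g s0)[]]. Qed.

Lemma bounded_Lfun_cutoff (A : set X) g : measurable A ->
  bounded_Lfun d mu s g -> bounded_Lfun d mu s (cutoff A g).
Proof.
move=> mA [[c [rho [rho0 hg]]] /(LfunP_pow_integral mu g s0)[mg fg]]; split.
  by exists c, rho; split => // x /hg gx; rewrite /cutoff gx mul0r.
apply/(LfunP_pow_integral mu _ s0); split; first exact: measurable_cutoff.
rewrite pow_integral_cutoff//; apply: le_lt_trans fg; exact: pow_integral_sub.
Qed.

Lemma bounded_Lfun_comb (a b : R) g h : bounded_Lfun d mu s g ->
  bounded_Lfun d mu s h -> bounded_Lfun d mu s (fun x => a * g x + b * h x).
Proof.
move=> [[c [rho [rho0 hg]]] Lg] [[c' [rho' [rho'0 hh]]] Lh]; split.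
  have cd0 := cd_gt0 HT.
  have r0 : 0 <= cd * (d c c' + rho').
    by rewrite mulr_ge0 ?(ltW cd0)// addr_ge0 ?(qdist_ge0 HT)// ltW.
  exists c, (rho + cd * (d c c' + rho')); split; first exact: ltr_wpDr.
  move=> x hx; rewrite hg ?hh ?mulr0 ?addr0//.
    move=> hx'; apply: hx; apply: (qball_sub HT (y := c')) hx'.
    by rewrite lerDr ltW.
  by move=> hx'; apply: hx; apply: qball_le hx'; rewrite lerDl.
have -> : (fun x => a * g x + b * h x) = a *: g + b *: h :> (X -> R) by [].
have p1 : (1 <= s%:E)%E by rewrite lee_fin.
have [_ sc] := Lfun_submod_closed mu p1.
have L0 : (0 : X -> R) \in Lfun mu s%:E by case: (Lfun_submod_closed mu p1).
by have := sc b h 0 Lh L0; rewrite addr0 => Lbh; exact: sc.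
Qed.

Lemma bounded_Lfun0 : X -> bounded_Lfun d mu s (fun=> 0).
Proof.
move=> x; split; first by exists x, 1; split.
by have [] := @Lfun_submod_closed _ _ _ mu s%:E; rewrite ?lee_fin.
Qed.

Lemma bounded_Lfun_sum (x0 : X) (I : Type) (r : seq I) (a : I -> R) (g : I -> X -> R) :
  (forall i, bounded_Lfun d mu s (g i)) ->
  bounded_Lfun d mu s (fun x => \sum_(i <- r) a i * g i x).
Proof.
move=> hg; elim: r => [|i r IH].
  by under eq_fun do rewrite big_nil; exact: bounded_Lfun0.
under eq_fun do rewrite big_cons.
by have := bounded_Lfun_comb (a i) 1 (hg i) IH; under eq_fun do rewrite mul1r.
Qed.

Variable T : (X -> R) -> (X -> R).
Hypothesis linT : linear_operator d mu s T.

Lemma linear_operator_sum (x0 : X) (I : Type) (r : seq I) (a : I -> R) (g : I -> X -> R) :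
  (forall i, bounded_Lfun d mu s (g i)) ->
  {ae mu, forall x, T (fun y => \sum_(i <- r) a i * g i y) x =
                    \sum_(i <- r) a i * T (g i) x}.
Proof.
move=> hg; elim: r => [|i r IH].
  have h0 := bounded_Lfun0 x0.
  apply: filterS (linT.2 0 0 _ _ h0 h0) => x; rewrite !mul0r addr0 big_nil => e.
  by rewrite -[RHS]e; congr (T _ x); apply/funext => y; rewrite big_nil.
apply: filterS2 IH (linT.2 (a i) 1 _ _ (hg i) (bounded_Lfun_sum x0 r a hg)).
move=> x e1 e2; rewrite big_cons -e1 -[X in _ + X]mul1r -e2; congr (T _ x).
by apply/funext => y; rewrite big_cons mul1r.
Qed.

Lemma linear_operator_split (A : set X) g : measurable A ->
  bounded_Lfun d mu s g ->
  {ae mu, forall x, T g x = T (cutoff (~` A) g) x + T (cutoff A g) x}.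
Proof.
move=> mA hg.
have h1 := bounded_Lfun_cutoff (measurableC mA) hg.
have h2 := bounded_Lfun_cutoff mA hg.
apply: filterS (linT.2 1 1 _ _ h1 h2) => x; rewrite !mul1r => <-.
congr (T _ x); apply/funext => y; rewrite !mul1r /cutoff -mulrDr.
by rewrite !indicE in_setC; case: (y \in A); rewrite ?addr0 ?add0r mulr1.
Qed.

End BoundedFunctions.

(** * Dilated cubes *)

Lemma measure_big_setU_le (disp : measure_display) (X : measurableType disp)
    (R : realType) (mu : {measure set X -> \bar R}) (I : Type) (r : seq I)
    (F : I -> set X) (c : \bar R) :
  (forall i, measurable (F i)) -> (forall i, mu (F i) <= c)%E ->
  measurable (\big[setU/set0]_(i <- r) F i) /\
  (mu (\big[setU/set0]_(i <- r) F i) <= (size r)%:R%:E * c)%E.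
Proof.
move=> mF hF; elim: r => [|i r [mr hr]]; first by rewrite !big_nil measure0 mul0e.
rewrite !big_cons; split; first exact: measurableU.
rewrite /= -add1n natrD EFinD ge0_muleDl// mul1e.
by apply: le_trans (measureU2 _ (mF i) mr) _; exact: (leeD (hF i) hr).
Qed.

Section Dilates.
Context (R : realType) (disp : measure_display) (X : measurableType disp).
Variables (d : X -> X -> R) (mu : {measure set X -> \bar R}) (cd cmu : R).
Hypothesis HT : homogeneous_type d mu cd cmu.
Variables (c0 C0 delta alpha : R) (D : set (cube X)).
Hypothesis DS : dyadic_system d c0 C0 delta D.
Hypothesis alpha_ge : 3 * cd ^+ 2 / delta <= alpha.

Local Notation dil := (cube_dilate d C0 delta alpha).

Lemma dilate_factor_ge : 3 * cd <= alpha.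
Proof.
have cd0 := cd_gt0 HT; have cd1 := cd_ge1 HT.
have dl0 := dyadic_delta_gt0 DS; have dl1 := dyadic_delta_lt1 DS.
apply: le_trans alpha_ge; rewrite ler_pdivlMr//.
have : 3 * cd * delta <= 3 * cd * 1 by rewrite ler_pM2l ?mulr_gt0// ltW.
have : cd * 1 <= cd * cd by rewrite ler_pM2l.
rewrite expr2; lra.
Qed.

Lemma dilate_factor_gt0 : 0 < alpha.
Proof. by have := dilate_factor_ge; have := cd_ge1 HT; lra. Qed.

Lemma measurable_dilate Q : measurable (dil Q).
Proof. exact: measurable_qball HT _ _. Qed.

Lemma dilate_lty Q : (mu (dil Q) < +oo)%E.
Proof. exact: qball_lty HT _ _. Qed.

Lemma dilate_radius_gt0 (Q : cube X) : 0 < alpha * C0 * delta ^ cube_gen Q.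
Proof.
rewrite mulr_gt0 ?(dyadic_scale_gt0 DS)//.
by rewrite mulr_gt0 ?dilate_factor_gt0 ?(dyadic_C0_gt0 DS).
Qed.

Lemma dilate_vol_gt0 Q : 0 < vol mu (dil Q).
Proof. by apply: (vol_qball_gt0 HT); exact: dilate_radius_gt0. Qed.

Lemma sub_dilate Q : D Q -> Q `<=` dil Q.
Proof.
move=> DQ; apply: subset_trans (dyadic_outer DS DQ) _; apply: qball_le.
rewrite ler_pM2r ?(dyadic_scale_gt0 DS)// ler_peMl ?(ltW (dyadic_C0_gt0 DS))//.
by have := dilate_factor_ge; have := cd_ge1 HT; lra.
Qed.

(** The center of Q may lie near the boundary of P, which uses up cd C0 delta^k of the radius of
    alpha P, k being the generation of P. After N generations the radius of alpha Q has shrunk by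
    the factor 2 cd, and cd + alpha / 2 <= alpha suffices. *)
Lemma dilate_nested : exists2 N : nat, (0 < N)%N & forall P Q, D P -> D Q ->
  Q `<=` P -> cube_gen P + N <= cube_gen Q -> dil Q `<=` dil P.
Proof.
have cd0 := cd_gt0 HT; have cd1 := cd_ge1 HT; have C00 := dyadic_C0_gt0 DS.
have a0 := dilate_factor_gt0.
have c20 : 0 < (2 * cd)^-1 by rewrite invr_gt0 mulr_gt0.
have [N N0 hN] := expr_small (dyadic_delta DS) c20.
exists N => // P Q DP DQ QP gPQ; apply: (qball_sub HT).
have h1 : d (cube_center P) (cube_center Q) <= C0 * delta ^ cube_gen P.
  exact/ltW/(dyadic_outer DS DP)/QP/(dyadic_center_in HT DS).
have h2 : delta ^ cube_gen Q <= (2 * cd)^-1 * delta ^ cube_gen P.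
  apply: (le_trans (dyadic_scale_le DS gPQ)).
  rewrite exprzDr ?unitfE ?gt_eqF ?(dyadic_delta_gt0 DS)// mulrC.
  by rewrite ler_pM2r ?(dyadic_scale_gt0 DS)// -exprnP.
have h3 : alpha * C0 * delta ^ cube_gen Q <= alpha * C0 * ((2 * cd)^-1 * delta ^ cube_gen P).
  by rewrite ler_pM2l// mulr_gt0.
apply: (@le_trans _ _ (cd * (C0 * delta ^ cube_gen P + alpha * C0 * ((2 * cd)^-1 * delta ^
  cube_gen P)))).
  by rewrite ler_pM2l// lerD.
rewrite (_ : _ * (_ + _) = (cd + alpha / 2) * (C0 * delta ^ cube_gen P)); last first.
  by field; rewrite gt_eqF.
rewrite -[leRHS]mulrA ler_pM2r ?mulr_gt0 ?(dyadic_scale_gt0 DS)//.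
by have := dilate_factor_ge; lra.
Qed.

Lemma dyadic_comparable (N : nat) : exists2 C, 1 <= C & forall P Q, D P -> D Q ->
  Q `<=` P -> cube_gen Q <= cube_gen P + N -> vol mu P <= C * vol mu Q.
Proof.
have cd0 := cd_gt0 HT; have C00 := dyadic_C0_gt0 DS; have dl0 := dyadic_delta_gt0 DS.
have [C C1 hC] := dyadic_vol_dilate HT DS (2 * cd * C0 / delta ^+ N).
exists C => // P Q DP DQ QP gQP; apply: le_trans (hC Q DQ); apply: vol_le.
- exact: dyadic_measurable DS _ DP.
- exact: measurable_qball HT _ _.
- apply: (dyadic_sub_qball HT DS DP); first exact/QP/(dyadic_center_in HT DS).
  rewrite -[leRHS]mulrA ler_pM2l ?mulr_gt0// mulrC ler_pdivlMr ?exprn_gt0//.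
  rewrite exprnP -exprzDr ?unitfE ?gt_eqF//; exact: (dyadic_scale_le DS).
- exact: qball_lty HT _ _.
Qed.

(* Passing to the adjacent systems, where the maximal cubes are disjoint,
   replaces a Vitali covering argument for the dilated cubes. *)
Lemma large_average_measure : exists2 K, 1 <= K &
  forall (s M' : R) (g : X -> R) (P : cube X), 0 < M' -> D P ->
  measurable_fun [set: X] g ->
  (mu (\bigcup_(Q in [set Q | [/\ D Q, (cube_gen P <= cube_gen Q)%R &
      (M' * vol mu (dil Q))%:E < pow_integral mu s (dil Q) g]]) (Q : set X))
   <= (K / M')%:E * pow_integral mu s [set: X] g)%E.
Proof.
have a0 := ltW dilate_factor_gt0.
have [c1 [C1 [de1 [N [m [D' [C [N0 C_ge1 DS' adj]]]]]]]] := adjacent_systems HT DS a0.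
have C_gt0 : 0 < C by exact: lt_le_trans C_ge1.
exists (m.+1%:R * C); first by rewrite mulr_ege1// ler1n.
move=> s M' g P M'0 DP mg; set F := [set Q | _].
pose F' j : set (cube X) := [set Q' | D' j Q' /\ exists2 Q, F Q &
  [/\ cube_gen Q' = (cube_gen Q %/ N)%Z - 1, dil Q `<=` Q' &
      vol mu Q' <= C * vol mu (qball d (cube_center Q) (c0 * delta ^ cube_gen Q))]].
(* Maximal cubes exist because the generations in [F' j] are bounded below in terms of the
   generation of P. *)
pose G j := maximal_cubes (F' j).
have F'D j : F' j `<=` D' j by move=> Q [].
have F'k j Q' : F' j Q' -> (cube_gen P %/ N)%Z - 1 <= cube_gen Q'.
  by move=> [_ [Q [_ gQ _] [-> _ _]]]; rewrite lerD2r; apply: lez_pdiv2r.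
have GD j : G j `<=` D' j by move=> Q [/F'D].
have cG j : countable (G j).
  by apply: sub_countable (dyadic_countable HT (DS' j)); exact: subset_card_le.
have mG j Q : G j Q -> measurable (Q : set X).
  by move=> /GD; exact: (dyadic_measurable (DS' j)).
have mUG j : measurable (\bigcup_(Q in G j) (Q : set X)).
  exact: (countable_bigcup_measurable (cG j) (@mG j)).
have hG j : (mu (\bigcup_(Q in G j) (Q : set X)) <=
    (C / M')%:E * pow_integral mu s [set: X] g)%E.
  apply: (@le_trans _ _ ((C / M')%:E * pow_integral mu s (\bigcup_(Q in G j) (Q : set X))
    g)%E); last first.
    by rewrite lee_wpmul2l ?lee_fin ?divr_ge0 ?(ltW M'0) ?(ltW C_gt0)// pow_integral_sub.
  apply: disjoint_cover_measure => //.
  - by rewrite divr_ge0 ?(ltW M'0) ?(ltW C_gt0).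
  - exact: measurable_norm_powR.
  - exact: (@mG j).
  - by move=> A B x; exact: (maximal_cubes_disjoint (DS' j) (@F'D j)).
  (* Q' contains alpha Q, over which the integral exceeds M' mu(alpha Q), and mu(Q') <= C mu(alpha
     Q); hence mu(Q') is at most C / M' times the integral over Q'. *)
  - move=> Q' GQ'; have [[D'Q' [Q [DQ gQ hQ] [_ dQ vQ]]] _] := GQ'.
    rewrite (volE (dyadic_lty HT (DS' j) D'Q')).
    apply: (@le_trans _ _ ((C / M')%:E * pow_integral mu s (dil Q) g)%E); last first.
      rewrite lee_wpmul2l ?lee_fin ?divr_ge0 ?(ltW M'0) ?(ltW C_gt0)//.
      by apply: pow_integral_sub => //; [exact: measurable_dilate|exact: mG GQ'].
    apply: (@le_trans _ _ ((C / M')%:E * (M' * vol mu (dil Q))%:E)%E); last first.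
      by rewrite lee_wpmul2l ?lee_fin ?divr_ge0 ?(ltW M'0) ?(ltW C_gt0)// ltW.
    rewrite -EFinM lee_fin mulrA divfK ?gt_eqF//; apply: (le_trans vQ).
    rewrite ler_pM2l//; apply: vol_le;
      [exact: measurable_qball HT _ _|exact: measurable_dilate| |exact: dilate_lty].
    exact: subset_trans (dyadic_inner DS DQ) (sub_dilate DQ).
have [mU hU] := measure_big_setU_le (index_iota 0 m.+1) mUG hG.
apply: (@le_trans _ _ (mu (\big[setU/set0]_(j <- index_iota 0 m.+1) \bigcup_(Q in G j) (Q :
  set X)))).
  apply: le_measure; rewrite ?inE//.
    apply: countable_bigcup_measurable; last by move=> Q [DQ _ _];
      exact: dyadic_measurable DS _ DQ.
    by apply: sub_countable (dyadic_countable HT DS); apply: subset_card_le => Q [].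
  move=> x [Q FQ Qx]; have [DQ _ _] := FQ.
  have [j [Q' [jm D'Q' gQ' dQ vQ]]] := adj Q DQ.
  have F'Q' : F' j Q' by split => //; exists Q.
  have [Q'' GQ'' Q'Q''] := sub_maximal_cube (DS' j) (@F'D j) (@F'k j) F'Q'.
  rewrite -bigcup_seq; exists j; first by rewrite /= mem_index_iota ltnS.
  by exists Q'' => //; apply: Q'Q''; apply: dQ; exact: sub_dilate.
apply: (le_trans hU).
set I := pow_integral mu s [set: X] g.
rewrite size_iota subn0 muleA -EFinM.
by rewrite (_ : m.+1%:R * (C / M') = m.+1%:R * C / M')//; ring.
Qed.

End Dilates.

(** * The stopping-time step for scalar functions *)

Section ScalarStep.
Context (R : realType) (disp : measure_display) (X : measurableType disp).
Variables (d : X -> X -> R) (mu : {sigma_finite_measure set X -> \bar R}).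
Variables (cd cmu : R).
Hypothesis HT : homogeneous_type d mu cd cmu.
Variables (c0 C0 delta alpha : R) (D : set (cube X)).
Hypothesis DS : dyadic_system d c0 C0 delta D.
Hypothesis alpha_ge : 3 * cd ^+ 2 / delta <= alpha.

Local Notation dil := (cube_dilate d C0 delta alpha).

Let measurable_dil Q : measurable (dil Q). Proof. exact: (measurable_dilate HT). Qed.
Let dil_lty Q : (mu (dil Q) < +oo)%E. Proof. exact: (dilate_lty HT). Qed.
Let dil_gt0 Q : 0 < vol mu (dil Q). Proof. exact: (dilate_vol_gt0 HT DS alpha_ge). Qed.

Section FixedOperator.
Variables (s q r : R) (psi phi : R -> R) (T : (X -> R) -> (X -> R)).
Hypotheses (q1 : 1 <= q) (r1 : 1 <= r) (qs : q <= s) (rs : r <= s).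
Hypothesis linT : linear_operator d mu s T.
Hypothesis boundT : operator_bound d mu s q T psi.
Hypothesis sharpT : sharp_maximal_bound d mu s r alpha T phi.
Variables (lam L M : R).
Hypotheses (lam01 : 0 < lam < 1) (L0 : 0 < L) (M0 : 0 < M).
Hypotheses (psi0 : 0 <= psi lam) (phi0 : 0 <= phi lam).

Let s1 : 1 <= s. Proof. exact: le_trans qs. Qed.
Let lam0 : 0 < lam. Proof. by case/andP: lam01. Qed.

Lemma cutoff_id (A : set X) (g : X -> R) : (forall x, ~ A x -> g x = 0) ->
  cutoff A g = g.
Proof.
move=> h; apply/funext => x; rewrite /cutoff indicE.
have [xA|] := boolP (x \in A); first by rewrite mulr1.
by rewrite notin_setE => /h ->; rewrite mul0r.
Qed.

Definition large_image (Q : cube X) (g : X -> R) (M' : R) : set X :=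
  dil Q `&` [set x | psi lam * (1 + M') < `|T (cutoff (dil Q) g) x|].

Lemma large_image_measure Q g M' : bounded_Lfun d mu s g -> 0 <= M' ->
  (pow_integral mu s (dil Q) g <= (M' * vol mu (dil Q))%:E)%E ->
  measurable (large_image Q g M') /\
  (mu (large_image Q g M') <= (lam * vol mu (dil Q))%:E)%E.
Proof.
move=> hg M'0 hM.
have mg := bounded_Lfun_measurable s1 hg.
have mT := linT.1 _ (bounded_Lfun_cutoff s1 (measurable_dil Q) hg).
have mTn : measurable_fun [set: X] (fun x => `|T (cutoff (dil Q) g) x|).
  exact: (measurableT_comp (@normr_measurable _ _) mT).
have mlarge (t : \bar R) : measurable (dil Q `&` [set x | (t < `|T (cutoff (dil Q) g)
  x|%:E)%E]).
  apply: measurableI => //.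
  rewrite -[X in measurable X]setTI; apply: emeasurable_fun_o_infty => //.
  exact/measurable_EFinP.
have mE : measurable (large_image Q g M').
  by have := mlarge (psi lam * (1 + M'))%:E; under eq_set do rewrite lte_fin.
split => //.
have rho0 := dilate_radius_gt0 HT DS alpha_ge Q.
have := @boundT (cube_center Q) _ g lam rho0 hg lam01; rewrite /= -/(dil Q) => hb.
rewrite -mule_volE ?dil_lty//; apply: le_trans hb; apply: le_measure; rewrite ?inE//.
apply: setIS => x /=; rewrite -lte_fin; apply: le_lt_trans.
rewrite EFinM lee_wpmul2l ?lee_fin//.
exact: (avg_norm_le q1 qs (measurable_dil Q) (dil_lty Q) (dil_gt0 Q) mg M'0 hM).
Qed.

(** E is the union of the set where T g is large (measure at most lam mu(alpha P)), a measurable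
    hull of the set where the sharp maximal function is large (2 lam mu(alpha P)), and the cubes
    below P over whose dilates the average of |g|^s exceeds L M (K / L times mu(alpha P)). Since g
    vanishes off alpha P, the truncations in the two hypotheses on T disappear. *)
Lemma bad_set K (P : cube X) (g : X -> R) : 1 <= K -> D P ->
  (forall s M' g P, 0 < M' -> D P -> measurable_fun [set: X] g ->
    (mu (\bigcup_(Q in [set Q | [/\ D Q, (cube_gen P <= cube_gen Q)%R &
      (M' * vol mu (dil Q))%:E < pow_integral mu s (dil Q) g]]) (Q : set X))
     <= (K / M')%:E * pow_integral mu s [set: X] g)%E) ->
  bounded_Lfun d mu s g -> (forall x, ~ dil P x -> g x = 0) ->
  (pow_integral mu s [set: X] g <= (M * vol mu (dil P))%:E)%E ->
  exists E, [/\ measurable E,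
    (mu E <= ((3 * lam + K / L) * vol mu (dil P))%:E)%E,
    forall x, (P : set X) x -> ~ E x -> `|T g x| <= psi lam * (1 + M),
    forall x, (P : set X) x -> ~ E x -> forall c rho, 0 < rho -> qball d c rho x ->
      (ess_osc mu (qball d c rho) (T (cutoff (~` qball d c (alpha * rho)) g))
        <= (phi lam * (1 + M))%:E)%E &
    forall x Q, (P : set X) x -> ~ E x -> D Q -> cube_gen P <= cube_gen Q ->
      (Q : set X) x ->
      (pow_integral mu s (dil Q) g <= (L * M * vol mu (dil Q))%:E)%E].
Proof.
move=> K1 DP hK hg sg hM.
have mg := bounded_Lfun_measurable s1 hg.
have hMP : (pow_integral mu s (dil P) g <= (M * vol mu (dil P))%:E)%E.
  by apply: le_trans hM; exact: pow_integral_sub.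
have [mE1 hE1] := large_image_measure hg (ltW M0) hMP.
have rho0 := dilate_radius_gt0 HT DS alpha_ge P.
have hs := @sharpT (cube_center P) _ g lam rho0 hg lam01; rewrite /= -/(dil P) in hs.
have [|E2 [mE2 sE2] hE2] := mu_ext_hull hs (c' := (2 * lam * vol mu (dil P))%:E).
  rewrite mule_volE ?dil_lty// lte_fin ltr_pM2r ?dil_gt0// mulr2n mulrDl mul1r.
  by rewrite ltrDl.
have LM0 : 0 < L * M by rewrite mulr_gt0.
set F3 := [set Q | [/\ D Q, (cube_gen P <= cube_gen Q)%R &
      ((L * M * vol mu (dil Q))%:E < pow_integral mu s (dil Q) g)%E]].
have hE3 := hK s (L * M) g P LM0 DP mg; rewrite -/F3 in hE3.
set E3 := \bigcup_(Q in F3) (Q : set X) in hE3.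
have mE3 : measurable E3.
  apply: countable_bigcup_measurable; last by move=> Q [DQ _ _];
    exact: dyadic_measurable DS _ DQ.
  by apply: sub_countable (dyadic_countable HT DS); apply: subset_card_le => Q [].
exists (large_image P g M `|` E2 `|` E3); split.
- by apply: measurableU => //; exact: measurableU.
- apply: (le_trans (measureU2 _ (measurableU _ _ mE1 mE2) mE3)).
  have -> : (3 * lam + K / L) * vol mu (dil P) =
    lam * vol mu (dil P) + 2 * lam * vol mu (dil P) + K / L * vol mu (dil P) by ring.
  rewrite !EFinD; apply: leeD.
    by apply: (le_trans (measureU2 _ mE1 mE2)); exact: leeD.
  apply: (le_trans hE3); apply: (@le_trans _ _ ((K / (L * M))%:E * (M * vol mu (dil P))%:E)%E).
    rewrite lee_wpmul2l// lee_fin divr_ge0 ?(ltW LM0)//; exact: le_trans K1.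
  rewrite -EFinM lee_fin le_eqVlt; apply/orP; left; apply/eqP; field.
  by rewrite !gt_eqF.
- move=> x Px /not_orP[/not_orP[nE _] _]; rewrite leNgt; apply/negP => h; apply: nE.
  split; first exact: (sub_dilate HT DS alpha_ge DP).
  by rewrite /= cutoff_id.
- move=> x Px /not_orP[/not_orP[_ nE] _] c rho rho0' cx.
  have : ~ ((phi lam)%:E * avg_norm mu r%:E (dil P) (EFin \o g) < sharp_maximal d mu T
    alpha (cutoff (dil P) g) x)%E.
    move=> h; apply: nE; apply: sE2; split => //.
    exact: (sub_dilate HT DS alpha_ge DP).
  move=> /negP; rewrite -leNgt cutoff_id// => h.
  apply: (@le_trans _ _ (sharp_maximal d mu T alpha g x)).
    by apply: ereal_sup_ubound; exists c, rho.
  apply: (le_trans h); rewrite EFinM lee_wpmul2l ?lee_fin//.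
  exact: (avg_norm_le r1 rs (measurable_dil P) (dil_lty P) (dil_gt0 P) mg (ltW M0) hMP).
- move=> x Q Px /not_orP[_ nE] DQ gQ Qx; rewrite leNgt; apply/negP => h.
  by apply: nE; exists Q.
Qed.

(** E fills at most 1/2 of Q and the set where T (g 1_(alpha Q)) is large at most 1/4, so good
    points z form a set of positive measure. At such z the function h = T (g 1_(X \ alpha Q)) is at
    most psi(lam) ((1 + M) + (1 + L M)), and its oscillation adds phi(lam) (1 + M). *)
Lemma local_oscillation (Q : cube X) (E : set X) (g : X -> R) : D Q ->
  bounded_Lfun d mu s g -> measurable E ->
  vol mu (Q `&` E) <= 2^-1 * vol mu Q ->
  lam * vol mu (dil Q) <= 4^-1 * vol mu Q ->
  (forall x, (Q : set X) x -> ~ E x -> `|T g x| <= psi lam * (1 + M)) ->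
  (forall x, (Q : set X) x -> ~ E x -> forall c rho, 0 < rho -> qball d c rho x ->
      (ess_osc mu (qball d c rho) (T (cutoff (~` qball d c (alpha * rho)) g))
        <= (phi lam * (1 + M))%:E)%E) ->
  (forall x, (Q : set X) x -> ~ E x ->
      (pow_integral mu s (dil Q) g <= (L * M * vol mu (dil Q))%:E)%E) ->
  {ae mu, forall y, (Q : set X) y -> `|T g y - T (cutoff (dil Q) g) y| <=
    phi lam * (1 + M) + psi lam * (2 + M + L * M)}.
Proof.
move=> DQ hg mE hE hlam ha hb hc.
have mQ := dyadic_measurable DS DQ; have fQ := dyadic_lty HT DS DQ.
have V0 := dyadic_vol_gt0 HT DS DQ.
have fsub (A : set X) : measurable A -> A `<=` Q -> (mu A < +oo)%E.
  by move=> mA AQ; exact: finite_sub mA mQ AQ fQ.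
have [x Qx nEx] : exists2 x, (Q : set X) x & ~ E x.
  apply: contrapT => nx; have QE : (Q : set X) `&` E = Q.
    apply: setIidl => x Qx; apply: contrapT => nEx; apply: nx; by exists x.
  by move: hE V0; rewrite QE; move: (vol mu Q) => v; lra.
have LM0 : 0 <= L * M by rewrite mulr_ge0// ltW.
have [mB2 hB2] := large_image_measure hg LM0 (hc _ Qx nEx).
set B2 := large_image _ _ _ in mB2 hB2.
(* The outer ball of Q: it contains x, and its dilate by alpha is exactly alpha Q, so the bound at
   the point x applies to the oscillation of h over B. *)
pose B := qball d (cube_center Q) (C0 * delta ^ cube_gen Q).
have QB : Q `<=` B by exact: dyadic_outer DS _ DQ.
set h := T (cutoff (~` dil Q) g).
have osc : {ae (mu \x mu)%E, forall p : X * X,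
    `|h p.1 - h p.2| * \1_(B `*` B) p <= phi lam * (1 + M)}.
  have rB : 0 < C0 * delta ^ cube_gen Q.
    by rewrite mulr_gt0 ?(dyadic_C0_gt0 DS) ?(dyadic_scale_gt0 DS).
  have := hb x Qx nEx _ _ rB (QB _ Qx); rewrite mulrA -/(dil Q) -/h.
  by move=> /ess_supP; apply: filterS => p; rewrite lee_fin.
have spl := linear_operator_split s1 linT (measurable_dil Q) hg.
set N := Q `&` (E `|` B2).
have mEB : measurable (E `|` B2) by exact: measurableU.
have hN : vol mu N <= 3 / 4 * vol mu Q.
  have fB2 : (mu B2 < +oo)%E.
    apply: finite_sub (dil_lty Q) => //; exact: subIsetl.
  have : (mu N <= mu (Q `&` E) + mu B2)%E.
    rewrite /N setIUr; apply: le_trans (measureU2 _ _ _) _;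
      [exact: measurableI|exact: measurableI|].
    rewrite leeD2l//; apply: le_measure; rewrite ?inE//; first exact: measurableI.
  have fN : (mu N < +oo)%E by apply: fsub; [exact: measurableI|exact: subIsetl].
  have fQE : (mu (Q `&` E) < +oo)%E by apply: fsub; [exact: measurableI|exact: subIsetl].
  rewrite (volE fN) (volE fQE) (volE fB2) -EFinD lee_fin => h1.
  move: hB2; rewrite (volE fB2) lee_fin => h2.
  by apply: (le_trans h1); lra.
have G0 : 0 < vol mu (Q `\` (E `|` B2)).
  have := vol_setDI mQ mEB fQ; rewrite -/N => h1.
  by move: h1 hN V0; move: (vol mu (Q `\` _)) (vol mu Q) (vol mu N) => a b c; lra.
(* The good points have positive measure, so z can be chosen outside any null set, in particular one
   that depends on y. *)
have nul (A : set X) : mu.-negligible A -> exists2 z, (Q `\` (E `|` B2)) z & ~ A z.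
  move=> [A' [mA' A'0 AA']]; apply: contrapT => nz.
  have sub : Q `\` (E `|` B2) `<=` A'.
    by move=> z Gz; apply: AA'; apply: contrapT => nA; apply: nz; exists z.
  have : mu (Q `\` (E `|` B2)) = 0%E.
    by apply: subset_measure0 sub A'0 => //; exact: measurableD.
  by move: G0; rewrite /vol => /[swap] ->; rewrite ltxx.
have spl2 := spl.
apply: filterS2 (ae_prod_section osc) spl2 => y oscy sply Qy.
have [z [Qz nEB] /contrapT[oscz splz]] := nul _ (filterI oscy spl).
have [nEz nBz] : ~ E z /\ ~ B2 z by exact/not_orP.
have hz : `|h z| <= psi lam * (1 + M) + psi lam * (1 + L * M).
  have -> : h z = T g z - T (cutoff (dil Q) g) z by rewrite splz addrK.
  apply: (le_trans (ler_normB _ _)); apply: lerD; first exact: ha.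
  rewrite leNgt; apply/negP => hh; apply: nBz; split => //.
  exact: (sub_dilate HT DS alpha_ge DQ).
have -> : T g y - T (cutoff (dil Q) g) y = h y by rewrite sply addrK.
have {oscz} : `|h y - h z| <= phi lam * (1 + M).
  by move: oscz; rewrite /= indicE mem_set ?mulr1//; split; exact: QB.
move=> hyz; have := ler_normD (h y - h z) (h z); rewrite subrK => h3.
by apply: (le_trans h3); lra.
Qed.

End FixedOperator.

(** One exceptional set E is formed for all the g_i, so that the stopping cubes do not depend on i.
    The constants lam and L are fixed before s, the operator and the functions. *)
Lemma scalar_step (n : nat) : exists lam L : R, [/\ 0 < lam < 1, 0 < L &
  forall (s q r : R) (psi phi : R -> R) (T : (X -> R) -> (X -> R)) (M : R)
    (P : cube X) (k : nat) (g : 'I_k -> X -> R),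
  1 <= q -> 1 <= r -> q <= s -> r <= s -> linear_operator d mu s T ->
  operator_bound d mu s q T psi -> sharp_maximal_bound d mu s r alpha T phi ->
  0 <= psi lam -> 0 <= phi lam -> 0 < M -> (k <= n)%N -> D P ->
  (forall i, bounded_Lfun d mu s (g i)) ->
  (forall i x, ~ dil P x -> g i x = 0) ->
  (forall i, pow_integral mu s [set: X] (g i) <= (M * vol mu (dil P))%:E)%E ->
  exists Ch : set (cube X),
  [/\ forall Q, Ch Q ->
        [/\ D Q, cube_gen P < cube_gen Q, Q `<=` P & dil Q `<=` dil P],
      forall Q Q' x, Ch Q -> Ch Q' -> (Q : set X) x -> (Q' : set X) x -> Q = Q',
      (mu (\bigcup_(Q in Ch) Q) <= 2^-1%:E * mu P)%E &
      forall i, {ae mu, forall x, (P : set X) x ->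
        (~ (\bigcup_(Q in Ch) (Q : set X)) x ->
          `|T (g i) x| <= phi lam * (1 + M) + psi lam * (2 + M + L * M)) /\
        (forall Q, Ch Q -> (Q : set X) x ->
          `|T (g i) x - T (cutoff (dil Q) (g i)) x| <=
            phi lam * (1 + M) + psi lam * (2 + M + L * M))}]].
Proof.
have [Ca Ca1 hCa] := dyadic_vol_dilate HT DS (alpha * C0).
have [N0 N00 hN0] := dilate_nested HT DS alpha_ge.
have [Cp Cp1 hCp] := dyadic_comparable HT DS 1.
have [Cn Cn1 hCn] := dyadic_comparable HT DS N0.
have [K K1 hK] := large_average_measure HT DS alpha_ge.
have Ca0 : 0 < Ca by exact: lt_le_trans Ca1.
have Cp0 : 0 < Cp by exact: lt_le_trans Cp1.
have Cn0 : 0 < Cn by exact: lt_le_trans Cn1.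
have K0 : 0 < K by exact: lt_le_trans K1.
(* With Cp comparing a cube to its parent, a parent of density at most theta forces density at most
   1/2 in the cube. The bound kappa <= theta / 2 makes the stopping cubes fill at most half of P,
   and kappa <= 1 / (2 Cn) handles cubes in the first admissible generation. Finally eta is such
   that at most n sets of measure 4 eta Ca mu(P) have total measure at most kappa mu(P). *)
pose theta := (2 * Cp)^-1.
have th0 : 0 < theta by rewrite invr_gt0 mulr_gt0.
have th1 : theta < 1 by rewrite invf_lt1 ?mulr_gt0//; lra.
pose kappa := Num.min (theta / 2) (2 * Cn)^-1.
have ka0 : 0 < kappa by rewrite lt_min divr_gt0// invr_gt0 mulr_gt0.
have ka1 : kappa <= theta / 2 by rewrite ge_min lexx.
have ka2 : kappa <= (2 * Cn)^-1 by rewrite ge_min lexx orbT.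
have n0 : 0 < n.+1%:R :> R by rewrite ltr0n.
have n1 : 1 <= n.+1%:R :> R by rewrite ler1n.
have [eta eta0 etaE] : exists2 eta, 0 < eta & eta * (4 * n.+1%:R * Ca) = kappa.
  exists (kappa / (4 * n.+1%:R * Ca)); first by rewrite divr_gt0// !mulr_gt0.
  by rewrite divfK// gt_eqF// !mulr_gt0.
have nCa1 : 1 <= n.+1%:R * Ca by rewrite mulr_ege1.
have etaCa : eta * Ca <= 4^-1.
  have : eta * Ca * 1 <= eta * Ca * n.+1%:R by rewrite ler_pM2l// mulr_gt0.
  lra.
have eta1 : eta < 1.
  have : eta * 1 <= eta * Ca by rewrite ler_pM2l.
  lra.
(* This L makes K / L equal to eta, so each exceptional set has measure at most 4 eta mu(alpha
   P). *)
exists eta, (K / eta); split; [by rewrite eta0 eta1|by rewrite divr_gt0|].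
move=> s q r psi phi T M P k g q1 r1 qs rs linT boundT sharpT psi0 phi0 M0 kn DP hg sg hM.
have et01 : 0 < eta < 1 by rewrite eta0.
have L0 : 0 < K / eta by rewrite divr_gt0.
have bad i := bad_set q1 r1 qs rs linT boundT sharpT et01 L0 M0 psi0 phi0 K1 DP hK (hg i)
  (sg i) (hM i).
have [E0 hE0] := choice bad.
have mE0 i : measurable (E0 i) by case: (hE0 i).
have vP : vol mu (dil P) <= Ca * vol mu P by exact: hCa.
have VP0 := dyadic_vol_gt0 HT DS DP.
have muE0 i : (mu (E0 i) <= (4 * eta * Ca * vol mu P)%:E)%E.
  have [_ /le_trans h _ _ _] := hE0 i; apply: h; rewrite lee_fin.
  have -> : 3 * eta + K / (K / eta) = 4 * eta by field; rewrite !gt_eqF.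
  by rewrite -[leRHS]mulrA ler_pM2l// mulr_gt0.
have [mE hE] := measure_big_setU_le (enum 'I_k) mE0 muE0.
set E := \big[setU/set0]_(i <- enum 'I_k) E0 i in mE hE.
have nE x : ~ E x -> forall i, ~ E0 i x.
  move=> nEx i Ei; apply: nEx; rewrite /E -bigcup_seq; exists i => //=.
  by rewrite mem_enum.
have {}hE : (mu E <= (kappa * vol mu P)%:E)%E.
  apply: (le_trans hE); rewrite size_enum_ord -EFinM lee_fin -etaE !mulrA ler_pM2r//.
  have : k%:R * (eta * Ca) <= n.+1%:R * (eta * Ca).
    by rewrite ler_wpM2r ?mulr_ge0 ?(ltW eta0) ?(ltW Ca0)// ler_nat ltnW.
  lra.
have fE : (mu E < +oo)%E by apply: le_lt_trans hE _; rewrite ltry.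
have vE : vol mu E <= kappa * vol mu P by move: hE; rewrite volE.
pose F := [set Q | [/\ D Q, cube_gen P + N0 <= cube_gen Q, Q `<=` P &
  theta * vol mu Q < vol mu (Q `&` E)]].
have FD : F `<=` D by move=> Q [].
have Fk Q : F Q -> cube_gen P + N0 <= cube_gen Q by case.
pose Ch := maximal_cubes F.
have ChF Q : Ch Q -> F Q by case.
(* Either Q is in the first admissible generation, where all of E is small compared with Q, or its
   parent was admissible and, by maximality of Q, failed the density test. *)
have half Q : Ch Q -> vol mu (Q `&` E) <= 2^-1 * vol mu Q.
  move=> [[DQ gQ QP _] maxQ]; have mQ := dyadic_measurable DS DQ.
  have [gE|gN] := eqVneq (cube_gen Q) (cube_gen P + N0).
    apply: (@le_trans _ _ (vol mu E)).
      by apply: vol_le => //; exact: measurableI.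
    apply: (le_trans vE); have : vol mu P <= Cn * vol mu Q by apply: hCn => //; rewrite gE.
    rewrite -(ler_pM2l ka0) => /le_trans; apply.
    have VQ0 := dyadic_vol_gt0 HT DS DQ.
    rewrite mulrA ler_pM2r//; have : kappa * Cn <= (2 * Cn)^-1 * Cn by rewrite ler_pM2r.
    by rewrite invfM divfK ?gt_eqF.
  have [Q1 [DQ1 gQ1 Q1c]] := dyadic_cover DS (cube_gen Q - 1) (cube_center Q).
  have cQ := dyadic_center_in HT DS DQ.
  have gle : cube_gen P + N0 <= cube_gen Q1.
    rewrite gQ1; move: gN gQ; move: (cube_gen Q) (cube_gen P) => a b; clear; lia.
  have QQ1 : Q `<=` Q1.
    by apply: (dyadic_sub DS DQ DQ1 _ cQ Q1c); rewrite gQ1 gerBl.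
  have Q1P : Q1 `<=` P.
    by apply: (dyadic_sub DS DQ1 DP _ Q1c (QP _ cQ)); apply: le_trans gle; rewrite lerDl.
  have nF : ~ F Q1.
    move=> FQ1; have := maxQ _ _ FQ1 Q1c cQ; rewrite gQ1.
    by rewrite lerBrDr gerDl.
  have h1 : vol mu (Q1 `&` E) <= theta * vol mu Q1.
    by rewrite leNgt; apply/negP => h; apply: nF.
  have h2 : vol mu Q1 <= Cp * vol mu Q.
    by apply: hCp => //; rewrite gQ1 subrK.
  have mQ1 := dyadic_measurable DS DQ1.
  apply: (@le_trans _ _ (vol mu (Q1 `&` E))).
    apply: vol_le; [exact: measurableI|exact: measurableI|exact: setSI|].
    exact: (@finite_sub _ _ _ mu _ _ (measurableI _ _ mQ1 mE) mE (@subIsetr _ _ _) fE).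
  apply: (le_trans h1); move: h2; rewrite -(ler_pM2l th0) => /le_trans; apply.
  by rewrite mulrA /theta invfM divfK ?gt_eqF.
have ChP Q : Ch Q -> [/\ D Q, cube_gen P < cube_gen Q, Q `<=` P & dil Q `<=` dil P].
  move=> /ChF[DQ gQ QP _]; split => //; last exact: hN0.
  by apply: lt_le_trans gQ; rewrite ltrDl ltz_nat.
have ChD : Ch `<=` D by move=> Q /ChP[].
have cCh : countable Ch.
  by apply: sub_countable (dyadic_countable HT DS); exact: subset_card_le.
have mCh Q : Ch Q -> measurable (Q : set X).
  by move=> /ChD DQ; exact: dyadic_measurable DS _ DQ.
have mU : measurable (\bigcup_(Q in Ch) (Q : set X)).
  exact: (countable_bigcup_measurable cCh mCh).
have disjCh Q Q' x : Ch Q -> Ch Q' -> (Q : set X) x -> (Q' : set X) x -> Q = Q'.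
  exact: (maximal_cubes_disjoint DS FD).
exists Ch; split => //.
  (* The stopping cubes are disjoint with density above theta, so their union has measure at most
     mu(E) / theta <= (kappa / theta) mu(P). *)
  have thV : 0 <= theta^-1 by rewrite invr_ge0 ltW.
  have := @disjoint_cover_measure _ _ _ mu (fun x => (\1_E x)%:E) theta^-1 Ch thV.
  move=> /(_ _ _ cCh mCh disjCh) h.
  have {h} : (mu (\bigcup_(Q in Ch) (Q : set X)) <= theta^-1%:E * mu (E `&` \bigcup_(Q in
    Ch) (Q : set X)))%E.
    rewrite -integral_indic//; apply: h => //.
      by apply/measurable_EFinP; exact: measurable_indic.
    move=> Q ChQ; have mQ := mCh Q ChQ; have [DQ _ _ hQ] := ChF Q ChQ.
    have fQ := dyadic_lty HT DS DQ.
    rewrite integral_indic// setIC (volE fQ) mule_volE; last first.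
      exact: (@finite_sub _ _ _ mu _ _ (measurableI _ _ mQ mE) mQ (@subIsetl _ _ _) fQ).
    by rewrite lee_fin ler_pdivlMl// ltW.
  move=> /le_trans; apply.
  apply: (@le_trans _ _ (theta^-1%:E * (kappa * vol mu P)%:E)%E).
    rewrite lee_wpmul2l ?lee_fin//; apply: le_trans hE; apply: le_measure; rewrite ?inE//.
    exact: measurableI.
  rewrite -EFinM (mule_volE _ (dyadic_lty HT DS DP)) lee_fin mulrA ler_pM2r// ler_pdivrMl//.
move=> i.
have [_ _ hE1 hE2 hE3] := hE0 i.
have osc : {ae mu, forall x, forall Q, Ch Q -> (Q : set X) x ->
    `|T (g i) x - T (cutoff (dil Q) (g i)) x| <=
    phi eta * (1 + M) + psi eta * (2 + M + K / eta * M)}.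
  apply: ae_forall_countable => // Q ChQ; have [DQ gPQ QP _] := ChP Q ChQ.
  apply: (local_oscillation q1 qs linT boundT et01 L0 M0 psi0 DQ (hg i) mE (half Q ChQ)).
  - have VQ0 := dyadic_vol_gt0 HT DS DQ.
    apply: (@le_trans _ _ (eta * (Ca * vol mu Q))); first by rewrite ler_pM2l//; exact: hCa.
    by rewrite mulrA ler_pM2r.
  - by move=> x Qx /nE/(_ i); apply: hE1; exact: QP.
  - by move=> x Qx /nE/(_ i); apply: hE2; exact: QP.
  - by move=> x Qx /nE/(_ i) nEx; apply: (hE3 x) => //; [exact: QP|exact: ltW].
(* A density point of E in P that belongs to E lies in a small cube that passes the density test,
   hence in a stopping cube. So a.e. point of P outside the stopping cubes is outside E. *)
apply: filterS2 osc (dyadic_density HT DS mE th1) => x oscx densx Px; split; last exact: oscx.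
move=> nU; apply: (@le_trans _ _ (psi eta * (1 + M))).
  apply: hE1 => //; apply: nE => Ex; apply: nU.
  have [k0 hk0] := densx Ex.
  have [Q [DQ gQ Qx]] := dyadic_cover DS (Num.max k0 (cube_gen P + N0)) x.
  have FQ : F Q.
    split => //.
    - by rewrite gQ le_max lexx orbT.
    - apply: (dyadic_sub DS DQ DP _ Qx Px); rewrite gQ le_max; apply/orP; right.
      by rewrite lerDl.
    - by apply: hk0 => //; rewrite gQ le_max lexx.
  have [Q' ChQ' QQ'] := sub_maximal_cube DS FD Fk FQ.
  by exists Q' => //; exact: QQ'.
have h1 : 0 <= phi eta * (1 + M) by rewrite mulr_ge0// addr_ge0// ltW.
have h2 : 0 <= psi eta * (1 + K / eta * M).
  by rewrite mulr_ge0// addr_ge0// mulr_ge0// ltW.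
lra.
Qed.

End ScalarStep.

(** * Duality for the convex bodies *)

Section Duality.
Context (R : realType) (disp : measure_display) (X : measurableType disp).
Variable mu : {measure set X -> \bar R}.
Variables (s : R) (B : set X).
Hypotheses (s1 : 1 <= s) (mB : measurable B) (fB : (mu B < +oo)%E)
  (B0 : 0 < vol mu B).

Let s0 : 0 < s. Proof. exact: lt_le_trans s1. Qed.
Let V := vol mu B.

(** Measurability is asked on all of X, whereas [convex_body] asks it on the set only; this makes
    finite sums of tau_i(x) phi_i(y) measurable in both variables on the whole product. *)
Definition unit_dual (phi : X -> R) : Prop := measurable_fun [set: X] phi /\
  (avg_norm mu (hoelder_conjugate s%:E) B (EFin \o phi) <= 1)%E.

Lemma avg_norm_le1 (p : R) (phi : X -> R) : 0 < p ->
  (avg_norm mu p%:E B (EFin \o phi) <= 1)%E <->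
  (pow_integral mu p B phi <= V%:E)%E.
Proof.
move=> p0; rewrite /avg_norm.
have -> : (\int[mu]_(x in B) (`|(EFin \o phi) x| `^ p))%E = pow_integral mu p B phi by [].
have V0 : (0 < V%:E)%E by rewrite lte_fin.
rewrite (volE fB) inver gt_eqF// muleC.
set I := pow_integral mu p B phi.
have I0 : (0 <= I)%E by exact: pow_integral_ge0.
have q0 : (0 <= I * (vol mu B)^-1%:E)%E by rewrite mule_ge0// lee_fin invr_ge0 ltW.
have in0 (x : \bar R) : (0 <= x)%E -> x \in `[0%E, +oo%E] by move=> ?;
  rewrite in_itv /= leey andbT.
have e1 (t : R) : (1 `^ t = 1 :> \bar R)%E by rewrite poweR_EFin powR1.
split => h.
  have := @gt0_ler_poweR _ p (ltW p0) _ _ (in0 _ (poweR_ge0 _ _)) (in0 _ (@lee01 R)) h.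
  by rewrite e1 -poweRrM mulVf ?gt_eqF// poweRe1// lee_pdivrMr// mul1e.
rewrite -(e1 p^-1); apply: gt0_ler_poweR; rewrite ?invr_ge0 ?(ltW p0)//; try exact: in0.
by rewrite lee_pdivrMr// mul1e.
Qed.

Lemma unit_dual1 (phi : X -> R) : s = 1 -> measurable_fun [set: X] phi ->
  unit_dual phi <-> {ae mu, forall x, B x -> `|phi x| <= 1}.
Proof.
move=> sE mphi; rewrite /unit_dual sE hoelder_conjugate1 /avg_norm; split.
  move=> [_ /ess_supP]; apply: filterS => x h Bx; move: h.
  by rewrite /= indicE mem_set// mule1 lee_fin.
move=> h; split => //; apply/ess_supP; apply: filterS h => x h.
rewrite /= indicE; have [xB|_] := boolP (x \in B); last by rewrite mule0.
by rewrite mule1 lee_fin h//; rewrite inE in xB.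
Qed.

Let p := s / (s - 1).

Lemma unit_dualP (phi : X -> R) : 1 < s -> measurable_fun [set: X] phi ->
  unit_dual phi <-> (pow_integral mu p B phi <= V%:E)%E.
Proof.
move=> s_gt1 mphi.
have p0 : 0 < p by rewrite divr_gt0// subr_gt0.
have pE : hoelder_conjugate s%:E = p%:E.
  rewrite /hoelder_conjugate /= eqe gt_eqF// -EFinD inver subr_eq0 gt_eqF//.
split => [[_]|h]; first by rewrite pE => h; apply/(avg_norm_le1 phi p0).
by split => //; rewrite pE; apply/(avg_norm_le1 phi p0).
Qed.

Let p_gt1 : 1 < s -> 1 < p.
Proof. by move=> h; rewrite /p ltr_pdivlMr ?subr_gt0// mul1r ltrBlDr ltrDl. Qed.

Let pq1 : 1 < s -> s^-1 + p^-1 = 1.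
Proof.
move=> h; have h1 : s - 1 != 0 by rewrite subr_eq0 gt_eqF.
have h2 : s != 0 by rewrite gt_eqF.
by rewrite /p; field; rewrite ?h1 ?h2.
Qed.

(** Young's inequality |phi g| <= |phi|^p + |g|^s, or |phi| <= 1 a.e. when s = 1. The bound is
    cruder than Hoelder's, but it is only used for integrability and for boundedness of the convex
    body. *)
Lemma unit_dual_bound (phi g : X -> R) : unit_dual phi ->
  measurable_fun [set: X] g -> (pow_integral mu s B g < +oo)%E ->
  mu.-integrable B (EFin \o (fun x => phi x * g x)) /\
  `|V^-1 * \int[mu]_(x in B) (phi x * g x)| <= 1 + V^-1 * fine (pow_integral mu s B g).
Proof.
move=> uphi mg fg; have [mphi _] := uphi.
set J := fine (pow_integral mu s B g).
have JE : pow_integral mu s B g = J%:E by rewrite fineK// ge0_fin_numE// pow_integral_ge0.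
have mpg : measurable_fun [set: X] (fun x => phi x * g x) by exact: measurable_funM.
have mpgB : measurable_fun B (EFin \o (fun x => phi x * g x)).
  by apply/measurable_EFinP; exact: measurable_funTS.
have hI : (\int[mu]_(x in B) `|(phi x * g x)%:E| <= (V + J)%:E)%E.
  have [sE|sN] := eqVneq s 1.
    apply: (@le_trans _ _ (pow_integral mu s B g)); last by rewrite JE lee_fin lerDr ltW.
    have hae := (unit_dual1 sE mphi).1 uphi.
    apply: ae_ge0_le_integral => //.
    - exact: measurableT_comp.
    - exact/measurable_funTS/measurable_norm_powR.
    - apply: filterS hae => x h Bx; rewrite lee_fin sE powRr1// normrM.
      by rewrite ler_piMl// h.
  have s_gt1 : 1 < s by rewrite lt_def sN.
  have hp := (unit_dualP s_gt1 mphi).1 uphi.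
  have s0' : 0 < p by exact: lt_trans (p_gt1 s_gt1).
  apply: (@le_trans _ _ (\int[mu]_(x in B) ((`|phi x| `^ p)%:E + (`|g x| `^ s)%:E))%E).
    apply: ge0_le_integral => //.
    - exact: measurableT_comp.
    - by apply: emeasurable_funD; exact/measurable_funTS/measurable_norm_powR.
    - move=> x _; rewrite -EFinD lee_fin normrM.
      have := @conjugate_powR R `|phi x| `|g x| p s (normr_ge0 _) (normr_ge0 _) s0' s0.
      rewrite addrC pq1// => /(_ erefl) /le_trans; apply.
      apply: lerD; rewrite ler_pdivrMr// ler_peMr ?powR_ge0//.
      exact/ltW/p_gt1.
  rewrite ge0_integralD//; last 2 first.
  - exact/measurable_funTS/measurable_norm_powR.
  - exact/measurable_funTS/measurable_norm_powR.
  rewrite EFinD -JE; exact: leeD.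
have ipg : mu.-integrable B (EFin \o (fun x => phi x * g x)).
  by apply/integrableP; split => //; apply: le_lt_trans hI _; rewrite ltry.
split => //; rewrite normrM gtr0_norm ?invr_gt0//.
rewrite -[leRHS](_ : V^-1 * (V + J) = _); last by rewrite mulrDr mulVf ?gt_eqF.
rewrite ler_pM2l ?invr_gt0//; apply: le_trans (le_normr_Rintegral _ _) _ => //.
rewrite /Rintegral -lee_fin fineK; first by under eq_integral do rewrite -abse_EFin.
rewrite ge0_fin_numE ?integral_ge0//; apply: le_lt_trans hI _; by rewrite ltry.
Qed.

(* The extremal function in Hoelder's inequality. *)
Lemma unit_dual_exists (g : X -> R) : measurable_fun [set: X] g ->
  (pow_integral mu s B g < +oo)%E ->
  exists2 phi, unit_dual phi & forall c, 0 <= c ->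
    `|V^-1 * \int[mu]_(x in B) (phi x * g x)| <= c ->
    (pow_integral mu s B g <= (c `^ s * V)%:E)%E.
Proof.
move=> mg fg.
set J := fine (pow_integral mu s B g).
have JE : pow_integral mu s B g = J%:E by rewrite fineK// ge0_fin_numE// pow_integral_ge0.
have J0 : 0 <= J by rewrite -lee_fin -JE pow_integral_ge0.
pose a := J / V.
have a0 : 0 <= a by rewrite divr_ge0// ltW.
(* With a the average of |g|^s, this factor gives sg(g) |g|^(s-1) dual norm at most 1, while its
   pairing with g becomes a^(1/s). For a = 0 the zero function is used instead. *)
pose ka := (a `^ (1 - s^-1))^-1.
have ka0 : 0 <= ka by rewrite invr_ge0 powR_ge0.
pose phi x := Num.sg (g x) * `|g x| `^ (s - 1) * ka.
have mphi : measurable_fun [set: X] phi.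
  apply: measurable_funM => //; apply: measurable_funM.
    rewrite (_ : (fun x => Num.sg (g x)) = (fun x =>
      \1_(g @^-1` `]0, +oo[) x - \1_(g @^-1` `]-oo, 0[) x)).
      apply: measurable_funB; apply: measurable_indic.
        by rewrite -[X in measurable X]setTI; exact: mg.
      by rewrite -[X in measurable X]setTI; exact: mg.
    apply/funext => x; rewrite !indicE.
    have -> : (x \in g @^-1` `]0, +oo[) = (0 < g x).
      by apply/idP/idP; rewrite inE /= in_itv /= andbT.
    have -> : (x \in g @^-1` `]-oo, 0[) = (g x < 0).
      by apply/idP/idP; rewrite inE /= in_itv.
    by case: sgrP => _; rewrite ?subr0 ?sub0r.
  apply: (measurableT_comp (measurable_powR (s - 1))).
  exact: (measurableT_comp (@normr_measurable _ _)).
have [aE|aN] := eqVneq a 0.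
  exists (fun=> 0).
    have m0 : measurable_fun [set: X] (fun=> 0 : R) by [].
    have [sE|sN] := eqVneq s 1.
      by apply/(unit_dual1 sE m0); apply: aeW => x _; rewrite normr0.
    have s_gt1 : 1 < s by rewrite lt_def sN.
    apply/(unit_dualP s_gt1 m0); rewrite /pow_integral.
    under eq_integral do rewrite normr0 powR0 ?gt_eqF ?(lt_trans ltr01 (p_gt1 s_gt1))//.
    by rewrite integral0 lee_fin ltW.
  move=> c c0 _; rewrite JE lee_fin.
  have -> : J = 0 by apply/eqP; move/eqP: aE; rewrite mulf_eq0 invr_eq0 (gt_eqF B0) orbF.
  by rewrite mulr_ge0 ?powR_ge0// ltW.
have a_gt0 : 0 < a by rewrite lt_def aN.
have ka_gt0 : 0 < ka by rewrite invr_gt0 powR_gt0.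
exists phi.
  have [sE|sN] := eqVneq s 1.
    apply/(unit_dual1 sE mphi); apply: aeW => x _.
    rewrite /phi /ka sE invr1 subrr !powRr0 invr1 !mulr1 normr_sg.
    by case: (_ != _).
  have s_gt1 : 1 < s by rewrite lt_def sN.
  have p0 : 0 < p by exact: lt_trans (p_gt1 s_gt1).
  apply/(unit_dualP s_gt1 mphi).
  apply: (@le_trans _ _ (a^-1%:E * pow_integral mu s B g)%E).
    rewrite /pow_integral -ge0_integralZl_EFin ?invr_ge0//; last first.
      exact/measurable_funTS/measurable_norm_powR.
    apply: ge0_le_integral => //.
    - exact/measurable_funTS/measurable_norm_powR.
    - apply: measurable_funeM; exact/measurable_funTS/measurable_norm_powR.
    - move=> x _; rewrite -EFinM lee_fin /phi !normrM normr_sg.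
      rewrite (ger0_norm (powR_ge0 _ _)) (ger0_norm ka0).
      have [->|gN] := eqVneq (g x) 0.
        rewrite /= normr0 !mul0r powR0 ?gt_eqF// mulr_ge0 ?invr_ge0// powR_ge0//.
      rewrite mul1r powRM ?powR_ge0// -powRrM /p mulrC (mulrC (s - 1)) divfK ?subr_eq0//.
      rewrite ler_wpM2r ?powR_ge0// /ka -powRN -powRrM.
      rewrite (_ : _ * _ = -1); first by rewrite powR_inv1.
      have h1 : s - 1 != 0 by rewrite subr_eq0.
      have h2 : s != 0 by rewrite gt_eqF.
      by field; rewrite ?h1 ?h2.
  rewrite JE -EFinM lee_fin /a invf_div mulfVK ?gt_eqF//.
  rewrite lt_def; apply/andP; split => //.
  by apply: contraNneq aN => J00; rewrite /a J00 mul0r.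
move=> c c0.
have -> : \int[mu]_(x in B) (phi x * g x) = ka * J.
  rewrite /Rintegral (_ : (fun x => _) = fun x => (ka%:E * (`|g x| `^ s)%:E)%E).
    rewrite ge0_integralZl_EFin//; last exact/measurable_funTS/measurable_norm_powR.
    by rewrite -/(pow_integral mu s B g) JE.
  apply/funext => x; rewrite -EFinM; congr EFin.
  transitivity (ka * (Num.sg (g x) * g x * `|g x| `^ (s - 1))); first by rewrite /phi; ring.
  by rewrite -normrEsg mulr_powRB1.
rewrite mulrCA (mulrC V^-1) -/a => h.
have aka : ka * a = a `^ s^-1.
  rewrite /ka -powRN -{2}(powRr1 a0) -powRD; last by rewrite aN implybT.
  by rewrite opprB subrK.
move: h; rewrite aka ger0_norm ?powR_ge0// => h.
have {}h : a <= c `^ s.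
  rewrite -[leLHS](powRr1 a0) -(mulVf (_ : s != 0)) ?gt_eqF// powRrM.
  by apply: ge0_ler_powR; rewrite ?nnegrE ?powR_ge0// ltW.
by rewrite JE lee_fin -ler_pdivrMr.
Qed.

End Duality.

(** * The stopping-time step for vector functions *)

Lemma Rintegral_comb (disp : measure_display) (X : measurableType disp)
    (R : realType) (mu : {measure set X -> \bar R}) (B : set X) (I : Type)
    (r : seq I) (a : I -> R) (h : I -> X -> R) :
  measurable B -> (forall i, mu.-integrable B (EFin \o h i)) ->
  \int[mu]_(x in B) (\sum_(i <- r) a i * h i x) =
  \sum_(i <- r) a i * \int[mu]_(x in B) h i x.
Proof.
move=> mB ih.
have iah i : mu.-integrable B (EFin \o (fun x => a i * h i x)).
  by have := integrableZl mB (a i) (ih i).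
elim: r => [|i r IH].
  rewrite big_nil /Rintegral.
  by under eq_integral do rewrite big_nil; rewrite integral0.
rewrite big_cons -IH -RintegralZl// -RintegralD//.
  by rewrite /Rintegral; under eq_integral do rewrite big_cons.
rewrite (_ : _ \o _ = fun x => \sum_(i <- r) (a i * h i x)%:E).
  by apply: (integrable_sum mB) => j _; exact: iah.
by apply/funext => x /=; rewrite -sumEFin.
Qed.

Lemma measurable_fun_countable_cover (d1 d2 : measure_display)
    (X : measurableType d1) (Y : measurableType d2) (I : Type) (D : set I)
    (F : I -> set X) (f : X -> Y) :
  countable D -> (forall i, D i -> measurable (F i)) ->
  (forall i, D i -> measurable_fun (F i) f) ->
  measurable_fun (\bigcup_(i in D) F i) f.
Proof.
move=> cD mF mf _ A mA; rewrite setI_bigcupl.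
apply: countable_bigcup_measurable => // i Di.
by apply: mf => //; exact: mF.
Qed.

Section UnitDualComb.
Context (R : realType) (disp : measure_display) (X : measurableType disp).
Variable mu : {measure set X -> \bar R}.
Variables (s : R) (B : set X).
Hypotheses (s1 : 1 <= s) (mB : measurable B) (fB : (mu B < +oo)%E)
  (B0 : 0 < vol mu B).

(** One factor 1 / (n + 1) pays for the number of terms, bounding the sum by max |phi_i| / (n + 1).
    After raising to the power p >= 1 and bounding the maximum by a sum of powers, the other factor
    pays for the k integrals. Minkowski's inequality is thus avoided. *)
Lemma unit_dual_comb (n k : nat) (tau : 'I_k -> R) (phi : 'I_k -> X -> R) :
  (k <= n)%N -> (forall i, `|tau i| <= (n.+1%:R ^+ 2)^-1) ->
  (forall i, unit_dual mu s B (phi i)) ->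
  unit_dual mu s B (fun y => \sum_i tau i * phi i y).
Proof.
move=> kn htau uphi.
have N0 : 0 < n.+1%:R :> R by rewrite ltr0n.
have N1 : 1 <= n.+1%:R :> R by rewrite ler1n.
have mphi i : measurable_fun [set: X] (phi i) by case: (uphi i).
have msum : measurable_fun [set: X] (fun y => \sum_i tau i * phi i y).
  by apply: measurable_sum => i; exact: measurable_funM.
have bound y m : (forall i, `|phi i y| <= m) -> 0 <= m ->
    `|\sum_i tau i * phi i y| <= m / n.+1%:R.
  move=> hm m0; apply: (le_trans (ler_norm_sum _ _ _)).
  apply: (@le_trans _ _ (\sum_(i < k) m / n.+1%:R ^+ 2)).
    by apply: ler_sum => i _; rewrite normrM mulrC ler_pM.
  rewrite sumr_const card_ord -[leLHS]mulr_natl expr2 invfM mulrCA.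
  rewrite ler_wpM2l// mulrA ler_piMl ?invr_ge0 ?(ltW N0)//.
  by rewrite ler_pdivrMr// mul1r ler_nat ltnW.
have [sE|sN] := eqVneq s 1.
  apply/(unit_dual1 mu B sE msum).
  have : {ae mu, forall y, forall i : 'I_k, [set: 'I_k] i -> B y -> `|phi i y| <= 1}.
    apply: ae_forall_countable => [|i _]; first exact: countableP.
    by apply/(unit_dual1 mu B sE (mphi i)).
  apply: filterS => y hy By; apply: (le_trans (bound y 1 _ _)) => //.
    by move=> i; exact: hy.
  by rewrite div1r invf_le1.
have s_gt1 : 1 < s by rewrite lt_def sN.
set p := s / (s - 1).
have p1 : 1 <= p by rewrite /p ler_pdivlMr ?subr_gt0// mul1r lerBlDr lerDl.
have p0 : 0 < p by exact: lt_le_trans p1.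
apply/(unit_dualP s1 fB B0 s_gt1 msum); rewrite -/p.
have pt y : `|\sum_i tau i * phi i y| `^ p <=
    n.+1%:R^-1 * \sum_(i < k) `|phi i y| `^ p.
  have [k0|k0] := posnP k.
    rewrite !big1 ?normr0 ?powR0 ?mulr0 ?gt_eqF// => i _; case: i => i hi; exfalso;
      by move: hi; rewrite k0.
  have [i0 _ himax] := arg_maxP (fun i => `|phi i y|) (erefl : xpredT (Ordinal k0)).
  have hi i : `|phi i y| <= `|phi i0 y| by exact: himax.
  apply: (@le_trans _ _ ((`|phi i0 y| / n.+1%:R) `^ p)).
    by apply: ge0_ler_powR; rewrite ?nnegrE ?(ltW p0) ?divr_ge0 ?(ltW N0)// bound.
  rewrite powRM// mulrC -{1}(powR_inv1 (ltW N0)) -powRrM mulN1r powRN.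
  apply: ler_pM; rewrite ?invr_ge0 ?powR_ge0//.
    rewrite lef_pV2 ?posrE ?powR_gt0// -[leLHS]powRr1//.
    exact: ler_powR.
  rewrite (bigD1 i0)//= lerDl; apply: sumr_ge0 => i _; exact: powR_ge0.
apply: (@le_trans _ _ (\int[mu]_(y in B) ((n.+1%:R^-1)%:E *
    \sum_(i < k) (`|phi i y| `^ p)%:E))%E).
  apply: ge0_le_integral => //.
  - exact/measurable_funTS/measurable_norm_powR.
  - apply: measurable_funeM; apply: emeasurable_sum => i.
    exact/measurable_funTS/measurable_norm_powR.
  - by move=> y _; rewrite sumEFin -EFinM lee_fin.
rewrite ge0_integralZl_EFin ?invr_ge0//; last 2 first.
- by move=> y _; rewrite sumEFin lee_fin sumr_ge0// => i _; exact: powR_ge0.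
- by apply: emeasurable_sum => i; exact/measurable_funTS/measurable_norm_powR.
rewrite ge0_integral_sum//; last first.
  by move=> i; exact/measurable_funTS/measurable_norm_powR.
apply: (@le_trans _ _ (((n.+1%:R^-1)%:E * \sum_(i < k) (vol mu B)%:E))%E).
  rewrite lee_wpmul2l ?lee_fin ?invr_ge0//; apply: lee_sum => i _.
  by apply/(unit_dualP s1 fB B0 s_gt1 (mphi i)).
rewrite sumEFin -EFinM lee_fin sumr_const card_ord -[_ *+ k]mulr_natl mulrA.
by rewrite ler_piMl ?(ltW B0)// mulrC ler_pdivrMr// mul1r ler_nat ltnW.
Qed.

End UnitDualComb.

Section VectorFunctions.
Context (R : realType) (disp : measure_display) (X : measurableType disp).
Variables (d : X -> X -> R) (mu : {measure set X -> \bar R}) (cd cmu : R).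
Hypothesis HT : homogeneous_type d mu cd cmu.
Variables (n : nat) (s : R) (f : X -> 'rV[R]_n).
Hypotheses (s1 : 1 <= s) (hf : bounded_Lfun_rV d mu s f).

Let s0 : 0 < s. Proof. exact: lt_le_trans s1. Qed.

Definition lin_coord (w : 'cV[R]_n) (x : X) : R := (f x *m w) ord0 ord0.

Lemma lin_coordE w x : lin_coord w x = \sum_l w l ord0 * f x ord0 l.
Proof. by rewrite /lin_coord mxE; apply: eq_bigr => l _; rewrite mulrC. Qed.

Lemma bounded_Lfun_coord l : bounded_Lfun d mu s (fun x => f x ord0 l).
Proof.
have [[c [rho [rho0 h0]]] mf /(LfunP_pow_integral mu _ s0)[menorm fenorm]] := hf.
split; first by exists c, rho; split => // x /h0 ->; rewrite mxE.
apply/(LfunP_pow_integral mu _ s0); split; first exact: mf.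
apply: le_lt_trans fenorm; apply: ge0_le_integral => //.
- exact/measurable_norm_powR/mf.
- exact: measurable_norm_powR.
- move=> x _; rewrite lee_fin; apply: ge0_ler_powR; rewrite ?nnegrE ?(ltW s0)//.
  rewrite [leRHS]ger0_norm ?sqrtr_ge0// /enorm -sqrtr_sqr ler_wsqrtr//.
  by rewrite (bigD1 l)//= lerDl sumr_ge0// => i _; rewrite sqr_ge0.
Qed.

Lemma bounded_Lfun_lin_coord w : bounded_Lfun d mu s (lin_coord w).
Proof.
have [[c _] _ _] := hf.
have -> : lin_coord w = fun x => \sum_l w l ord0 * f x ord0 l.
  by apply/funext => x; exact: lin_coordE.
by apply: (bounded_Lfun_sum HT s1 c) => l; exact: bounded_Lfun_coord.
Qed.

Lemma bounded_pow_integral_lty g (B : set X) : bounded_Lfun d mu s g ->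
  measurable B -> (pow_integral mu s B g < +oo)%E.
Proof.
move=> [_ /(LfunP_pow_integral mu _ s0)[mg fg]] mB; apply: le_lt_trans fg.
exact: pow_integral_sub.
Qed.

Variable B : set X.
Hypotheses (mB : measurable B) (fB : (mu B < +oo)%E) (B0 : 0 < vol mu B).

Lemma unit_dual_coord_integrable phi l : unit_dual mu s B phi ->
  mu.-integrable B (EFin \o (fun x => phi x * f x ord0 l)).
Proof.
move=> uphi; have hl := bounded_Lfun_coord l.
have := unit_dual_bound s1 mB fB B0 uphi (bounded_Lfun_measurable s1 hl).
by move=> /(_ (bounded_pow_integral_lty hl mB))[].
Qed.

Lemma avg_rV_mul phi w : unit_dual mu s B phi ->
  (avg_rV mu B (fun x => phi x *: f x) *m w) ord0 ord0 =
  (vol mu B)^-1 * \int[mu]_(x in B) (phi x * lin_coord w x).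
Proof.
move=> uphi.
have -> : \int[mu]_(x in B) (phi x * lin_coord w x) =
    \int[mu]_(x in B) (\sum_l w l ord0 * (phi x * f x ord0 l)).
  apply: eq_Rintegral => x _; rewrite lin_coordE mulr_sumr.
  by apply: eq_bigr => l _; rewrite mulrCA.
rewrite Rintegral_comb//; last by move=> l; exact: unit_dual_coord_integrable.
rewrite mxE mulr_sumr; apply: eq_bigr => l _; rewrite mxE mulrC mulrCA.
congr (_ * (_ * _)); apply: eq_Rintegral => x _; by rewrite mxE.
Qed.

Lemma avg_rV_comb (k : nat) (tau : 'I_k -> R) (phi : 'I_k -> X -> R) :
  (forall i, unit_dual mu s B (phi i)) ->
  avg_rV mu B (fun y => (\sum_i tau i * phi i y) *: f y) =
  \sum_i tau i *: avg_rV mu B (fun y => phi i y *: f y).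
Proof.
move=> uphi; apply/rowP => l; rewrite summxE !mxE.
have -> : \int[mu]_(x in B) ((\sum_i tau i * phi i x) *: f x) ord0 l =
    \int[mu]_(x in B) (\sum_i tau i * (phi i x * f x ord0 l)).
  apply: eq_Rintegral => x _; rewrite mxE mulr_suml.
  by apply: eq_bigr => i _; rewrite mulrA.
rewrite Rintegral_comb//; last by move=> i; exact: unit_dual_coord_integrable.
rewrite mulr_sumr; apply: eq_bigr => i _; rewrite !mxE mulrCA.
congr (_ * (_ * _)); apply: eq_Rintegral => x _; by rewrite mxE.
Qed.

(** The convex body of f over B, with test functions measurable on the whole space. *)
Definition dual_averages : set 'rV[R]_n :=
  [set avg_rV mu B (fun x => phi x *: f x) | phi in unit_dual mu s B].

Lemma dual_averages_bounded :
  exists M : R, forall u i, dual_averages u -> `|u ord0 i| <= M.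
Proof.
pose a i := 1 + (vol mu B)^-1 * fine (pow_integral mu s B (fun x => f x ord0 i)).
exists (\sum_i `|a i|) => _ i [phi uphi <-].
have hl := bounded_Lfun_coord i.
have [_ h] := unit_dual_bound s1 mB fB B0 uphi (bounded_Lfun_measurable s1 hl)
  (bounded_pow_integral_lty hl mB).
have -> : avg_rV mu B (fun x => phi x *: f x) ord0 i =
    (vol mu B)^-1 * \int[mu]_(x in B) (phi x * f x ord0 i).
  by rewrite mxE; congr (_ * _); apply: eq_Rintegral => x _; rewrite mxE.
apply: (le_trans h); apply: (@le_trans _ _ `|a i|); first exact: ler_norm.
by rewrite (bigD1 i)//= lerDl sumr_ge0.
Qed.

(** Pairing phi with the scalar function f w gives u w, where u is the dual average defined by phi.
    Applied to the extremal phi, a bound for a linear functional on the convex body becomes a bound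
    for the s-average of f w. *)
Lemma pow_integral_lin_coord w c : 0 <= c ->
  (forall u, dual_averages u -> `|(u *m w) ord0 ord0| <= c) ->
  (pow_integral mu s B (lin_coord w) <= (c `^ s * vol mu B)%:E)%E.
Proof.
move=> c0 h; have hw := bounded_Lfun_lin_coord w.
have [phi uphi hphi] := unit_dual_exists s1 mB fB B0 (bounded_Lfun_measurable s1 hw)
  (bounded_pow_integral_lty hw mB).
apply: hphi => //; rewrite -avg_rV_mul//; apply: h.
by exists phi.
Qed.

End VectorFunctions.

(** T acts on functions, not on classes modulo null sets, so this is not automatic. On a ball
    containing the support the average of g is 0, so the set where T g is nonzero has measure at
    most l mu(B) for every l in (0, 1). *)
Lemma linear_operator_null (R : realType) (disp : measure_display)
    (X : measurableType disp) (d : X -> X -> R)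
    (mu : {measure set X -> \bar R}) (cd cmu s q : R)
    (T : (X -> R) -> (X -> R)) (psi : R -> R) (g : X -> R) :
  homogeneous_type d mu cd cmu -> 1 <= s -> 1 <= q -> linear_operator d mu s T ->
  operator_bound d mu s q T psi -> bounded_Lfun d mu s g ->
  pow_integral mu s [set: X] g = 0%E -> {ae mu, forall x, T g x = 0}.
Proof.
move=> HT s1 q1 linT boundT hg g0.
have s0 : 0 < s by exact: lt_le_trans s1.
have q0 : 0 < q by exact: lt_le_trans q1.
have mg := bounded_Lfun_measurable s1 hg.
have gae : {ae mu, forall x, g x = 0}.
  have mgs := measurable_norm_powR s mg.
  have : ae_eq mu setT (fun x => (`|g x| `^ s)%:E) (cst 0%E).
    apply/(ae_eq_integral_abs mu measurableT mgs).
    rewrite -[RHS]g0; apply: eq_integral => x _.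
    by rewrite gee0_abs// lee_fin powR_ge0.
  apply: filterS => x /(_ I) /= [] /eqP; rewrite powR_eq0 normr_eq0 => /andP[/eqP//].
have avg0 (B : set X) : measurable B -> avg_norm mu q%:E B (EFin \o g) = 0%E.
  move=> mB; rewrite /avg_norm (_ : integral _ _ _ = 0%E).
    by rewrite mule0 poweR0r// invr_neq0 ?gt_eqF.
  transitivity (\int[mu]_(x in B) (cst 0%E x : \bar R))%E; last by rewrite integral0.
  apply: ae_eq_integral => //.
    exact/measurable_funTS/measurable_norm_powR.
  by apply: filterS gae => x gx _; rewrite /= gx normr0 powR0 ?gt_eqF.
have [[c [rho [rho0 hrho]]] _] := hg.
have mT := linT.1 _ hg.
pose B m := qball d c (rho + m%:R).
have mB m : measurable (B m) by exact: measurable_qball HT _ _.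
pose A m := B m `&` [set x | 0 < `|T g x|].
have mA m : measurable (A m).
  apply: measurableI => //; rewrite -[X in measurable X]setTI.
  rewrite (_ : [set x | 0 < `|T g x|] = [set x | (0%:E < `|T g x|%:E)%E]); last first.
    by apply/seteqP; split => x /=; rewrite lte_fin.
  apply: emeasurable_fun_o_infty => //; apply/measurable_EFinP.
  exact: (measurableT_comp (@normr_measurable _ _) mT).
have fB m : (mu (B m) < +oo)%E by exact: qball_lty HT _ _.
have A0 m : mu (A m) = 0%E.
  have fA : (mu (A m) < +oo)%E by exact: finite_sub (mA m) (mB m) (@subIsetl _ _ _) (fB m).
  have r0 : 0 < rho + m%:R by exact: ltr_wpDr.
  have h l : 0 < l < 1 -> vol mu (A m) <= l * vol mu (B m).
    move=> l01.
    have hb : (mu (B m `&` [set x | (psi l)%:E * avg_norm mu q%:E (B m) (EFin \o g)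
        < `|T (cutoff (B m) g) x|%:E]) <= l%:E * mu (B m))%E := @boundT c _ g l r0 hg l01.
    move: hb; rewrite avg0// mule0 cutoff_id.
      rewrite mule_volE// (_ : [set x | _] = [set x | 0 < `|T g x|]).
        by rewrite -/(A m) (volE fA) lee_fin.
      by apply/seteqP; split => x /=; rewrite lte_fin.
    by move=> x nBx; apply: hrho => rx; apply: nBx; apply: qball_le rx; rewrite lerDl.
  rewrite (volE fA); congr EFin; apply/eqP; rewrite eq_le vol_ge0 andbT.
  have V0 : 0 < vol mu (B m) by exact: vol_qball_gt0 HT _ _ r0.
  rewrite leNgt; apply/negP => v0.
  have l0 : 0 < Num.min 2^-1 (vol mu (A m) / (2 * vol mu (B m))).
    by rewrite lt_min invr_gt0 ltr0n /= divr_gt0// mulr_gt0.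
  have l1 : Num.min 2^-1 (vol mu (A m) / (2 * vol mu (B m))) < 1.
    by rewrite gt_min invf_lt1// ltr1n.
  have := h _ (introT andP (conj l0 l1)); apply/negP; rewrite -ltNge.
  apply: (@le_lt_trans _ _ (vol mu (A m) / (2 * vol mu (B m)) * vol mu (B m))).
    by rewrite ler_pM2r// ge_min lexx orbT.
  rewrite invfM mulrA divfK ?gt_eqF//.
  by rewrite ltr_pdivrMr// mulr2n mulrDr mulr1 ltrDl.
have : {ae mu, forall x, forall m, ~ A m x}.
  by apply: ae_foralln => m; exists (A m); split => // x /contrapT.
apply: filterS => x hx; apply/eqP; rewrite -[_ == _]negbK -normr_gt0; apply/negP => Tx.
apply: (hx (Num.truncn (d c x)).+1); split => //.
by apply: (lt_trans (truncnS_gt _)); rewrite ltrDr.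
Qed.

Section VectorStep.
Context (R : realType) (disp : measure_display) (X : measurableType disp).
Variables (d : X -> X -> R) (mu : {sigma_finite_measure set X -> \bar R}).
Variables (cd cmu : R).
Hypothesis HT : homogeneous_type d mu cd cmu.
Variables (c0 C0 delta alpha : R) (D : set (cube X)).
Hypothesis DS : dyadic_system d c0 C0 delta D.
Hypothesis alpha_ge : 3 * cd ^+ 2 / delta <= alpha.

Local Notation dil := (cube_dilate d C0 delta alpha).

Let measurable_dil Q : measurable (dil Q). Proof. exact: (measurable_dilate HT). Qed.
Let dil_lty Q : (mu (dil Q) < +oo)%E. Proof. exact: (dilate_lty HT). Qed.
Let dil_gt0 Q : 0 < vol mu (dil Q). Proof. exact: (dilate_vol_gt0 HT DS alpha_ge). Qed.

(** T (f 1_(alpha Q)), the quantity that telescopes down the tree of stopping cubes. *)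
Definition local_image (n : nat) (T : (X -> R) -> (X -> R)) (e : 'M[R]_n)
    (f : X -> 'rV[R]_n) (Q : cube X) : X -> 'rV[R]_n :=
  vector_operator T e (fun y => \1_(dil Q) y *: f y).

(** Since every dual average over alpha P satisfies u = u W V, duality gives f = f W V a.e. on alpha
    P. Linearity then moves T onto the scalar functions f W, the null error being removed by
    [linear_operator_null]. *)
Lemma local_image_expand (n k : nat) (s q : R) (psi : R -> R)
    (T : (X -> R) -> (X -> R)) (e : 'M[R]_n) (f : X -> 'rV[R]_n)
    (P Q : cube X) (V : 'M[R]_(k, n)) (W : 'M[R]_(n, k)) :
  1 <= q -> 1 <= s -> linear_operator d mu s T -> orthonormal_basis e ->
  operator_bound d mu s q T psi -> bounded_Lfun_rV d mu s f ->
  (forall u, dual_averages mu s f (dil P) u -> u = u *m W *m V) ->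
  dil Q `<=` dil P ->
  {ae mu, forall x, local_image T e f Q x =
    \sum_i T (cutoff (dil Q) (lin_coord f (col i W))) x *: row i V}.
Proof.
move=> q1 s1 linT eON boundT hf KVW QP.
have [[c _] _ _] := hf.
have mQ := measurable_dil Q.
pose w j : 'cV[R]_n := (row j e)^T.
(* The part of w j that V does not see: it annihilates every dual average, so the scalar function f
   rho_j vanishes a.e. on alpha P. *)
pose rho j : 'cV[R]_n := w j - W *m V *m w j.
have hlin v : bounded_Lfun d mu s (cutoff (dil Q) (lin_coord f v)).
  by apply: bounded_Lfun_cutoff => //; exact: (bounded_Lfun_lin_coord HT s1 hf).
have rho0 j : pow_integral mu s [set: X] (cutoff (dil Q) (lin_coord f (rho j))) = 0%E.
  have s0 : 0 < s by exact: lt_le_trans s1.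
  rewrite pow_integral_cutoff//; apply/eqP; rewrite eq_le pow_integral_ge0 andbT.
  apply: (@le_trans _ _ (pow_integral mu s (dil P) (lin_coord f (rho j)))).
    apply: pow_integral_sub => //.
    exact: (bounded_Lfun_measurable s1 (bounded_Lfun_lin_coord HT s1 hf _)).
  have := @pow_integral_lin_coord _ _ _ d mu cd cmu HT n s f s1 hf (dil P) (measurable_dil
    P) (dil_lty P) (dil_gt0 P) (rho j) 0 (lexx 0).
  rewrite powR0 ?gt_eqF// mul0r; apply => u /KVW uE.
  by rewrite /rho mulmxBr !mulmxA -uE subrr mxE normr0.
have expand j : {ae mu, forall x, T (cutoff (dil Q) (lin_coord f (w j))) x =
    \sum_i (V *m e^T) i j * T (cutoff (dil Q) (lin_coord f (col i W))) x}.
  have h1 := linear_operator_sum HT s1 linT c (index_enum 'I_k) (fun i =>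
    (V *m e^T) i j) (fun i => hlin (col i W)).
  have h2 := linear_operator_null HT s1 q1 linT boundT (hlin (rho j)) (rho0 j).
  have hs := bounded_Lfun_sum HT s1 c (index_enum 'I_k) (fun i => (V *m e^T) i j) (fun i =>
    hlin (col i W)).
  apply: filterS3 h1 h2 (linT.2 1 1 _ _ hs (hlin (rho j))) => x e1 e2.
  rewrite e1 e2 mulr0 addr0 mul1r => <-; congr (T _ x); apply/funext => y.
  rewrite !mul1r /cutoff; under eq_bigr do rewrite mulrA.
  rewrite -mulr_suml -mulrDl; congr (_ * _).
  rewrite /rho /lin_coord mulmxBr [in RHS]mxE.
  have -> : \sum_i (V *m e^T) i j * (f y *m col i W) ord0 ord0 =
      (f y *m (W *m V *m w j)) ord0 ord0.
    have -> : f y *m (W *m V *m w j) = f y *m W *m (V *m w j) by rewrite !mulmxA.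
    rewrite [RHS]mxE; apply: eq_bigr => i _; rewrite mulrC; congr (_ * _).
      by rewrite !mxE; apply: eq_bigr => l _; rewrite mxE.
    by rewrite !mxE; apply: eq_bigr => l _; rewrite !mxE.
  by rewrite [X in _ + (_ + X)]mxE addrC subrK.
have : {ae mu, forall x, forall j, [set: 'I_n] j -> T (cutoff (dil Q) (lin_coord f (w j))) x =
    \sum_i (V *m e^T) i j * T (cutoff (dil Q) (lin_coord f (col i W))) x}.
  apply: ae_forall_countable => [|j _]; first exact: countableP.
  exact: expand.
apply: filterS => x hx; rewrite /local_image /vector_operator.
pose t : 'rV[R]_k := \row_i T (cutoff (dil Q) (lin_coord f (col i W))) x.
transitivity (t *m V); last first.
  by rewrite mulmx_sum_row; apply: eq_bigr => i _; rewrite mxE.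
(* Inserting e^T e = 1 writes the right side in the basis e; the result itself does not depend on
   the basis. *)
have -> : t *m V = t *m (V *m e^T) *m e.
  by rewrite !mulmxA -mulmxA (mulmx1C eON) mulmx1.
rewrite mulmx_sum_row; apply: eq_bigr => j _; congr (_ *: _).
rewrite [RHS]mxE; under [RHS]eq_bigr do rewrite mxE mulrC.
rewrite -hx//; congr (T _ x); apply/funext => y.
rewrite /cutoff lin_coordE /dotv mulr_suml; apply: eq_bigr => l _.
by rewrite !mxE; ring.
Qed.

(** Truncating the coefficients makes the kernel bounds hold at every x, although the estimates for
    T hold only almost everywhere. *)
Definition clamp (C x : R) : R := Num.max (- C) (Num.min C x).

Lemma clamp_le C x : 0 <= C -> `|clamp C x| <= C.
Proof.
move=> hC; rewrite ler_norml /clamp le_max lexx /= ge_max ge_min lexx /=.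
by rewrite (le_trans _ hC)// oppr_le0.
Qed.

Lemma clamp_id C x : `|x| <= C -> clamp C x = x.
Proof.
by rewrite ler_norml => /andP[h1 h2]; rewrite /clamp min_r// max_r.
Qed.

(** The bound of [scalar_step] with M = 2^s. The final + 1 makes it positive, so that it can be
    divided by even when psi and phi vanish at lam. *)
Definition step_constant (s lam L : R) (psi phi : R -> R) : R :=
  phi lam * (1 + 2 `^ s) + psi lam * (2 + 2 `^ s + L * 2 `^ s) + 1.

Lemma vector_step (n : nat) : exists lam L : R, [/\ 0 < lam < 1, 0 < L &
  forall (s q r : R) (psi phi : R -> R) (T : (X -> R) -> (X -> R))
    (e : 'M[R]_n) (f : X -> 'rV[R]_n) (P : cube X),
  1 <= q -> 1 <= r -> q <= s -> r <= s -> linear_operator d mu s T ->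
  orthonormal_basis e ->
  operator_bound d mu s q T psi -> sharp_maximal_bound d mu s r alpha T phi ->
  0 <= psi lam -> 0 <= phi lam -> bounded_Lfun_rV d mu s f -> D P ->
  exists (Ch : set (cube X)) (k : X -> X -> R),
  [/\ (forall Q, Ch Q ->
        [/\ D Q, cube_gen P < cube_gen Q & Q `<=` P]) /\
      (forall Q Q' x, Ch Q -> Ch Q' -> (Q : set X) x -> (Q' : set X) x -> Q = Q'),
      (mu (\bigcup_(Q in Ch) Q) <= 2^-1%:E * mu P)%E,
      measurable_fun [set: X * X] (fun z : X * X => k z.1 z.2),
      forall x, unit_dual mu s (dil P) (k x) &
      {ae mu, forall x, (P : set X) x ->
        (~ (\bigcup_(Q in Ch) (Q : set X)) x ->
          local_image T e f P x =
          (step_constant s lam L psi phi * n.+1%:R ^+ 2) *: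
            avg_rV mu (dil P) (fun y => k x y *: f y)) /\
        (forall Q, Ch Q -> (Q : set X) x ->
          local_image T e f P x - local_image T e f Q x =
          (step_constant s lam L psi phi * n.+1%:R ^+ 2) *:
            avg_rV mu (dil P) (fun y => k x y *: f y))}]].
Proof.
have [lam [L [lam01 L0 step]]] := scalar_step HT DS alpha_ge n.
exists lam, L; split => // s q r psi phi T e f P q1 r1 qs rs linT eON boundT sharpT psi0
  phi0 hf DP.
have s1 : 1 <= s by exact: le_trans qs.
have s0 : 0 < s by exact: lt_le_trans s1.
have mP := measurable_dil P; have fP := dil_lty P; have VP := dil_gt0 P.
have [M0 hM0] := dual_averages_bounded s1 hf mP fP VP.
have [k [V [W [kn KV KW]]]] := near_extremal_basis hM0.
have ex_phi i : exists psi0, unit_dual mu s (dil P) psi0 /\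
    avg_rV mu (dil P) (fun x => psi0 x *: f x) = row i V.
  by have [psi0' u ue] := KV i; exists psi0'.
have [phi_ hphi_] := choice ex_phi.
have uphi i : unit_dual mu s (dil P) (phi_ i) by have [] := hphi_ i.
have vphi i : avg_rV mu (dil P) (fun x => phi_ i x *: f x) = row i V by have [] := hphi_ i.
pose g i := cutoff (dil P) (lin_coord f (col i W)).
have hlin w := bounded_Lfun_lin_coord HT s1 hf w.
have hg i : bounded_Lfun d mu s (g i) by apply: bounded_Lfun_cutoff.
have sg i x : ~ dil P x -> g i x = 0.
  by move=> nx; rewrite /g /cutoff indicE memNset// mulr0.
(* Points of the convex body have coordinates u W at most 2 in the near-extremal basis, so the
   s-averages of the g_i are at most 2^s by duality. *)
pose M : R := 2 `^ s.
have M_gt0 : 0 < M by rewrite powR_gt0.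
have hM i : (pow_integral mu s [set: X] (g i) <= (M * vol mu (dil P))%:E)%E.
  rewrite pow_integral_cutoff//; apply: (pow_integral_lin_coord HT s1 hf mP fP VP) => // u Ku.
  have [_ /(_ i)] := KW u Ku; rewrite (_ : (u *m col i W) ord0 ord0 = (u *m W) ord0 i)//.
  by rewrite !mxE; apply: eq_bigr => l _; rewrite mxE.
have [Ch [hCh disjCh muCh aeCh]] :=
  step s q r psi phi T M P k g q1 r1 qs rs linT boundT sharpT psi0 phi0 M_gt0 kn DP hg sg hM.
set C := step_constant s lam L psi phi.
have C1 : phi lam * (1 + M) + psi lam * (2 + M + L * M) <= C by rewrite /C /step_constant lerDl.
have C0' : 0 < C.
  rewrite /C /step_constant ltr_wpDl// addr_ge0// mulr_ge0//.
  by rewrite !addr_ge0 ?powR_ge0// mulr_ge0 ?powR_ge0// ltW.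
have cutg Q i : Ch Q -> cutoff (dil Q) (g i) = cutoff (dil Q) (lin_coord f (col i W)).
  move=> /hCh[_ _ _ dQP]; apply/funext => y; rewrite /g /cutoff !indicE.
  have [yQ|yQ] := boolP (y \in dil Q); last by rewrite !mulr0.
  by rewrite mem_set ?mulr1//; apply: dQP; rewrite inE in yQ.
pose U := \bigcup_(Q in Ch) (Q : set X).
have cCh : countable Ch.
  by apply: sub_countable (dyadic_countable HT DS); apply: subset_card_le => Q /hCh[].
have mCh Q : Ch Q -> measurable (Q : set X).
  by move=> /hCh[DQ _ _ _]; exact: dyadic_measurable DS _ DQ.
have mU : measurable U by exact: (countable_bigcup_measurable cCh mCh).
pose pick x := xget P [set Q | Ch Q /\ (Q : set X) x].
have pickE Q x : Ch Q -> (Q : set X) x -> pick x = Q.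
  move=> ChQ Qx; have [Cp px] : Ch (pick x) /\ (pick x : set X) x.
    by apply: (@xgetPex _ P [set Q | Ch Q /\ (Q : set X) x]); exists Q.
  exact: disjCh px Qx.
(* Disjointness of the stopping cubes makes [pick] the only one containing x, so one coefficient
   function covers both cases of the conclusion. *)
pose t i x := if `[< U x >] then T (g i) x - T (cutoff (dil (pick x)) (g i)) x
  else T (g i) x.
have tU i x : ~ U x -> t i x = T (g i) x by move=> nU; rewrite /t asboolF.
have tQ Q i x : Ch Q -> (Q : set X) x -> t i x = T (g i) x - T (cutoff (dil Q) (g i)) x.
  by move=> ChQ Qx; rewrite /t asboolT ?(pickE Q)//; exists Q.
have mt i : measurable_fun [set: X] (t i).
  rewrite -(setUv U); apply/measurable_funU => //; first exact: measurableC.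
  split.
    apply: measurable_fun_countable_cover => // Q ChQ.
    apply: (eq_measurable_fun (fun x => T (g i) x - T (cutoff (dil Q) (g i)) x)).
      by move=> x; rewrite inE => Qx; rewrite (tQ Q).
    apply: measurable_funTS; apply: measurable_funB; apply: linT.1 => //.
    exact: bounded_Lfun_cutoff.
  apply: (eq_measurable_fun (T (g i))); last by apply: measurable_funTS; exact: linT.1.
  by move=> x; rewrite inE => nU; rewrite tU.
pose N2 : R := n.+1%:R ^+ 2.
have N20 : 0 < N2 by rewrite exprn_gt0// ltr0n.
(* Division by C (n + 1)^2 brings the coefficients below the bound required by [unit_dual_comb]; the
   same factor reappears in the constant of the conclusion. *)
pose tau i x := clamp C (t i x) / (C * N2).
have mtau i : measurable_fun [set: X] (tau i).
  apply: measurable_funM => //.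
  rewrite /clamp; apply: measurable_maxr => //; exact: measurable_minr.
have htau i x : `|tau i x| <= N2^-1.
  rewrite normrM normfV normrM (gtr0_norm C0') (gtr0_norm N20).
  rewrite invfM mulrA ler_piMl ?invr_ge0 ?(ltW N20)//.
  by rewrite ler_pdivrMr// mul1r clamp_le// ltW.
exists Ch, (fun x y => \sum_i tau i x * phi_ i y); split.
- by split => // Q /hCh[].
- exact: muCh.
- apply: measurable_sum => i; apply: measurable_funM.
    exact: (measurableT_comp (mtau i) measurable_fst).
  have [mphi _] := uphi i; exact: (measurableT_comp mphi measurable_snd).
- by move=> x; apply: (unit_dual_comb s1 mP fP VP kn).
have avgE x : (C * N2) *: avg_rV mu (dil P) (fun y => (\sum_i tau i x * phi_ i y) *: f y) =
    \sum_i clamp C (t i x) *: row i V.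
  rewrite (avg_rV_comb s1 hf mP fP VP)// scaler_sumr; apply: eq_bigr => i _.
  by rewrite vphi scalerA mulrC divfK// gt_eqF// mulr_gt0.
have aeP := local_image_expand q1 s1 linT eON boundT hf (fun u Ku =>
  (KW u Ku).1) (@subset_refl _ (dil P)).
have aeQ : {ae mu, forall x, forall Q, Ch Q -> local_image T e f Q x =
    \sum_i T (cutoff (dil Q) (lin_coord f (col i W))) x *: row i V}.
  apply: ae_forall_countable => // Q /hCh[_ _ _ dQP].
  exact: (local_image_expand q1 s1 linT eON boundT hf (fun u Ku => (KW u Ku).1) dQP).
have aeT : {ae mu, forall x, forall i, [set: 'I_k] i -> (P : set X) x ->
    (~ U x -> `|T (g i) x| <= C) /\
    (forall Q, Ch Q -> (Q : set X) x -> `|T (g i) x - T (cutoff (dil Q) (g i)) x| <= C)}.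
  apply: ae_forall_countable => [|i _]; first exact: countableP.
  apply: filterS (aeCh i) => x h Px; have [h1 h2] := h Px; split.
    by move=> /h1 /le_trans; exact.
  by move=> Q ChQ Qx; exact: le_trans (h2 Q ChQ Qx) C1.
apply: filterS3 aeP aeQ aeT => x eP eQ eT Px; split.
  move=> nU; rewrite avgE eP; apply: eq_bigr => i _; congr (_ *: _).
  have [/(_ nU) h _] := eT i I Px.
  by rewrite tU// clamp_id.
move=> Q ChQ Qx; rewrite avgE eP eQ// -sumrB; apply: eq_bigr => i _.
have [_ /(_ Q ChQ Qx) h] := eT i I Px.
by rewrite (tQ Q)// clamp_id// -(cutg Q i ChQ) scalerBl.
Qed.

End VectorStep.

(** * Iteration of the stopping-time step *)

Section Roots.
Context (R : realType) (disp : measure_display) (X : measurableType disp).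
Variables (d : X -> X -> R) (mu : {measure set X -> \bar R}) (cd cmu : R).
Hypothesis HT : homogeneous_type d mu cd cmu.
Variables (c0 C0 delta alpha : R) (D : set (cube X)).
Hypothesis DS : dyadic_system d c0 C0 delta D.
Hypothesis alpha_ge : 3 * cd ^+ 2 / delta <= alpha.

Local Notation dil := (cube_dilate d C0 delta alpha).

(** The center of P and y both lie in the parent Q, so their distance is below 2 cd C0 delta^(k-1),
    with k the generation of P. One more triangle inequality gives the factor cd (2 cd + 1) <= 3
    cd^2 <= alpha delta. *)
Lemma sub_dilate_child (P Q : cube X) (y z : X) : D P -> D Q ->
  cube_gen Q = cube_gen P - 1 -> P `<=` Q -> (Q : set X) y ->
  d y z < C0 * delta ^ cube_gen Q -> dil P z.
Proof.
move=> DP DQ gQ PQ Qy yz.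
have cd0 := cd_gt0 HT; have cd1 := cd_ge1 HT; have C00 := dyadic_C0_gt0 DS.
have dl0 := dyadic_delta_gt0 DS; have sc0 := dyadic_scale_gt0 DS (cube_gen Q).
have cP := PQ _ (dyadic_center_in HT DS DP).
have h1 : d (cube_center P) y < 2 * cd * C0 * delta ^ cube_gen Q.
  exact: (dyadic_sub_qball HT DS DQ cP (lexx _) Qy).
rewrite /cube_dilate /qball/=; apply: le_lt_trans (qdist_tri HT y _ _) _.
apply: (@lt_le_trans _ _ (cd * (2 * cd * C0 * delta ^ cube_gen Q + C0 * delta ^ cube_gen Q))).
  by rewrite ltr_pM2l// ltrD.
have -> : alpha * C0 * delta ^ cube_gen P = alpha * delta * (C0 * delta ^ cube_gen Q).
  have -> : delta ^ cube_gen P = delta * delta ^ cube_gen Q.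
    have -> : cube_gen P = 1 + cube_gen Q by rewrite gQ addrC subrK.
    by rewrite exprzDr ?unitfE ?gt_eqF// expr1z.
  ring.
rewrite (_ : cd * (_ + _) = cd * (2 * cd + 1) * (C0 * delta ^ cube_gen Q)); last by ring.
rewrite ler_pM2r ?mulr_gt0//; apply: (@le_trans _ _ (3 * cd ^+ 2)).
  have : cd * 1 <= cd * cd by rewrite ler_pM2l.
  rewrite expr2; lra.
by rewrite -ler_pdivrMr.
Qed.

(* Two points are related when some cube contains both.  In each class fix a
   point y; the roots are the cubes whose parent, but not they themselves,
   contain y, stopped at a generation adapted to the distance from y to c. *)
Lemma dyadic_roots (c : X) (rho : R) : 0 < rho -> exists Rt : set (cube X),
  [/\ Rt `<=` D, forall P, Rt P -> qball d c rho `<=` dil P,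
      forall P Q x, Rt P -> Rt Q -> (P : set X) x -> (Q : set X) x -> P = Q &
      forall x, exists2 P, Rt P & (P : set X) x].
Proof.
move=> rho0.
have cd0 := cd_gt0 HT; have C00 := dyadic_C0_gt0 DS; have dl0 := dyadic_delta_gt0 DS.
pose cls x := [set y | exists2 Q, D Q & (Q : set X) x /\ (Q : set X) y].
have clsE x y : cls x y -> cls x = cls y.
  have sub u v w : cls u v -> cls v w -> cls u w.
    move=> [P DP [Pu Pv]] [Q DQ [Qv Qw]].
    have [PQ|QP] := leP (cube_gen P) (cube_gen Q).
      by exists P => //; split => //; exact: (dyadic_sub DS DQ DP PQ Qv Pv).
    by exists Q => //; split => //; exact: (dyadic_sub DS DP DQ (ltW QP) Pv Qv).
  have sym u v : cls u v -> cls v u by move=> [Q DQ []]; exists Q.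
  move=> xy; apply/seteqP; split => z; last exact: sub.
  exact/sub/sym.
have cls_refl x : cls x x.
  by have [Q [DQ _ Qx]] := dyadic_cover DS 0 x; exists Q.
have [r hr] : exists r : set X -> X, forall A, A !=set0 -> A (r A).
  have /choice[r hr] : forall A : set X, exists z, A !=set0 -> A z.
    move=> A; have [[z Az]|nA] := pselect (A !=set0); first by exists z.
    by exists c => /nA.
  by exists r.
pose rep x := r (cls x).
have repx x : cls x (rep x) by apply: hr; exists x.
(* Below the generation k0 y the ball of radius C0 delta^k about y contains the given ball, so
   [sub_dilate_child] puts that ball into the dilate of a root. *)
have exk0 y : exists k0 : int, forall k z, k <= k0 -> qball d c rho z ->
    d y z < C0 * delta ^ k.
  pose t := cd * (d y c + rho).
  have t0 : 0 < t by rewrite mulr_gt0// ltr_wpDl// (qdist_ge0 HT).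
  have [N _ hN] := expr_small (dyadic_delta DS) (divr_gt0 C00 t0).
  exists (- (N : int)) => k z kN cz; apply: (@lt_le_trans _ _ t).
    apply: le_lt_trans (qdist_tri HT c _ _) _; by rewrite ltr_pM2l// ltrD2l.
  apply: (@le_trans _ _ (C0 * delta ^ (- (N : int)))); last first.
    by rewrite ler_pM2l//; exact: (dyadic_scale_le DS).
  rewrite -exprnN ler_pdivlMr ?exprn_gt0//.
  by rewrite mulrC -ler_pdivlMr.
have [k0 hk0] := choice exk0.
pose Rt := [set P | D P /\ exists2 y, y = rep y & [/\ cube_gen P <= k0 y,
  (exists2 Q, D Q & [/\ cube_gen Q = cube_gen P - 1, P `<=` Q & (Q : set X) y]) &
  cube_gen P = k0 y \/ ~ (P : set X) y]].
(* Two roots that meet belong to the same class, hence to the same y. If P is the coarser one, the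
   parent of P' contains y and lies in P, so P stopped at k0 y; but no root of y has a finer
   generation. *)
have disj P P' x : Rt P -> Rt P' -> (P : set X) x -> (P' : set X) x ->
    cube_gen P < cube_gen P' -> False.
  move=> [DP [y yE [gP [Q DQ [gQ PQ Qy]] hP]]] [DP' [y' y'E [gP' [Q' DQ' [gQ' PQ' Qy']] hP']]].
  move=> Px P'x lt.
  have yy' : y = y'.
    rewrite yE y'E /rep -(clsE x y) -?(clsE x y')//.
      by exists Q' => //; split => //; exact: PQ'.
    by exists Q => //; split => //; exact: PQ.
  subst y'; case: hP => [gE|nP]; first by move: (lt_le_trans lt gP'); rewrite gE ltxx.
  apply: nP; apply: (dyadic_sub DS DQ' DP _ (PQ' _ P'x) Px Qy').
  by rewrite gQ' lerBrDr lezD1.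
exists Rt; split.
- by move=> P [].
- move=> P [DP [y yE [gP [Q DQ [gQ PQ Qy]] _]]] z cz.
  apply: (sub_dilate_child DP DQ gQ PQ Qy); apply: hk0 => //.
  by rewrite gQ; apply: le_trans gP; rewrite gerBl.
- move=> P Q x RP RQ Px Qx; have [DP _] := RP; have [DQ _] := RQ.
  apply: (dyadic_uniq DS DP DQ _ Px Qx); apply/eqP; rewrite eq_le.
  apply/andP; split; rewrite leNgt; apply/negP => lt.
    exact: disj RQ RP Qx Px lt.
  exact: disj RP RQ Px Qx lt.
move=> x; set y := rep x.
have yE : y = rep y by rewrite /rep -(clsE x y)//; exact: repx.
have [Qk hQk] := choice (fun k => dyadic_cover DS k x).
have QkD k : D (Qk k) by case: (hQk k).
have Qkg k : cube_gen (Qk k) = k by case: (hQk k).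
have Qkx k : (Qk k : set X) x by case: (hQk k).
have Qkle k l : k <= l -> Qk l `<=` Qk k.
  by move=> kl; apply: (dyadic_sub DS (QkD l) (QkD k) _ (Qkx l) (Qkx k)); rewrite !Qkg.
have [yk0|nyk0] := pselect ((Qk (k0 y) : set X) y).
  exists (Qk (k0 y)) => //; split => //; exists y => //; split; rewrite ?Qkg//; last by left.
  have le1 : k0 y - 1 <= k0 y by rewrite gerBl.
  by exists (Qk (k0 y - 1)) => //; split; [rewrite Qkg|exact: Qkle|exact: (Qkle _ _ le1)].
(* Some cube around x contains y, by definition of the class. From there the generation is refined
   until the cube loses y, which happens no later than at k0 y. *)
have [k1 k1k0 yk1] : exists2 k1, k1 <= k0 y & (Qk k1 : set X) y.
  have [Q DQ [Qx Qy]] := repx x.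
  have QE : Q = Qk (cube_gen Q) by apply: (dyadic_uniq DS DQ (QkD _) _ Qx (Qkx _)); rewrite Qkg.
  exists (Num.min (cube_gen Q) (k0 y)); first by rewrite ge_min lexx orbT.
  have le1 : Num.min (cube_gen Q) (k0 y) <= cube_gen Q by rewrite ge_min lexx.
  by apply: (Qkle _ _ le1); rewrite -QE.
have [m] := ubnP `|k0 y - k1|%N; elim: m k1 k1k0 yk1 => // m IH k1 k1k0 yk1 hm.
have k1lt : k1 < k0 y.
  by rewrite lt_def k1k0 andbT; apply/negP => /eqP e; apply: nyk0; rewrite e.
have [yS|nyS] := pselect ((Qk (k1 + 1) : set X) y).
  apply: (IH (k1 + 1)) => //; first by rewrite lezD1.
  by move: hm k1lt; clear; move: (k0 y) => a; lia.
exists (Qk (k1 + 1)) => //; split => //; exists y => //; split; rewrite ?Qkg.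
- by rewrite lezD1.
- exists (Qk k1) => //; split => //; first by rewrite Qkg addrK.
  by apply: Qkle; rewrite lerDl.
- by right.
Qed.

End Roots.

(** * The tree of stopping cubes and the telescoping sum *)

Section StoppingTree.
Context (R : realType) (disp : measure_display) (X : measurableType disp).
Variables (d : X -> X -> R) (mu : {measure set X -> \bar R}) (cd cmu : R).
Hypothesis HT : homogeneous_type d mu cd cmu.
Variables (c0 C0 delta : R) (D : set (cube X)).
Hypothesis DS : dyadic_system d c0 C0 delta D.
Variables (Rt : set (cube X)) (Ch : cube X -> set (cube X)).
Hypotheses (RtD : Rt `<=` D)
  (Rt_uniq : forall P Q x, Rt P -> Rt Q -> (P : set X) x -> (Q : set X) x -> P = Q)
  (Rt_cover : forall x, exists2 P, Rt P & (P : set X) x).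
Hypotheses
  (ChP : forall P Q, D P -> Ch P Q -> [/\ D Q, cube_gen P < cube_gen Q & Q `<=` P])
  (Ch_uniq : forall P Q Q' x, D P -> Ch P Q -> Ch P Q' ->
    (Q : set X) x -> (Q' : set X) x -> Q = Q')
  (Ch_half : forall P, D P ->
    (mu (\bigcup_(Q in Ch P) (Q : set X)) <= 2^-1%:E * mu P)%E).

Fixpoint tree_level (l : nat) : set (cube X) :=
  if l is j.+1 then [set Q | exists2 P, tree_level j P & Ch P Q] else Rt.

Definition tree : set (cube X) := \bigcup_l tree_level l.

Definition stopped (Q : cube X) : set X := \bigcup_(Q' in Ch Q) (Q' : set X).

Lemma tree_levelD l : tree_level l `<=` D.
Proof.
elim: l => [|l IH] Q /=; first exact: RtD.
by move=> [P /IH DP ChQ]; have [] := ChP DP ChQ.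
Qed.

Lemma treeD : tree `<=` D.
Proof. by move=> Q [l _ /tree_levelD]. Qed.

Lemma tree_level_uniq l P Q x : tree_level l P -> tree_level l Q ->
  (P : set X) x -> (Q : set X) x -> P = Q.
Proof.
elim: l P Q => [|l IH] P Q /=; first exact: Rt_uniq.
move=> [P' lP' CP] [Q' lQ' CQ] Px Qx.
have [_ _ PP'] := ChP (tree_levelD lP') CP.
have [_ _ QQ'] := ChP (tree_levelD lQ') CQ.
have e : P' = Q' by apply: IH => //; [exact: PP'|exact: QQ'].
by subst Q'; exact: Ch_uniq (tree_levelD lP') CP CQ Px Qx.
Qed.

Lemma tree_level_ancestor l j Q x : tree_level (l + j) Q -> (Q : set X) x ->
  exists2 P, tree_level l P & (P : set X) x.
Proof.
elim: j Q => [|j IH] Q; first by rewrite addn0; exists Q.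
rewrite addnS => -[P lP CQ] Qx; have [_ _ QP] := ChP (tree_levelD lP) CQ.
by apply: (IH P) => //; exact: QP.
Qed.

Lemma tree_level_stopped l l' P Q x : (l < l')%N -> tree_level l P ->
  tree_level l' Q -> (P : set X) x -> (Q : set X) x ->
  exists2 P1, Ch P P1 & (P1 : set X) x.
Proof.
move=> ll' lP lQ Px Qx; move: lQ; rewrite -(subnKC ll') => lQ.
have [P1 [P' lP' CP1] P1x] := tree_level_ancestor lQ Qx.
have [_ _ P1P'] := ChP (tree_levelD lP') CP1.
by exists P1 => //; rewrite (tree_level_uniq lP lP' Px)//; exact: P1P'.
Qed.

Lemma tree_level_gen l l' P Q x : (l < l')%N -> tree_level l P ->
  tree_level l' Q -> (P : set X) x -> (Q : set X) x -> cube_gen P < cube_gen Q.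
Proof.
move=> ll' lP; elim: l' Q ll' => // l' IH Q; rewrite ltnS leq_eqVlt.
move=> ll' [P' lP' CQ] Px Qx; have [_ gQ QP'] := ChP (tree_levelD lP') CQ.
have P'x := QP' _ Qx.
move: ll' => /predU1P[ll'|ll']; last exact: lt_trans (IH _ ll' lP' Px P'x) gQ.
by subst l'; rewrite (tree_level_uniq lP lP' Px P'x).
Qed.

Lemma stopped_measurable Q : D Q -> measurable (stopped Q).
Proof.
move=> DQ; apply: countable_bigcup_measurable.
  by apply: sub_countable (dyadic_countable HT DS); apply: subset_card_le => P /(ChP DQ)[].
by move=> P /(ChP DQ)[DP _ _]; exact: dyadic_measurable DS _ DP.
Qed.

Lemma stopped_sub Q : D Q -> stopped Q `<=` Q.
Proof. by move=> DQ x [P /(ChP DQ)[_ _ PQ] Px]; exact: PQ. Qed.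

Lemma vol_stopped Q : D Q -> vol mu (stopped Q) <= 2^-1 * vol mu Q.
Proof.
move=> DQ; have fQ := dyadic_lty HT DS DQ.
have fS : (mu (stopped Q) < +oo)%E.
  exact: (finite_sub (stopped_measurable DQ) (dyadic_measurable DS DQ) (stopped_sub DQ) fQ).
by have := Ch_half DQ; rewrite -/(stopped Q) (volE fS) mule_volE.
Qed.

(** E_Q is Q without its stopping cubes. If two cubes of the tree meet at x, the one of lower level
    has a stopping cube containing x, so x is not in its E_Q. *)
Lemma tree_sparse : eta_sparse mu 2^-1 tree.
Proof.
exists (fun Q : cube X => Q `\` stopped Q); split.
- move=> Q /treeD DQ; apply: measurableD; first exact: dyadic_measurable DS _ DQ.
  exact: stopped_measurable.
- by move=> Q _ x [].
- move=> Q /treeD DQ; have fQ := dyadic_lty HT DS DQ.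
  have mQ := dyadic_measurable DS DQ; have mS := stopped_measurable DQ.
  have h := vol_stopped DQ; have := vol_setDI mQ mS fQ.
  rewrite (setIidr (stopped_sub DQ)) => e.
  have fD : (mu (Q `\` stopped Q) < +oo)%E.
    exact: (finite_sub (measurableD mQ mS) mQ (@subDsetl _ _ _) fQ).
  rewrite mule_volE// (volE fD) lee_fin; move: h e.
  by move: (vol mu Q) (vol mu (stopped Q)) (vol mu (_ `\` _)) => a b c; lra.
- move=> P Q [l _ lP] [l' _ lQ] [x [[Px nP] [Qx nQ]]].
  have [lt|lt|e] := ltngtP l l'.
  + by case: nP; have [P1] := tree_level_stopped lt lP lQ Px Qx; exists P1.
  + by case: nQ; have [P1] := tree_level_stopped lt lQ lP Qx Px; exists P1.
  + by subst l'; exact: tree_level_uniq lP lQ Px Qx.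
Qed.

(* A density point of the set where the tree does not terminate lies in
   arbitrarily small cubes of which that set fills at most one half. *)
Lemma tree_terminates :
  {ae mu, forall x, exists l, ~ (\bigcup_(Q in tree_level l) (Q : set X)) x}.
Proof.
pose Om l := \bigcup_(Q in tree_level l) (Q : set X).
pose Z := \bigcap_(l in [set: nat]) Om l.
have mOm l : measurable (Om l).
  apply: countable_bigcup_measurable.
    by apply: sub_countable (dyadic_countable HT DS); apply: subset_card_le => P /tree_levelD.
  by move=> P /tree_levelD DP; exact: dyadic_measurable DS _ DP.
have mZ : measurable Z by exact: bigcap_measurableType.
have half1 : (2^-1 : R) < 1 by rewrite invf_lt1// ltr1n.
apply: filterS (dyadic_density HT DS mZ half1) => x dens.
apply: contrapT => /forallNP nx.
have Zx : Z x by move=> l _; apply: contrapT => h; exact: (nx l).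
have [k0 hk0] := dens Zx.
have [P0 lP0 P0x] := Zx 0%N I.
have path l : exists2 P, tree_level l P /\ (P : set X) x & cube_gen P0 + l%:Z <= cube_gen P.
  elim: l => [|l [P [lP Px] gP]]; first by exists P0 => //; rewrite addr0.
  have [Q lQ Qx] := Zx l.+1 I.
  have [P1 CP1 P1x] := tree_level_stopped (ltnSn l) lP lQ Px Qx.
  have [_ g1 _] := ChP (tree_levelD lP) CP1.
  exists P1; first by split => //; exists P.
  by rewrite -(addn1 l) PoszD addrA lezD1; exact: le_lt_trans gP g1.
have [P [lP Px] gP] := path `|k0 - cube_gen P0|%N.
have DP := tree_levelD lP; have mP := dyadic_measurable DS DP.
have : 2^-1 * vol mu P < vol mu (P `&` Z).
  by apply: hk0 => //; apply: le_trans gP; rewrite -lerBlDl ler_normr lexx.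
apply/negP; rewrite -leNgt; apply: le_trans (vol_stopped DP); apply: vol_le.
- exact: measurableI.
- exact: stopped_measurable.
- move=> y [Py Zy]; have [Q lQ Qy] := Zy (`|k0 - cube_gen P0|%N).+1 I.
  exact: tree_level_stopped (ltnSn _) lP lQ Py Qy.
- exact: (finite_sub (stopped_measurable DP) mP (stopped_sub DP) (dyadic_lty HT DS DP)).
Qed.

(** Induction on the number of levels left until x drops out of the tree. At each level at most one
    cube contains x, so r lists the chain of cubes through x; generations increase strictly along
    it, so no cube is repeated. *)
Lemma tree_telescope (W : zmodType) (F G : cube X -> W) (x : X) (l : nat) :
  (forall P, tree P -> (P : set X) x -> ~ stopped P x -> F P = G P) ->
  (forall P Q, tree P -> (P : set X) x -> Ch P Q -> (Q : set X) x ->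
     F P - F Q = G P) ->
  ~ (\bigcup_(Q in tree_level l) (Q : set X)) x ->
  exists (r : seq (cube X)) (P : cube X),
    [/\ uniq r, forall Q, Q \in r <-> tree Q /\ (Q : set X) x,
        Rt P, (P : set X) x & F P = \sum_(Q <- r) G Q].
Proof.
move=> hF1 hF2 nl.
suff main j m P : tree_level j P -> (P : set X) x -> (j + m = l)%N ->
    exists r : seq (cube X), [/\ uniq r,
      forall Q, Q \in r <-> (exists2 i, (j <= i)%N & tree_level i Q) /\ (Q : set X) x &
      F P = \sum_(Q <- r) G Q].
  have [P RP Px] := Rt_cover x.
  have [r [ur hr FE]] := main 0%N l P RP Px (erefl _).
  exists r, P; split => // Q; rewrite hr; split => -[[i]]; first by move=> _ lQ Qx;
    split => //; exists i.
  by move=> _ lQ Qx; split => //; exists i.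
elim: m j P => [|m IH] j P lP Px jl.
  by exfalso; apply: nl; exists P => //; rewrite -jl addn0.
have tP : tree P by exists j.
have [[Q CQ Qx]|nS] := pselect (stopped P x); last first.
  exists [:: P]; split => //; last by rewrite big_seq1; exact: hF1.
  move=> Q; rewrite inE; split => [/eqP ->|[[i ji lQ] Qx]]; first by split => //; exists j.
  move: ji; rewrite leq_eqVlt => /predU1P[e|lt].
    by subst i; apply/eqP; exact: tree_level_uniq lQ lP Qx Px.
  by exfalso; apply: nS; have [P1] := tree_level_stopped lt lP lQ Px Qx; exists P1.
have lQ : tree_level j.+1 Q by exists P.
have [|r [ur hr FQ]] := IH j.+1 Q lQ Qx; first by rewrite -jl addSnnS.
exists (P :: r); split.
- rewrite /= ur andbT; apply/negP => /hr[[i ji lPi] _].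
  by have := tree_level_gen ji lP lPi Px Px; rewrite ltxx.
- move=> Q'; rewrite inE; split.
    move=> /orP[/eqP ->|/hr[[i ji lQ'] Q'x]]; first by split => //; exists j.
    by split => //; exists i => //; exact: ltnW.
  move=> [[i ji lQ'] Q'x]; move: ji; rewrite leq_eqVlt => /predU1P[e|lt].
    by subst i; rewrite (tree_level_uniq lQ' lP Q'x Px) eqxx.
  by apply/orP; right; apply/hr; split => //; exists i.
- by rewrite big_cons -FQ -(hF2 P Q)// subrK.
Qed.

End StoppingTree.

(** Partial sums are constant once the finite set contains r. *)
Lemma has_sum_finite (R : realType) (n : nat) (I : choiceType) (A : set I)
    (v : I -> 'rV[R]_n) (r : seq I) :
  uniq r -> (forall i, i \in r -> A i) ->
  (forall i, A i -> i \notin r -> v i = 0) ->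
  has_sum A v (\sum_(i <- r) v i).
Proof.
move=> ur rA v0; have FF := @summability.totally_filter I.
apply: cvg_near_cst; exists [fset i in r]%fset => //= B rB.
rewrite /summability.partial_sum -(big_seq_fsetE _ _ predT (patch (fun=> 0) A v)) /=.
rewrite -(big_fset_incl _ rB) /=; last first.
  move=> i _ ir; rewrite /patch; case: ifPn => // iA.
  by apply: v0; [rewrite inE in iA|move: ir; rewrite inE].
rewrite (perm_big r) /=; last first.
  by apply: uniq_perm => //= i; rewrite inE.
by rewrite !big_seq; apply: eq_bigr => i /rA Ai; rewrite /patch mem_set.
Qed.

Section SparseDomination.
Context (R : realType) (disp : measure_display) (X : measurableType disp).
Variables (d : X -> X -> R) (mu : {sigma_finite_measure set X -> \bar R}).
Variables (cd cmu : R).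
Hypothesis HT : homogeneous_type d mu cd cmu.
Variables (c0 C0 delta alpha : R) (D : set (cube X)).
Hypothesis DS : dyadic_system d c0 C0 delta D.
Hypothesis alpha_ge : 3 * cd ^+ 2 / delta <= alpha.

Local Notation dil := (cube_dilate d C0 delta alpha).

(** The tree uses the kernels of [vector_step] at every cube of D, and countability of D allows one
    null set for all of them. *)
Lemma sparse_domination (n : nat) : exists lam L : R, [/\ 0 < lam < 1, 0 < L &
  forall (s q r : R) (psi phi : R -> R) (T : (X -> R) -> (X -> R))
    (e : 'M[R]_n) (f : X -> 'rV[R]_n),
  1 <= q -> 1 <= r -> q <= s -> r <= s -> linear_operator d mu s T ->
  orthonormal_basis e ->
  operator_bound d mu s q T psi -> sharp_maximal_bound d mu s r alpha T phi ->
  0 <= psi lam -> 0 <= phi lam -> bounded_Lfun_rV d mu s f ->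
  exists (S : set (cube X)) (k : cube X -> X -> X -> R),
  [/\ S `<=` D, eta_sparse mu 2^-1 S,
      forall Q, D Q -> measurable_fun [set: X * X] (fun z : X * X => k Q z.1 z.2),
      forall Q x, D Q -> unit_dual mu s (dil Q) (k Q x) &
      {ae mu, forall x, exists2 F : seq (cube X),
        uniq F /\ (forall Q, Q \in F <-> S Q /\ (Q : set X) x) &
        vector_operator T e f x =
        (step_constant s lam L psi phi * n.+1%:R ^+ 2) *:
          \sum_(Q <- F) avg_rV mu (dil Q) (fun y => k Q x y *: f y)}]].
Proof.
have [lam [L [lam01 L0 step]]] := vector_step HT DS alpha_ge n.
exists lam, L; split => // s q r psi phi T e f q1 r1 qs rs linT eON boundT sharpT psi0 phi0 hf.
set C := step_constant s lam L psi phi * n.+1%:R ^+ 2.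
have [[c [rho [rho0 suppf]]] _ _] := hf.
have [Rt [RtD Rtdil Rt_uniq Rt_cover]] := dyadic_roots HT DS alpha_ge c rho0.
have /choice[Chk hChk] : forall P : cube X, exists Chk : set (cube X) * (X -> X -> R), D P ->
  [/\ (forall Q, Chk.1 Q ->
        [/\ D Q, cube_gen P < cube_gen Q & Q `<=` P]) /\
      (forall Q Q' x, Chk.1 Q -> Chk.1 Q' -> (Q : set X) x -> (Q' : set X) x -> Q = Q'),
      (mu (\bigcup_(Q in Chk.1) (Q : set X)) <= 2^-1%:E * mu P)%E,
      measurable_fun [set: X * X] (fun z : X * X => Chk.2 z.1 z.2),
      forall x, unit_dual mu s (dil P) (Chk.2 x) &
      {ae mu, forall x, (P : set X) x ->
        (~ (\bigcup_(Q in Chk.1) (Q : set X)) x ->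
          local_image d C0 delta alpha T e f P x =
          C *: avg_rV mu (dil P) (fun y => Chk.2 x y *: f y)) /\
        (forall Q, Chk.1 Q -> (Q : set X) x ->
          local_image d C0 delta alpha T e f P x - local_image d C0 delta alpha T e f Q x =
          C *: avg_rV mu (dil P) (fun y => Chk.2 x y *: f y))}].
  move=> P; have [DP|nDP] := pselect (D P); last by exists (set0, fun _ _ => 0).
  have [Ch [k h]] := step s q r psi phi T e f P q1 r1 qs rs linT eON boundT sharpT psi0
    phi0 hf DP.
  by exists (Ch, k).
pose Ch P := (Chk P).1; pose k P := (Chk P).2.
have ChP P Q : D P -> Ch P Q -> [/\ D Q, cube_gen P < cube_gen Q & Q `<=` P].
  by move=> DP; have [[h _] _ _ _ _] := hChk P DP; exact: h.
have Ch_uniq P Q Q' x : D P -> Ch P Q -> Ch P Q' -> (Q : set X) x -> (Q' : set X) x -> Q = Q'.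
  by move=> DP; have [[_ h] _ _ _ _] := hChk P DP; exact: h.
have Ch_half P : D P -> (mu (\bigcup_(Q in Ch P) (Q : set X)) <= 2^-1%:E * mu P)%E.
  by move=> DP; have [_ h _ _ _] := hChk P DP.
have SD : tree Rt Ch `<=` D by exact: treeD.
exists (tree Rt Ch), k; split => //.
- exact: (tree_sparse HT DS).
- by move=> Q DQ; have [_ _ h _ _] := hChk Q DQ.
- by move=> Q x DQ; have [_ _ _ h _] := hChk Q DQ; exact: h.
have aeS : {ae mu, forall x, forall P, D P -> (P : set X) x ->
    (~ stopped Ch P x -> local_image d C0 delta alpha T e f P x =
      C *: avg_rV mu (dil P) (fun y => k P x y *: f y)) /\
    (forall Q, Ch P Q -> (Q : set X) x ->
      local_image d C0 delta alpha T e f P x - local_image d C0 delta alpha T e f Q x =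
      C *: avg_rV mu (dil P) (fun y => k P x y *: f y))}.
  apply: ae_forall_countable; first exact: (dyadic_countable HT DS).
  by move=> P DP; have [_ _ _ _ h] := hChk P DP.
have aeT := tree_terminates HT DS RtD Rt_uniq ChP Ch_uniq Ch_half.
apply: filterS2 aeS aeT => x hx [l hl].
pose F P : 'rV[R]_n := local_image d C0 delta alpha T e f P x.
pose G P : 'rV[R]_n := C *: avg_rV mu (dil P) (fun y => k P x y *: f y).
have [|| |r' [P [ur hr RP Px FP]]] := tree_telescope RtD Rt_uniq Rt_cover ChP Ch_uniq (F :=
  F) (G := G) (x := x) (l := l).
- by move=> P /SD DP Px; have [h _] := hx P DP Px; exact: h.
- by move=> P Q /SD DP Px; have [_ h] := hx P DP Px; exact: h.
- exact: hl.
exists r'; first by [].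
(* The dilate of a root contains the support of f, so truncating f there changes nothing and the
   telescoped quantity at the root is T f(x) itself. *)
rewrite scaler_sumr -FP /F /local_image; congr (vector_operator T e _ x).
apply/funext => y; rewrite indicE.
have [yP|] := boolP (y \in dil P); first by rewrite scale1r.
rewrite notin_setE => ny; rewrite suppf ?scaler0//.
by move=> /(Rtdil P RP).
Qed.

Lemma normalized_kernel_unit_dual (s : R) (Q : cube X) (B : set X) (k : X -> X -> R) :
  1 <= s ->
  measurable_fun [set: X * X] (fun z : X * X => k z.1 z.2) ->
  (forall x, unit_dual mu s B (k x)) ->
  normalized_kernel mu (hoelder_conjugate s%:E) Q B k.
Proof.
move=> s1 mk uk; split; first exact: measurable_funTS.
apply/ess_supP; apply: aeW => x; rewrite indicE.
have [xQ|_] := boolP (x \in (Q : set X)); last by rewrite mule0.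
rewrite mule1; have [_ h] := uk x; rewrite gee0_abs//.
(* The essential supremum of a nonnegative function is known to be nonnegative only on a space of
   positive measure; it is needed to drop the absolute value around the inner norm. *)
have muX : (0 < mu [set: X])%E.
  apply: lt_le_trans (homogeneous_ball_gt0 HT x ltr01) _; apply: le_measure; rewrite ?inE//.
  exact: measurable_qball HT _ _.
case: (hoelder_conjugate s%:E) => [p| |]; rewrite /avg_norm.
- exact: poweR_ge0.
- by apply: ess_sup_gee => //; apply: aeW => y; rewrite mule_ge0// lee_fin.
- by apply: ess_sup_gee => //; apply: aeW => y; rewrite mule_ge0// lee_fin.
Qed.

End SparseDomination.

(** * Transfer to the adjacent systems *)

Section Enlarge.
Context (R : realType) (disp : measure_display) (X : measurableType disp).
Variable mu : {measure set X -> \bar R}.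
Variables (s C : R) (B B' : set X).
Hypotheses (s1 : 1 <= s) (C1 : 1 <= C) (mB : measurable B) (mB' : measurable B').
Hypotheses (BB' : B `<=` B') (fB' : (mu B' < +oo)%E) (B0 : 0 < vol mu B)
  (volB' : vol mu B' <= C * vol mu B).

Let fB : (mu B < +oo)%E. Proof. exact: (finite_sub mB mB' BB' fB'). Qed.
Let volBB' : vol mu B <= vol mu B'. Proof. exact: vol_le. Qed.
Let B'0 : 0 < vol mu B'. Proof. exact: lt_le_trans volBB'. Qed.
Let C0 : 0 < C. Proof. exact: lt_le_trans C1. Qed.

(** This factor replaces the normalization 1 / mu(B') by exactly 1 / (C mu(B)). It is at most 1
    because B' has at most C times the measure of B, so the dual norm is not increased. *)
Definition enlarge_factor : R := vol mu B' / (C * vol mu B).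

Lemma enlarge_factor_ge0 : 0 <= enlarge_factor.
Proof. by rewrite divr_ge0 ?vol_ge0// mulr_ge0 ?vol_ge0// ltW. Qed.

Lemma enlarge_factor_le1 : enlarge_factor <= 1.
Proof. by rewrite ler_pdivrMr ?mulr_gt0// mul1r. Qed.

Definition enlarge (phi : X -> R) : X -> R :=
  fun y => enlarge_factor * cutoff B phi y.

Lemma unit_dual_enlarge phi : unit_dual mu s B phi -> unit_dual mu s B' (enlarge phi).
Proof.
move=> uphi; have [mphi _] := uphi.
have c0 := enlarge_factor_ge0; have c1 := enlarge_factor_le1.
have mcut := measurable_cutoff mB mphi.
have me : measurable_fun [set: X] (enlarge phi) by exact: measurable_funM.
have le y : `|enlarge phi y| <= `|cutoff B phi y|.
  by rewrite normrM (ger0_norm c0) ler_piMl.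
have [sE|sN] := eqVneq s 1.
  apply/(unit_dual1 mu B' sE me).
  apply: filterS ((unit_dual1 mu B sE mphi).1 uphi) => y h _; apply: (le_trans (le y)).
  rewrite /cutoff indicE; have [yB|_] := boolP (y \in B); last by rewrite mulr0 normr0.
  by rewrite mulr1 h//; rewrite inE in yB.
have s_gt1 : 1 < s by rewrite lt_def sN.
apply/(unit_dualP s1 fB' B'0 s_gt1 me).
set p := s / (s - 1).
have p0 : 0 < p by rewrite divr_gt0 ?subr_gt0// (lt_le_trans ltr01).
apply: (@le_trans _ _ (pow_integral mu p [set: X] (cutoff B phi))).
  apply: (@le_trans _ _ (pow_integral mu p B' (cutoff B phi))); last exact: pow_integral_sub.
  apply: ge0_le_integral => //.
  - exact/measurable_funTS/measurable_norm_powR.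
  - exact/measurable_funTS/measurable_norm_powR.
  - move=> y _; rewrite lee_fin; apply: ge0_ler_powR; rewrite ?nnegrE ?(ltW p0)//.
rewrite pow_integral_cutoff//.
apply: (@le_trans _ _ (vol mu B)%:E); last by rewrite lee_fin.
exact: (unit_dualP s1 fB B0 s_gt1 mphi).1.
Qed.

Lemma avg_rV_enlarge (n : nat) (f : X -> 'rV[R]_n) phi :
  (forall l, mu.-integrable B (EFin \o (fun x => phi x * f x ord0 l))) ->
  avg_rV mu B' (fun y => enlarge phi y *: f y) =
  C^-1 *: avg_rV mu B (fun y => phi y *: f y).
Proof.
move=> iphi; apply/rowP => l; rewrite !mxE.
have -> : \int[mu]_(x in B') (enlarge phi x *: f x) ord0 l =
    enlarge_factor * \int[mu]_(x in B) (phi x * f x ord0 l).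
  rewrite -RintegralZl// /Rintegral -[in RHS](setIidr BB') integral_mkcondr.
  congr fine; apply: eq_integral => x _; rewrite patchE mxE /enlarge /cutoff indicE.
  by case: ifPn => _; rewrite ?mulr1 ?mulrA// !mulr0 mul0r.
have -> : \int[mu]_(x in B) (phi x *: f x) ord0 l = \int[mu]_(x in B) (phi x * f x ord0 l).
  by apply: eq_Rintegral => x _; rewrite mxE.
rewrite /enlarge_factor -/(vol mu B') -/(vol mu B).
by field; rewrite !gt_eqF.
Qed.

End Enlarge.

Section Transfer.
Context (R : realType) (disp : measure_display) (X : measurableType disp).
Variables (d : X -> X -> R) (mu : {sigma_finite_measure set X -> \bar R}).
Variables (cd cmu : R).
Hypothesis HT : homogeneous_type d mu cd cmu.
Variables (c0 C0 delta alpha : R) (D : set (cube X)).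
Hypothesis DS : dyadic_system d c0 C0 delta D.
Hypothesis alpha_ge : 3 * cd ^+ 2 / delta <= alpha.

Local Notation dil := (cube_dilate d C0 delta alpha).

Variables (c1 C1 delta1 C : R) (N m : nat) (D' : nat -> set (cube X)).
Hypotheses (N0 : (0 < N)%N) (C_ge1 : 1 <= C).
Hypothesis DS' : forall j, dyadic_system d c1 C1 delta1 (D' j).
Hypothesis adj : forall Q, D Q -> exists j (Q' : cube X),
  [/\ (j <= m)%N, D' j Q', cube_gen Q' = (cube_gen Q %/ N)%Z - 1,
      dil Q `<=` Q' &
      vol mu Q' <= C * vol mu (qball d (cube_center Q) (c0 * delta ^ cube_gen Q))].

(* The index also records the residue mod N of the generation of Q, so that
   cubes sent to the same cube of the same system have equal generations and
   are therefore disjoint. *)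
Lemma sparse_transfer (n : nat) (s : R) (f : X -> 'rV[R]_n)
    (S : set (cube X)) (k : cube X -> X -> X -> R) :
  1 <= s -> bounded_Lfun_rV d mu s f -> S `<=` D -> eta_sparse mu 2^-1 S ->
  (forall Q, D Q -> measurable_fun [set: X * X] (fun z : X * X => k Q z.1 z.2)) ->
  (forall Q x, D Q -> unit_dual mu s (dil Q) (k Q x)) ->
  exists (S' : 'I_(m.+1 * N).+1 -> set (cube X))
         (k' : 'I_(m.+1 * N).+1 -> cube X -> X -> X -> R),
  [/\ forall i, S' i `<=` D' (i %/ N)%N, forall i, sparse mu (S' i),
      forall i Q, S' i Q ->
        normalized_kernel mu (hoelder_conjugate s%:E) Q Q (k' i Q) &
      forall x (F : seq (cube X)), uniq F ->
        (forall Q, Q \in F <-> S Q /\ (Q : set X) x) ->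
        exists2 w : 'I_(m.+1 * N).+1 -> 'rV[R]_n,
          forall i, has_sum (S' i) (fun Q => \1_(Q : set X) x *:
            avg_rV mu Q (fun y => k' i Q x y *: f y)) (w i) &
          \sum_(Q <- F) avg_rV mu (dil Q) (fun y => k Q x y *: f y) =
          C *: \sum_i w i].
Proof.
move=> s1 hf SD [E [mE EQ hE trE]] mk uk.
have C_gt0 : 0 < C by exact: lt_le_trans C_ge1.
have mdil Q : measurable (dil Q) by exact: (measurable_dilate HT).
have dil0 Q : 0 < vol mu (dil Q) by exact: (dilate_vol_gt0 HT DS alpha_ge).
have /choice[ad had] : forall Q, exists p : nat * cube X, D Q ->
  [/\ (p.1 <= m)%N, D' p.1 p.2, cube_gen p.2 = (cube_gen Q %/ N)%Z - 1,
      dil Q `<=` p.2 & vol mu p.2 <= C * vol mu (qball d (cube_center Q) (c0 * delta ^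
        cube_gen Q))].
  move=> Q; have [DQ|nDQ] := pselect (D Q); last by exists (0%N, Q).
  by have [j [Q' h]] := adj DQ; exists (j, Q').
pose res (Q : cube X) := `|(cube_gen Q %% N)%Z|%N.
have Nz : (0 < (N : int)) by rewrite ltz_nat.
have res0 (Q : cube X) : 0 <= (cube_gen Q %% N)%Z by rewrite modz_ge0// gt_eqF.
have resN Q : (res Q < N)%N.
  by rewrite -ltz_nat /res gez0_abs// ltz_pmod.
(* The index encodes color and residue as color N + residue, so division by N recovers the
   system. *)
pose idx Q : 'I_(m.+1 * N).+1 := inord ((ad Q).1 * N + res Q).
have idxE Q : D Q -> idx Q = ((ad Q).1 * N + res Q)%N :> nat.
  move=> DQ; rewrite inordK// ltnS; have [jm _ _ _ _] := had Q DQ.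
  apply: (@leq_trans ((ad Q).1 * N + N)); first by rewrite leq_add2l ltnW.
  by rewrite -mulSnr leq_mul2r ltnS jm orbT.
have idx_div Q : D Q -> (idx Q %/ N)%N = (ad Q).1.
  by move=> DQ; rewrite idxE// divnMDl// divn_small// addn0.
have ad_inj Q1 Q2 x : D Q1 -> D Q2 -> idx Q1 = idx Q2 -> (ad Q1).2 = (ad Q2).2 ->
    (Q1 : set X) x -> (Q2 : set X) x -> Q1 = Q2.
  move=> DQ1 DQ2 ei ea Q1x Q2x; apply: (dyadic_uniq DS DQ1 DQ2 _ Q1x Q2x).
  have er : res Q1 = res Q2.
    have : (idx Q1 %% N = idx Q2 %% N)%N by rewrite ei.
    by rewrite !idxE// !modnMDl !modn_small.
  have eq : (cube_gen Q1 %/ N)%Z = (cube_gen Q2 %/ N)%Z.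
    have [_ _ g1 _ _] := had _ DQ1; have [_ _ g2 _ _] := had _ DQ2.
    by apply: (addIr (-1)); rewrite -g1 -g2 ea.
  rewrite (divz_eq (cube_gen Q1) N) (divz_eq (cube_gen Q2) N) eq.
  by congr (_ + _); rewrite -(gez0_abs (res0 Q1)) -(gez0_abs (res0 Q2)) -/(res Q1) er.
pose fib i Q' := [set Q | [/\ S Q, idx Q = i & (ad Q).2 = Q']].
have fibD i Q' Q : fib i Q' Q -> D Q by move=> [/SD].
pose S' i := [set Q' | fib i Q' !=set0].
have S'D i Q' : S' i Q' -> D' (i %/ N)%N Q'.
  move=> [Q [SQ <- <-]]; have DQ := SD _ SQ; rewrite idx_div//.
  by have [] := had Q DQ.
have mQ' i Q' : S' i Q' -> measurable (Q' : set X).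
  by move=> /S'D h; exact: dyadic_measurable (DS' _) _ h.
have fQ' i Q' : S' i Q' -> (mu Q' < +oo)%E.
  by move=> /S'D h; exact: (dyadic_lty HT (DS' _) h).
have fib_sub i Q' Q : fib i Q' Q -> dil Q `<=` Q'.
  by move=> [/SD DQ _ <-]; have [] := had Q DQ.
have fib_vol i Q' Q : fib i Q' Q -> vol mu Q' <= C * vol mu Q.
  move=> [/SD DQ _ <-]; have [_ _ _ _ /le_trans] := had Q DQ; apply.
  by rewrite ler_pM2l//; exact: (dyadic_vol_ge HT DS).
have fib_vold i Q' Q : fib i Q' Q -> vol mu Q' <= C * vol mu (dil Q).
  move=> hQ; apply: (le_trans (fib_vol _ _ _ hQ)); rewrite ler_pM2l//.
  have DQ := fibD _ _ _ hQ; apply: vol_le => //; last exact: (dilate_lty HT).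
    exact: dyadic_measurable DS _ DQ.
  exact: (sub_dilate HT DS alpha_ge).
have fib_uniq i Q' Q1 Q2 x : fib i Q' Q1 -> fib i Q' Q2 ->
    (Q1 : set X) x -> (Q2 : set X) x -> Q1 = Q2.
  move=> h1 h2; apply: ad_inj; [exact: fibD h1|exact: fibD h2| |].
    by case: h1 h2 => _ -> _ [].
  by case: h1 h2 => _ _ -> [].
pose at_ i Q' x := fib i Q' `&` [set Q | (Q : set X) x].
pose pk i (Q' : cube X) x := xget Q' (at_ i Q' x).
(* Several cubes of S may be sent to Q'. They are disjoint for a fixed index, so their kernels are
   glued along the first variable, and the result is zero where no such cube contains x. *)
pose k' i (Q' : cube X) x : X -> R :=
  if `[< at_ i Q' x !=set0 >] then
    enlarge mu C (dil (pk i Q' x)) Q' (k (pk i Q' x) x) else fun=> 0.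
have k'E i Q' Q x : fib i Q' Q -> (Q : set X) x ->
    k' i Q' x = enlarge mu C (dil Q) Q' (k Q x).
  move=> hQ Qx; have ex : at_ i Q' x !=set0 by exists Q.
  rewrite /k' asboolT//; have [h1 h2] := xgetPex Q' ex.
  by rewrite /pk (fib_uniq i Q' (xget Q' (at_ i Q' x)) Q x).
have k'0 i Q' x : ~ (at_ i Q' x !=set0) -> k' i Q' x = fun=> 0.
  by move=> h; rewrite /k' asboolF.
have cfib i Q' : countable (fib i Q').
  by apply: sub_countable (dyadic_countable HT DS); apply: subset_card_le => Q /fibD.
have mk' i Q' : S' i Q' -> measurable_fun [set: X * X] (fun z : X * X => k' i Q' z.1 z.2).
  move=> S'Q'.
  pose U := \bigcup_(Q in fib i Q') ((Q : set X) `*` [set: X]).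
  have mQX Q : fib i Q' Q -> measurable ((Q : set X) `*` [set: X]).
    by move=> /fibD DQ; apply: measurableX => //; exact: dyadic_measurable DS _ DQ.
  have mU : measurable U by exact: countable_bigcup_measurable.
  rewrite -(setUv U); apply/measurable_funU => //; first exact: measurableC.
  split.
    apply: measurable_fun_countable_cover => // Q hQ.
    apply: (eq_measurable_fun (fun z : X * X => enlarge mu C (dil Q) Q' (k Q z.1) z.2)).
      by move=> [x y]; rewrite inE => -[/= Qx _]; rewrite (k'E _ _ Q).
    apply: measurable_funTS; rewrite /enlarge /cutoff; apply: measurable_funM => //.
    apply: measurable_funM; first exact: mk (fibD _ _ _ hQ).
    apply: (measurableT_comp _ measurable_snd); exact: measurable_indic.
  apply: (eq_measurable_fun (cst (0 : R))); last exact: measurable_cst.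
  move=> [x y]; rewrite inE => nU /=; rewrite k'0// => -[Q [hQ Qx]].
  by apply: nU; exists Q.
have uk' i Q' x : S' i Q' -> unit_dual mu s Q' (k' i Q' x).
  move=> S'Q'; have V'0 : 0 < vol mu Q' by exact: (dyadic_vol_gt0 HT (DS' _) (S'D _ _ S'Q')).
  have [[Q [hQ Qx]]|nat_] := pselect (at_ i Q' x !=set0).
    rewrite (k'E _ _ Q)//; apply: unit_dual_enlarge => //.
    - exact: mQ' S'Q'.
    - exact: fib_sub hQ.
    - exact: fQ' S'Q'.
    - exact: fib_vold hQ.
    - exact: uk (fibD _ _ _ hQ).
  (* The zero function is treated as an empty combination. *)
  rewrite k'0// (_ : (fun=> 0) = fun y : X => \sum_(i < 0) (0 : R) * (fun=> (0 : R)) y);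
    last first.
    by apply/funext => y; rewrite big_ord0.
  by apply: (unit_dual_comb s1 (mQ' _ _ S'Q') (fQ' _ _ S'Q') V'0 (leqnn 0)) => -[].
exists S', k'; split => //.
- move=> i; exists (2 * C)^-1.
    have C2 : 1 < 2 * C by move: C_ge1; lra.
    by rewrite invr_gt0 invf_lt1 (lt_trans ltr01 C2).
  (* One preimage of each Q' lends its set E; passing from Q to Q' multiplies the measure by at most
     C, whence the sparseness constant 1 / (2 C). *)
  pose sel (Q' : cube X) := xget Q' (fib i Q').
  have selP Q' : S' i Q' -> fib i Q' (sel Q') by move=> h; exact: xgetPex.
  have selS Q' : S' i Q' -> S (sel Q') by move=> /selP[].
  exists (E \o sel); split => /=.
  + by move=> Q' /selS; exact: mE.
  + move=> Q' S'Q'; apply: subset_trans (EQ _ (selS _ S'Q')) _.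
    apply: subset_trans (fib_sub _ _ _ (selP _ S'Q')).
    exact: (sub_dilate HT DS alpha_ge (fibD _ _ _ (selP _ S'Q'))).
  + move=> Q' S'Q'; apply: le_trans (hE _ (selS _ S'Q')).
    have h := fib_vol _ _ _ (selP _ S'Q').
    have DQ := fibD _ _ _ (selP _ S'Q').
    rewrite (mule_volE _ (fQ' _ _ S'Q')) (mule_volE _ (dyadic_lty HT DS DQ)).
    rewrite lee_fin invfM -mulrA ler_pM2l ?invr_gt0//.
    by rewrite ler_pdivrMl.
  + move=> P Q S'P S'Q PQ.
    have e := trE _ _ (selS _ S'P) (selS _ S'Q) PQ.
    have [_ _ <-] := selP _ S'P; have [_ _ <-] := selP _ S'Q.
    by rewrite e.
- move=> i Q S'Q; apply: (normalized_kernel_unit_dual HT Q s1 (mk' _ _ S'Q)) => x.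
  exact: uk'.
move=> x F uF hF.
(* Only the images of the cubes of S through x contribute at x, and for a fixed index distinct cubes
   through x have distinct images; so the sum over F splits by index without repetition. *)
pose Fi i := [seq (ad Q).2 | Q <- F & idx Q == i].
have FS Q : Q \in F -> S Q by move=> /hF[].
have Fx Q : Q \in F -> (Q : set X) x by move=> /hF[].
pose term i (Q' : cube X) := \1_(Q' : set X) x *: avg_rV mu Q' (fun y => k' i Q' x y *: f y).
exists (fun i => \sum_(Q' <- Fi i) term i Q').
  move=> i; apply: has_sum_finite.
  - rewrite map_inj_in_uniq ?filter_uniq// => Q1 Q2.
    rewrite !mem_filter => /andP[/eqP i1 F1] /andP[/eqP i2 F2] ea.
    by apply: (ad_inj Q1 Q2 x); rewrite ?i1 ?i2//;
      [exact/SD/FS|exact/SD/FS|exact: Fx|exact: Fx].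
  - move=> Q' /mapP[Q]; rewrite mem_filter => /andP[/eqP iQ FQ] ->.
    by exists Q; split => //; exact: FS.
  - move=> Q' S'Q' nQ'; rewrite /term k'0.
      rewrite (_ : avg_rV _ _ _ = 0) ?scaler0//; apply/rowP => l; rewrite !mxE.
      rewrite /Rintegral; under eq_integral do rewrite scale0r mxE.
      by rewrite integral0 mulr0.
    move=> [Q [[SQ iQ eQ] Qx]]; move/negP: nQ'; apply; apply/mapP; exists Q => //.
    by rewrite mem_filter iQ eqxx; apply/hF.
rewrite (partition_big idx xpredT)//= scaler_sumr; apply: eq_bigr => i _.
rewrite big_map big_filter scaler_sumr big_seq_cond [RHS]big_seq_cond.
apply: eq_bigr => Q /andP[FQ /eqP iQ].
have hQ : fib i (ad Q).2 Q by split => //; exact: FS.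
have S'Q' : S' i (ad Q).2 by exists Q.
have Qx := Fx Q FQ; have DQ := fibD _ _ _ hQ.
rewrite /term (k'E _ _ Q)// indicE mem_set ?scale1r; last first.
  by apply: (fib_sub _ _ _ hQ); exact: (sub_dilate HT DS alpha_ge).
rewrite avg_rV_enlarge//.
- by rewrite scalerA divff ?scale1r// gt_eqF.
- exact: mQ' S'Q'.
- exact: fib_sub hQ.
- exact: fQ' S'Q'.
- move=> l; apply: (unit_dual_coord_integrable s1 hf (mdil Q) _ (dil0 Q));
  first exact: (dilate_lty HT).
  exact: uk.
Qed.

End Transfer.

Theorem theorem1 (R : realType) (disp : measure_display)
    (X : measurableType disp) (d : X -> X -> R)
    (mu : {sigma_finite_measure set X -> \bar R}) (cd cmu : R)
    (c0 C0 delta : R) (D : set (cube X)) (alpha : R) (n : nat) :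
  homogeneous_type d mu cd cmu ->
  dyadic_system d c0 C0 delta D ->
  3 * cd ^+ 2 / delta <= alpha ->
  exists (cnd cnd' : R) (c0' C0' delta' : R) (m : nat)
         (D' : 'I_m -> set (cube X)),
  [/\ 0 < cnd, 0 < cnd', (0 < m)%N,
      (forall j, dyadic_system d c0' C0' delta' (D' j))
    & forall (s : R) (psi phi : R -> R),
      nonincreasing_01 psi -> nonincreasing_01 phi ->
      exists cT cT' : R, [/\ 0 <= cT, 0 <= cT' &
      forall (q r : R) (T : (X -> R) -> (X -> R)) (e : 'M[R]_n)
             (f : X -> 'rV[R]_n),
        1 <= q -> 1 <= r -> s = Num.max q r ->
        linear_operator d mu s T ->
        orthonormal_basis e ->
        operator_bound d mu s q T psi ->
        sharp_maximal_bound d mu s r alpha T phi ->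
        bounded_Lfun_rV d mu s f ->
        (exists S : set (cube X),
          [/\ S `<=` D,
              eta_sparse mu 2^-1 S,
              {ae mu, forall x,
                scale_set (cnd * cT)
                  (minkowski_sum S (fun Q =>
                     scale_set (\1_(Q : set X) x)
                       (convex_body mu s (cube_dilate d C0 delta alpha Q) f)))
                  (vector_operator T e f x)}
            & exists k : cube X -> X -> X -> R,
              (forall Q, S Q ->
                 normalized_kernel mu (hoelder_conjugate s%:E)
                   Q (cube_dilate d C0 delta alpha Q) (k Q)) /\
              {ae mu, forall x, exists2 w : 'rV[R]_n,
                has_sum S (fun Q => \1_(Q : set X) x *:
                    avg_rV mu (cube_dilate d C0 delta alpha Q)
                      (fun y => k Q x y *: f y)) w
                & vector_operator T e f x = (cnd * cT) *: w}])
        /\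
        (exists S' : 'I_m -> set (cube X),
          [/\ (forall j, S' j `<=` D' j),
              (forall j, sparse mu (S' j))
            & exists k : 'I_m -> cube X -> X -> X -> R,
              (forall j Q, S' j Q ->
                 normalized_kernel mu (hoelder_conjugate s%:E) Q Q (k j Q)) /\
              {ae mu, forall x, exists2 w : 'I_m -> 'rV[R]_n,
                forall j, has_sum (S' j) (fun Q => \1_(Q : set X) x *:
                    avg_rV mu Q (fun y => k j Q x y *: f y)) (w j)
                & vector_operator T e f x = (cnd' * cT') *: \sum_j w j}])]].
Proof.
move=> HT DS alpha_ge.
have [lam [L [lam01 L0 dom]]] := sparse_domination HT DS alpha_ge n.
have a0 := ltW (dilate_factor_gt0 HT DS alpha_ge).
have [c1 [C1 [delta1 [N [m [D' [C [N0 C_ge1 DS' adj]]]]]]]] := adjacent_systems HT DS a0.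
(* The level lam and the factor (n + 1)^2 enter through [cT], which leaves 1 for the first
   representation; the second only picks up the volume ratio C from the enlargement of the
   dilates. *)
exists 1, C, c1, C1, delta1, (m.+1 * N).+1, (fun i => D' (i %/ N)%N).
split => //; first exact: lt_le_trans C_ge1.
move=> s psi phi [psi_ge0 _] [phi_ge0 _].
have psi0 := psi_ge0 _ lam01; have phi0 := phi_ge0 _ lam01.
pose cT := step_constant s lam L psi phi * n.+1%:R ^+ 2.
have cT0 : 0 <= cT.
  rewrite mulr_ge0 ?exprn_ge0// /step_constant !addr_ge0// mulr_ge0// !addr_ge0 ?powR_ge0//.
  by rewrite mulr_ge0 ?powR_ge0// ltW.
exists cT, cT; split => // q r T e f q1 r1 sE linT eON boundT sharpT hf.
have qs : q <= s by rewrite sE le_max lexx.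
have rs : r <= s by rewrite sE le_max lexx orbT.
have s1 : 1 <= s by exact: le_trans qs.
have [S [k [SD sparseS mk uk aeF]]] :=
  dom s q r psi phi T e f q1 r1 qs rs linT eON boundT sharpT psi0 phi0 hf.
pose v Q x := avg_rV mu (cube_dilate d C0 delta alpha Q) (fun y => k Q x y *: f y).
have sumS x F : uniq F -> (forall Q, Q \in F <-> S Q /\ (Q : set X) x) ->
    has_sum S (fun Q => \1_(Q : set X) x *: v Q x) (\sum_(Q <- F) v Q x).
  move=> uF hF.
  have -> : \sum_(Q <- F) v Q x = \sum_(Q <- F) \1_(Q : set X) x *: v Q x.
    rewrite big_seq [RHS]big_seq; apply: eq_bigr => Q /hF[_ Qx].
    by rewrite indicE mem_set// scale1r.
  apply: has_sum_finite => // [Q /hF[]//|Q SQ /negP nQ].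
  rewrite indicE memNset ?scale0r// => Qx.
  by apply: nQ; apply/hF.
split.
  exists S; split => //.
    apply: filterS aeF => x [F [uF hF] TE].
    exists (\sum_(Q <- F) v Q x); last by rewrite mul1r TE.
    exists (fun Q : cube X => \1_(Q : set X) x *: v Q x); last exact: sumS.
    move=> Q /SD DQ; exists (v Q x) => //.
    have [mkx nkx] := uk Q x DQ; exists (k Q x); split => //.
    exact: measurable_funTS.
  exists k; split.
    move=> Q /SD DQ; apply: (normalized_kernel_unit_dual HT Q s1 (mk Q DQ)) => x.
    exact: uk.
  apply: filterS aeF => x [F [uF hF] TE].
  by exists (\sum_(Q <- F) v Q x); [exact: sumS|rewrite mul1r TE].
have [S' [k' [S'D sparseS' nk' tr]]] :=
  sparse_transfer HT DS alpha_ge N0 C_ge1 DS' adj s1 hf SD sparseS mk uk.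
exists S'; split => //; exists k'; split => //.
apply: filterS aeF => x [F [uF hF] TE].
have [w hw wE] := tr x F uF hF.
by exists w => //; rewrite TE wE scalerA -/cT mulrC.
Qed.
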